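(* Suppose that $M_+$ is an open dense submanifold in a compact connected conformal manifold $(M^d,\boldsymbol{c})$, $d=n+1\ge3$, possibly with boundary, and that one of the following two possibilities holds: (1) $M$ is a manifold with boundary $\partial M$ and $M\setminus M_+=\partial M$; or (2) $M$ is closed and $M\setminus M_+$ is contained in a smoothly embedded submanifold of $M$ of codimension at least $2$. Suppose also that $g_+$ is a geodesically complete Einstein, but not Ricci flat, pseudo-Riemannian metric on $M_+$ such that on $M_+$ the conformal structure $[g_+]$ coincides with the restriction of $\boldsymbol{c}$. Then either (a) $M_+$ is closed and $M_+=M$; or (b) we are in setting (1), with $M\setminus M_+$ the smooth $n$-dimensional boundary of $M$.
   Context: All objects are smooth. A conformal manifold $(M^d,\boldsymbol{c})$, $d\ge 3$, is a $d$-manifold (here possibly with boundary, the conformal structure being smooth up to the boundary) with an equivalence class $\boldsymbol{c}$ of pseudo-Riemannian metrics of some fixed signature, where $\widehat g\sim g$ iff $\widehat g=\Omega^2 g$ for a smooth function $\Omega>0$. $[g]$ is the conformal class of $g$. Closed manifold means compact without boundary. A metric $g$ is Einstein if $\mathrm{Ric}^g=\lambda g$ for some (necessarily locally constant) function $\lambda$. *)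

(* Defs.v *)
From mathcomp Require Import all_boot all_order all_algebra.
From mathcomp Require Import all_classical all_reals all_analysis.

Set Implicit Arguments.
Unset Strict Implicit.
Unset Printing Implicit Defensive.

Import Order.TTheory GRing.Theory Num.Theory.
Import numFieldNormedType.Exports.

Local Open Scope classical_set_scope.
Local Open Scope ring_scope.

Section EuclideanCalculus.
Context {R : realType} {n : nat}.
Local Notation E := 'rV[R]_n.+1.

Definition partial (i : 'I_n.+1) (f : E -> R) : E -> R :=
  fun y => 'D_(delta_mx 0 i) f y.

Definition iter_partial (s : seq 'I_n.+1) (f : E -> R) : E -> R :=
  foldr partial f s.

(* C^infinity on an open set: all iterated partial derivatives exist and are
   continuous. *)
Definition smooth_on (V : set E) (f : E -> R) : Prop :=
  forall (s : seq 'I_n.+1) (y : E), V y ->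
    {for y, continuous (iter_partial s f)} /\
    forall i : 'I_n.+1, derivable (iter_partial s f) y (delta_mx 0 i).

(* Smoothness on an arbitrary subset (in practice relatively open in the
   half-space): locally the restriction of a smooth function. *)
Definition smooth_in (A : set E) (f : E -> R) : Prop :=
  forall y, A y -> exists (V : set E) (F : E -> R),
    [/\ open V, V y, smooth_on V F & forall z, V z -> A z -> f z = F z].

Definition smooth_map_on (V : set E) (f : E -> E) : Prop :=
  forall k, smooth_on V (fun y => f y 0 k).

Definition smooth_map_in (A : set E) (f : E -> E) : Prop :=
  forall k, smooth_in A (fun y => f y 0 k).

Definition half_space : set E := [set y | 0 <= y 0 ord0].

End EuclideanCalculus.

Section LocalGeometry.
Context {R : realType} {n : nat}.
Local Notation E := 'rV[R]_n.+1.
Implicit Types (G : E -> 'M[R]_n.+1) (y : E) (i j k l : 'I_n.+1).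

(* [christoffel G k i j] is Gamma^k_{ij} for the metric with components [G]. *)
Definition christoffel G k i j : E -> R := fun y =>
  2^-1 * \sum_l invmx (G y) k l *
    (partial i (fun z => G z j l) y + partial j (fun z => G z i l) y
     - partial l (fun z => G z i j) y).

(* Ric_{ij} = d_k Gamma^k_{ij} - d_j Gamma^k_{ik}
              + Gamma^k_{kl} Gamma^l_{ij} - Gamma^k_{jl} Gamma^l_{ik}. *)
Definition ricci G y : 'M[R]_n.+1 := \matrix_(i, j)
  \sum_k (partial k (christoffel G k i j) y
          - partial j (christoffel G k i k) y
          + \sum_l (christoffel G k k l y * christoffel G l i j y
                    - christoffel G k j l y * christoffel G l i k y)).

(* Signature (p, n.+1 - p). Symmetry and nondegeneracy are consequences. *)
Definition has_signature (p : nat) (A : 'M[R]_n.+1) : Prop :=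
  exists2 P : 'M[R]_n.+1, P \in unitmx &
    P *m A *m P^T = diag_mx (\row_(i < n.+1) (if (i < p)%N then 1 else -1)).

End LocalGeometry.

Section Manifolds.
Context {R : realType} {n : nat} {M : topologicalType}.
Local Notation E := 'rV[R]_n.+1.

(* [pnt] is the inverse of [coord] on its image; both functions are
   unspecified elsewhere. *)
Record chart := Chart {
  dom : set M;
  coord : M -> E;
  pnt : E -> M }.

Definition is_chart (phi : chart) : Prop :=
  [/\ open (dom phi),
      (exists2 O : set E, open O & coord phi @` dom phi = half_space `&` O),
      {within dom phi, continuous (coord phi)},
      (forall x, dom phi x -> pnt phi (coord phi x) = x) &
      {within coord phi @` dom phi, continuous (pnt phi)}].

Definition overlap (phi psi : chart) : set E :=
  coord phi @` (dom phi `&` dom psi).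

Definition transition (phi psi : chart) : E -> E :=
  fun y => coord psi (pnt phi y).

Definition compatible (phi psi : chart) : Prop :=
  smooth_map_in (overlap phi psi) (transition phi psi) /\
  smooth_map_in (overlap psi phi) (transition psi phi).

(* Structure of smooth (n+1)-manifold, possibly with boundary, given by its
   maximal atlas. *)
Record manifold := Manifold {
  atlas : set chart;
  manifold_hausdorff : hausdorff_space M;
  manifold_second_countable : @second_countable M;
  atlas_chart : forall phi, atlas phi -> is_chart phi;
  atlas_cover : forall x : M, exists2 phi, atlas phi & dom phi x;
  atlas_compatible : forall phi psi, atlas phi -> atlas psi ->
    compatible phi psi;
  atlas_maximal : forall phi, is_chart phi ->
    (forall psi, atlas psi -> compatible phi psi) -> atlas phi }.

Variable X : manifold.

Definition boundary : set M :=
  [set x | exists phi, [/\ atlas X phi, dom phi x & coord phi x 0 ord0 = 0]].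

(* An open subset, with the induced structure, is a closed manifold. *)
Definition closed_manifold (W : set M) : Prop :=
  compact W /\ boundary `&` W = set0.

(* Local slice condition: in suitable charts of the maximal atlas, S is given
   by fixing k of the coordinates. The constants are arbitrary since our charts
   take values in the half-space; the boundary is the case k = 1, y_0 = 0. *)
Definition embedded_submanifold (k : nat) (S : set M) : Prop :=
  forall x, S x -> exists (phi : chart) (I : {set 'I_n.+1}) (c : E),
    [/\ atlas X phi, dom phi x, #|I| = k &
        forall z, dom phi z ->
          (S z <-> forall i, i \in I -> coord phi z 0 i = c 0 i)].

Definition smooth_function (W : set M) (f : M -> R) : Prop :=
  forall phi, atlas X phi ->
    smooth_in (coord phi @` (dom phi `&` W)) (fun y => f (pnt phi y)).

(* Covariant 2-tensor fields, given by their component matrices in each chart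
   at each point of its domain. *)
Definition tensor2 := chart -> M -> 'M[R]_n.+1.
Implicit Types (g h : tensor2) (W : set M).

Definition components g (phi : chart) : E -> 'M[R]_n.+1 :=
  fun y => g phi (pnt phi y).

(* Transformation law. At boundary points the differential of the transition
   map is that of any smooth extension F. The library's Jacobian acts on row
   vectors. *)
Definition tensorial W g : Prop :=
  forall phi psi x, atlas X phi -> atlas X psi ->
    W x -> dom phi x -> dom psi x ->
  forall (V : set E) (F : E -> E),
    open V -> V (coord phi x) -> smooth_map_on V F ->
    (forall y, V y -> overlap phi psi y -> F y = transition phi psi y) ->
  g phi x = 'J F (coord phi x) *m g psi x *m ('J F (coord phi x))^T.

(* Pseudo-Riemannian metrics of signature (p, n.+1 - p) on an open subset W,
   smooth up to the boundary points of M contained in W. *)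
Definition metric (p : nat) W g : Prop :=
  [/\ tensorial W g,
      (forall phi, atlas X phi -> forall i j,
         smooth_in (coord phi @` (dom phi `&` W))
                   (fun y => components g phi y i j)) &
      (forall phi x, atlas X phi -> W x -> dom phi x ->
         has_signature p (g phi x))].

Definition conformal W g h : Prop :=
  exists Omega : M -> R,
    [/\ smooth_function W Omega,
        (forall x, W x -> 0 < Omega x) &
        (forall phi x, atlas X phi -> W x -> dom phi x ->
           h phi x = Omega x ^+ 2 *: g phi x)].

Definition conformal_class (p : nat) W g : set tensor2 :=
  [set h | metric p W h /\ conformal W g h].

Definition conformal_structure (p : nat) (c : set tensor2) : Prop :=
  exists2 g, metric p setT g & c = conformal_class p setT g.

(* The conformal structure on W determined by the restrictions of the metrics
   in c. *)
Definition conformal_restriction (p : nat) (c : set tensor2) W : set tensor2 :=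
  [set h | exists2 g, c g & conformal_class p W g h].

(* The next notions are computed with two-sided partial derivatives, so they
   are meaningful for open W disjoint from the boundary. *)
Definition ricci_tensor g : tensor2 :=
  fun phi x => ricci (components g phi) (coord phi x).

Definition einstein W g : Prop :=
  exists lambda : M -> R,
  forall phi x, atlas X phi -> W x -> dom phi x ->
    ricci_tensor g phi x = lambda x *: g phi x.

Definition ricci_flat W g : Prop :=
  forall phi x, atlas X phi -> W x -> dom phi x -> ricci_tensor g phi x = 0.

Definition curve_coord (phi : chart) (gamma : R -> M) (k : 'I_n.+1) : R -> R :=
  fun t => coord phi (gamma t) 0 k.

(* Affinely parametrised geodesics in W on the open set of times J. *)
Definition geodesic W g (J : set R) (gamma : R -> M) : Prop :=
  (forall t, J t -> W (gamma t) /\ {for t, continuous gamma}) /\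
  forall phi t, atlas X phi -> J t -> dom phi (gamma t) ->
  forall k : 'I_n.+1,
    [/\ derivable (curve_coord phi gamma k) t 1,
        derivable (derive1 (curve_coord phi gamma k)) t 1 &
        derive1 (derive1 (curve_coord phi gamma k)) t +
        \sum_i \sum_j
          christoffel (components g phi) k i j (coord phi (gamma t)) *
          derive1 (curve_coord phi gamma i) t *
          derive1 (curve_coord phi gamma j) t
        = 0].

Definition geodesically_complete W g : Prop :=
  forall (J : set R) (gamma : R -> M),
    open J -> is_interval J -> J !=set0 -> geodesic W g J gamma ->
    exists2 gamma' : R -> M,
      geodesic W g setT gamma' & forall t, J t -> gamma' t = gamma t.

End Manifolds.

Arguments chart R n M : clear implicits.
Arguments manifold R n M : clear implicits.
Arguments tensor2 R n M : clear implicits.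

(* Main.v *)
(* The first case only uses that boundary points are boundary points in every
   chart. In the second case let [x] be a point outside [Mplus]. Near [x], off a
   plane of codimension 2, [gplus = sigma^-2 g] with [g] smooth across [x].
   Since [gplus] is Einstein, the Hessian of [sigma] is [phi g] up to terms linear
   in [sigma] and its differential [mu], and the integrability conditions of
   this equation express the differential of [phi] linearly in [(sigma, mu, phi)].
   This closed linear system makes [(sigma, mu, phi)] bounded and Lipschitz off
   the plane, so that it extends to [x]. The Einstein factor [lam] is locally
   constant by Schur's lemma, and is a quadratic expression in [(sigma, mu, phi)]
   that vanishes with [(sigma, mu)]. If the extended [sigma] vanishes at [x], so
   does [mu], because [sigma >= 0]; hence [lam = 0] near [x]. Otherwise the
   Christoffel symbols of [gplus] extend to Lipschitz functions, and a geodesic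
   issues from [x] and leaves the plane at once; by completeness it is continuous
   in [Mplus] at time 0, so [x] belongs to [Mplus], a contradiction. Hence [lam]
   vanishes near every point outside [Mplus]; as [M] is connected and [gplus] is
   not Ricci flat, there is no such point. *)
Require Import Defs.
From HB Require Import structures.
From mathcomp Require Import all_boot all_order all_algebra.
From mathcomp Require Import all_classical all_reals all_analysis.
From mathcomp Require Import ring lra.

Set Implicit Arguments.
Unset Strict Implicit.
Unset Printing Implicit Defensive.

Import Order.TTheory GRing.Theory Num.Theory.
Import numFieldNormedType.Exports.

Local Open Scope classical_set_scope.
Local Open Scope ring_scope.

(** * Smooth functions on open sets *)

(** The closed system for [(sigma, mu, phi)] is the prolongation of the almost Einstein equation,
    that is, parallel transport in the tractor bundle, and [lam] is up to a constant factor the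
    squared length of the tractor. This is why it has to vanish when [sigma] and [mu] vanish at one
    point. The obstacle is low regularity: nothing is known at the points of the plane, so
    derivatives cannot be followed through it and only Lipschitz extensions are available.
    Codimension 2 enters twice. Points off the plane can be joined by short staircases of
    axis-parallel segments that avoid it, so a Gronwall estimate propagates up to the plane; and a
    curve through [x] can leave the plane at once. The extensions are made from [gen] alone, where
    the Lipschitz bound in the sum distance is immediate; the geodesic must therefore run in [gen],
    which the initial velocity with entries 1 in the directions [a] and [b] ensures. Existence of
    geodesics is needed for Lipschitz Christoffel symbols only. As [geodesic] requires the equation
    in every chart, the curve built in one chart is carried to the others by comparing momenta
    rather than Christoffel symbols. *)

Section Calculus.
Context {R : realType} {n : nat}.
Local Notation E := 'rV[R]_n.+1.
Local Notation ev i := (delta_mx 0 i : E).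
Implicit Types (V : set E) (f g : E -> R) (x y : E) (i j : 'I_n.+1).

Definition box x (r : R) : set E := [set y | forall i, `|y 0 i - x 0 i| < r].

Lemma nbhs_boxP x (A : set E) :
  nbhs x A <-> exists2 r, 0 < r & box x r `<=` A.
Proof.
split.
  move/nbhs_ballP => [r /= r0 rA]; exists r => // y xy; apply: rA.
  by split => // i j; rewrite ord1 /ball /= distrC; exact: xy.
move=> [r r0 rA]; apply/nbhs_ballP; exists r => //= y [_ xy]; apply: rA => i.
by rewrite distrC; exact: xy.
Qed.

Lemma box_center x r : 0 < r -> box x r x.
Proof. by move=> r0 i; rewrite subrr normr0. Qed.

Lemma sub_box x r s : r <= s -> box x r `<=` box x s.
Proof. by move=> rs y xy i; exact: lt_le_trans (xy i) rs. Qed.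

Lemma open_box x r : open (box x r).
Proof.
rewrite openE => y yx.
apply: (@filter_forall _ _ (fun i z => `|z 0 i - x 0 i| < r) (nbhs y)) => i.
have c : {for y, continuous (fun z : E => `|z 0 i - x 0 i|)}.
  apply: (@continuous_comp _ _ _ (fun z : E => z 0 i - x 0 i) Num.norm);
    last exact: norm_continuous.
  apply: (@continuousB _ _ _ (fun z : E => z 0 i) (fun=> x 0 i)).
    exact: coord_continuous.
  exact: cst_continuous.
by apply: (@cvgr_lt R _ _ _ (fun z : E => `|z 0 i - x 0 i|) _ c); exact: yx.
Qed.

Lemma coord_shift y (t : R) i j : (t *: ev i + y) 0 j = t * (j == i)%:R + y 0 j.
Proof. by rewrite !mxE eqxx. Qed.

Lemma eq_on_nbhs V f g y : open V -> (forall z, V z -> f z = g z) -> V y ->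
  \forall z \near y, f z = g z.
Proof. by move=> oV fg Vy; apply: filterS fg _; exact: open_nbhs_nbhs. Qed.

Lemma partial_ext V f g i y : open V -> (forall z, V z -> f z = g z) -> V y ->
  partial i f y = partial i g y.
Proof. by move=> oV fg Vy; apply: near_eq_derive; exact: eq_on_nbhs Vy. Qed.

Lemma derivable_ext V f g (v : E) y : open V -> (forall z, V z -> f z = g z) ->
  V y -> derivable f y v -> derivable g y v.
Proof. by move=> oV fg Vy; apply: near_eq_derivable; exact: eq_on_nbhs Vy. Qed.

Lemma continuous_ext V f g y : open V -> (forall z, V z -> f z = g z) ->
  V y -> {for y, continuous f} -> {for y, continuous g}.
Proof.
move=> oV fg Vy cf; change (g @ y --> g y); change (f @ y --> f y) in cf.
rewrite -(fg _ Vy); apply: cvg_trans cf.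
exact: (@near_eq_cvg _ _ (nbhs y) _ f g (eq_on_nbhs oV fg Vy)).
Qed.

Lemma iter_partial_ext V f g s : open V -> (forall z, V z -> f z = g z) ->
  forall z, V z -> iter_partial s f z = iter_partial s g z.
Proof.
move=> oV fg; elim: s => [|i s IH] //= z Vz.
exact: partial_ext Vz.
Qed.

(** Iterated partial derivatives depend only on germs, so the local extension [F] may replace [f]
    near each point of an open set. *)
Lemma smooth_in_open V f : open V -> smooth_in V f -> smooth_on V f.
Proof.
move=> oV sf s y Vy.
have [W [F [oW Wy sF fF]]] := sf y Vy.
have oWV : open (W `&` V) by exact: openI.
have e z : (W `&` V) z -> iter_partial s F z = iter_partial s f z.
  apply: iter_partial_ext oWV _ _ => {}z [Wz Vz]; exact/esym/fF.
have [cF dF] := sF s y Wy.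
split; first exact: continuous_ext e _ cF.
by move=> i; apply: derivable_ext e _ (dF i).
Qed.

(** The recursion on the order makes closure under products and inverses an induction: their partial
    derivatives are polynomial in data one order lower. The lists of partial derivatives in
    [smooth_on] offer no such induction. *)
Fixpoint Ck (k : nat) V f : Prop :=
  (forall y, V y -> {for y, continuous f}) /\
  if k is k'.+1 then
    forall i, (forall y, V y -> derivable f y (ev i)) /\ Ck k' V (partial i f)
  else True.

Definition Cinf V f := forall k, Ck k V f.

Lemma Ck_cont k V f y : Ck k V f -> V y -> {for y, continuous f}.
Proof. by case: k => [|k] [+ _]; apply. Qed.

Lemma CkS k V f : Ck k.+1 V f -> Ck k V f.
Proof.
elim: k f => [|k IH] f; first by case.
move=> [cf df]; split=> // i; have [dfi Cf] := df i; split=> //.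
exact: IH.
Qed.

Lemma Ck_ext k V f g : open V -> (forall z, V z -> f z = g z) ->
  Ck k V f -> Ck k V g.
Proof.
move=> oV; elim: k f g => [|k IH] f g fg [cf df].
  by split=> // y Vy; exact: continuous_ext fg Vy (cf y Vy).
split=> [y Vy|i]; first exact: continuous_ext fg Vy (cf y Vy).
have [dfi Cf] := df i; split=> [y Vy|]; first exact: derivable_ext fg Vy (dfi y Vy).
by apply: IH Cf => z Vz; exact: partial_ext Vz.
Qed.

Lemma Ck_sub k V W f : W `<=` V -> Ck k V f -> Ck k W f.
Proof.
move=> WV; elim: k f => [|k IH] f [cf df]; split => //.
- by move=> y Wy; apply: cf; exact: WV.
- by move=> y Wy; apply: cf; exact: WV.
- move=> i; have [dfi Cf] := df i; split; last exact: IH.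
  by move=> y Wy; apply: dfi; exact: WV.
Qed.

Lemma Ck_cst k V (a : R) : Ck k V (fun=> a).
Proof.
elim: k a => [|k IH] a; split=> //; try by move=> y _; exact: cst_continuous.
move=> i; split; first by move=> y _; exact: derivable_cst.
suff -> : partial i (fun=> a) = fun=> 0 by exact: IH.
by apply/funext => z; exact: (derive_cst a z (ev i)).
Qed.

Lemma Ck_coord k V i : Ck k V (fun y => y 0 i).
Proof.
have c : forall y, {for y, continuous (fun y : E => y 0 i)}.
  by move=> y; exact: coord_continuous.
have d y j : is_derive y (ev j) (fun y : E => y 0 i) ((i == j)%:R).
  have e : (fun h : R => h^-1 *: (((fun y : E => y 0 i) \o shift y) (h *: ev j) - y 0 i)) @ 0^'
      --> ((i == j)%:R : R).
    apply: (@cvg_near_cst R R (i == j)%:R _ 0^'); near=> h.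
    rewrite /= coord_shift addrK /GRing.scale /= mulKf //.
    by near: h; exact: nbhs_dnbhs_neq.
  apply: DeriveDef; first by apply/cvg_ex; eexists; exact: e.
  by apply/cvg_lim => //; exact: e.
case: k => [|k]; split=> // j; split=> [y _|].
  by have [] := d y j.
suff -> : partial j (fun y : E => y 0 i) = fun=> (i == j)%:R by exact: Ck_cst.
by apply/funext => z; have [] := d z j.
Unshelve. all: by end_near. Qed.

Lemma Ck_add k V f g : open V -> Ck k V f -> Ck k V g ->
  Ck k V (fun y => f y + g y).
Proof.
move=> oV; elim: k f g => [|k IH] f g [cf df] [cg dg]; split=> //;
  try by move=> y Vy; apply: continuousD; [exact: cf|exact: cg].
move=> i; have [dfi Cf] := df i; have [dgi Cg] := dg i.
split=> [y Vy|]; first by apply: derivableD; [exact: dfi|exact: dgi].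
apply: Ck_ext (IH _ _ Cf Cg) => // z Vz.
by rewrite /partial deriveD//; [exact: dfi|exact: dgi].
Qed.

Lemma Ck_mul k V f g : open V -> Ck k V f -> Ck k V g ->
  Ck k V (fun y => f y * g y).
Proof.
move=> oV; elim: k f g => [|k IH] f g Cf0 Cg0; case: (Cf0) (Cg0) => [cf df] [cg dg];
  split=> //; try by move=> y Vy; apply: continuousM; [exact: cf|exact: cg].
move=> i; have [dfi Cf] := df i; have [dgi Cg] := dg i.
split=> [y Vy|]; first by apply: derivableM; [exact: dfi|exact: dgi].
have := Ck_add oV (IH _ _ (CkS Cf0) Cg) (IH _ _ (CkS Cg0) Cf).
apply: Ck_ext => // z Vz.
by rewrite /partial deriveM//; [exact: dfi|exact: dgi].
Qed.

Lemma Ck_inv k V f : open V -> (forall y, V y -> f y != 0) -> Ck k V f ->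
  Ck k V (fun y => (f y)^-1).
Proof.
move=> oV f0; elim: k => [|k IH] Cf0; case: (Cf0) => [cf df]; split=> //;
  try by move=> y Vy; apply: continuousV; [exact: f0|exact: cf].
move=> i; have [dfi Cf] := df i.
split=> [y Vy|]; first by apply: derivableV; [exact: f0|exact: dfi].
have Cv := IH (CkS Cf0).
have := Ck_mul oV (Ck_cst k V (-1)) (Ck_mul oV (Ck_mul oV Cv Cv) Cf).
apply: Ck_ext => // z Vz.
rewrite /partial deriveV//; [|exact: f0|exact: dfi].
by rewrite /GRing.scale /= mulNr mul1r mulNr expr2 invfM.
Qed.

Lemma iter_partial_rcons s i f :
  iter_partial (rcons s i) f = iter_partial s (partial i f).
Proof. by rewrite /iter_partial foldr_rcons. Qed.

Lemma smooth_on_partial V f i : smooth_on V f -> smooth_on V (partial i f).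
Proof. by move=> sf s y Vy; have := sf (rcons s i) y Vy; rewrite iter_partial_rcons. Qed.

Lemma smooth_on_Cinf V f : smooth_on V f -> Cinf V f.
Proof.
move=> sf k; elim: k f sf => [|k IH] f sf; split=> //;
  try by move=> y Vy; have [] := sf [::] y Vy.
move=> i; split; last by apply: IH; exact: smooth_on_partial.
by move=> y Vy; have [_] := sf [::] y Vy; apply.
Qed.

Section Cinf.
Variable V : set E.
Hypothesis oV : open V.

Lemma Cinf_cont f y : Cinf V f -> V y -> {for y, continuous f}.
Proof. by move=> /(_ 0%N) Cf; exact: Ck_cont Cf. Qed.

Lemma Cinf_derivable f i y : Cinf V f -> V y -> derivable f y (ev i).
Proof. by move=> /(_ 1%N)[_ /(_ i)[+ _]] Vy; apply. Qed.

Lemma Cinf_partial f i : Cinf V f -> Cinf V (partial i f).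
Proof. by move=> Cf k; have [_ /(_ i)[]] := Cf k.+1. Qed.

Lemma Cinf_ext f g : (forall z, V z -> f z = g z) -> Cinf V f -> Cinf V g.
Proof. by move=> fg Cf k; exact: Ck_ext fg (Cf k). Qed.

Lemma Cinf_cst (a : R) : Cinf V (fun=> a).
Proof. by move=> k; exact: Ck_cst. Qed.

Lemma CinfD f g : Cinf V f -> Cinf V g -> Cinf V (fun y => f y + g y).
Proof. by move=> Cf Cg k; exact: Ck_add. Qed.

Lemma CinfM f g : Cinf V f -> Cinf V g -> Cinf V (fun y => f y * g y).
Proof. by move=> Cf Cg k; exact: Ck_mul. Qed.

Lemma CinfV f : (forall y, V y -> f y != 0) -> Cinf V f ->
  Cinf V (fun y => (f y)^-1).
Proof. by move=> f0 Cf k; exact: Ck_inv. Qed.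

Lemma CinfN f : Cinf V f -> Cinf V (fun y => - f y).
Proof.
by move=> Cf; apply: Cinf_ext (CinfM (Cinf_cst (-1)) Cf) => z _; rewrite mulN1r.
Qed.

Lemma CinfB f g : Cinf V f -> Cinf V g -> Cinf V (fun y => f y - g y).
Proof. by move=> Cf Cg; apply: CinfD => //; exact: CinfN. Qed.

Lemma Cinf_sum (I : Type) (r : seq I) (F : I -> E -> R) :
  (forall k : I, Cinf V (F k)) -> Cinf V (fun y => \sum_(i <- r) F i y).
Proof.
move=> CF; elim: r => [|k r IH].
  by apply: Cinf_ext (Cinf_cst 0) => z _; rewrite big_nil.
by apply: Cinf_ext (CinfD (CF k) IH) => z _; rewrite big_cons.
Qed.

Lemma Cinf_prod (I : Type) (r : seq I) (F : I -> E -> R) :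
  (forall k : I, Cinf V (F k)) -> Cinf V (fun y => \prod_(i <- r) F i y).
Proof.
move=> CF; elim: r => [|k r IH].
  by apply: Cinf_ext (Cinf_cst 1) => z _; rewrite big_nil.
by apply: Cinf_ext (CinfM (CF k) IH) => z _; rewrite big_cons.
Qed.

Lemma Cinf_det m (A : E -> 'M[R]_m) :
  (forall i j : 'I_m, Cinf V (fun y => A y i j)) -> Cinf V (fun y => \det (A y)).
Proof.
move=> CA; rewrite /determinant; apply: Cinf_sum => s.
by apply: CinfM; [exact: Cinf_cst|exact: Cinf_prod].
Qed.

Lemma Cinf_invmx m (A : E -> 'M[R]_m) :
  (forall y, V y -> A y \in unitmx) ->
  (forall i j : 'I_m, Cinf V (fun y => A y i j)) ->
  forall i j : 'I_m, Cinf V (fun y => invmx (A y) i j).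
Proof.
move=> uA CA i j.
have Cc : Cinf V (fun y => cofactor (A y) j i).
  apply: CinfM; first exact: Cinf_cst.
  apply: Cinf_det => k l.
  by apply: Cinf_ext (CA (lift j k) (lift i l)) => z _; rewrite !mxE.
have d0 y : V y -> \det (A y) != 0 by move/uA; rewrite unitmxE unitfE.
apply: Cinf_ext (CinfM (CinfV d0 (Cinf_det CA)) Cc) => z Vz.
by rewrite /invmx uA// !mxE.
Qed.

Lemma partialD f g i y : Cinf V f -> Cinf V g -> V y ->
  partial i (fun z => f z + g z) y = partial i f y + partial i g y.
Proof. by move=> Cf Cg Vy; rewrite /partial deriveD//; exact: Cinf_derivable. Qed.

Lemma partialM f g i y : Cinf V f -> Cinf V g -> V y ->
  partial i (fun z => f z * g z) y = partial i f y * g y + f y * partial i g y.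
Proof.
move=> Cf Cg Vy; rewrite /partial deriveM//; try exact: Cinf_derivable.
by rewrite addrC /GRing.scale /= [g y * _]mulrC.
Qed.

Lemma partial_cst (a : R) i y : partial i (fun=> a) y = 0.
Proof. exact: (derive_cst a y (ev i)). Qed.

Lemma partialZ (a : R) f i y : Cinf V f -> V y ->
  partial i (fun z => a * f z) y = a * partial i f y.
Proof.
move=> Cf Vy; rewrite (partialM i (Cinf_cst a) Cf Vy).
by rewrite (partial_cst a i y) mul0r add0r.
Qed.

Lemma partialN f i y : Cinf V f -> V y ->
  partial i (fun z => - f z) y = - partial i f y.
Proof. by move=> Cf Vy; rewrite /partial deriveN//; exact: Cinf_derivable. Qed.

Lemma partialB f g i y : Cinf V f -> Cinf V g -> V y ->
  partial i (fun z => f z - g z) y = partial i f y - partial i g y.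
Proof. by move=> Cf Cg Vy; rewrite partialD ?partialN//; exact: CinfN. Qed.

Lemma partial_sum (I : Type) (r : seq I) (F : I -> E -> R) i y :
  (forall k : I, Cinf V (F k)) -> V y ->
  partial i (fun z => \sum_(k <- r) F k z) y = \sum_(k <- r) partial i (F k) y.
Proof.
move=> CF Vy; elim: r => [|k r IH].
  rewrite big_nil -[RHS](partial_cst 0 i y); congr (partial i _ y).
  by apply/funext => z; rewrite big_nil.
rewrite big_cons -IH -partialD//; last exact: Cinf_sum.
by congr (partial i _ y); apply/funext => z; rewrite big_cons.
Qed.

End Cinf.
End Calculus.

(** * Mean value inequalities, chain rule and symmetry of second derivatives *)

(** A candidate differential with a small remainder is the differential, by uniqueness. *)
Lemma differentiable_eps (K : numFieldType) (V W : normedModType K) (f : V -> W)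
    (df : {linear V -> W}) (x : V) : continuous df ->
  (forall eps, 0 < eps -> \forall h \near (0 : V),
     `|f (h + x) - f x - df h| <= eps * `|h|) ->
  differentiable f x.
Proof.
move=> cd fe.
have E1 : f \o shift x = cst (f x) + df +o_ 0 id.
  apply/eqaddoP => eps /fe; apply: filterS => h.
  by rewrite -addrA -opprD.
by apply/diff_locallyP; rewrite (diff_unique cd E1).
Qed.

Section MeanValue.
Context {R : realType} {n : nat}.
Local Notation E := 'rV[R]_n.+1.
Local Notation ev i := (delta_mx 0 i : E).
Implicit Types (V : set E) (f g : E -> R) (x y p q : E) (i j : 'I_n.+1).

Lemma continuous_near f y (e : R) : {for y, continuous f} -> 0 < e ->
  \forall z \near y, `|f z - f y| < e.
Proof. by move=> c e0; apply: (@cvgr_distC_lt _ R^o _ _ _ f _ c). Qed.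

Lemma continuous_box f y (e : R) : {for y, continuous f} -> 0 < e ->
  exists2 r, 0 < r & forall z, box y r z -> `|f z - f y| < e.
Proof. by move=> c e0; have /nbhs_boxP[r r0 br] := continuous_near c e0; exists r. Qed.

Lemma open_sub_box V y : open V -> V y -> exists2 r, 0 < r & box y r `<=` V.
Proof. by move=> oV Vy; apply/nbhs_boxP; exact: open_nbhs_nbhs. Qed.

Lemma finite_box (I : finType) (P : I -> R -> Prop) :
  (forall (k : I) (r s : R), r <= s -> P k s -> P k r) ->
  (forall k : I, exists2 r, 0 < r & P k r) ->
  exists2 r, 0 < r & forall k : I, P k r.
Proof.
move=> mP eP.
pose r k := s2val (cid2 (eP k)).
have r0 k : 0 < r k := s2valP (cid2 (eP k)).
have Pr k : P k (r k) := s2valP' (cid2 (eP k)).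
exists (\big[Num.min/1]_i r i).
  by elim/big_ind: _ => // a b a0 b0; rewrite lt_min a0.
by move=> i; apply: mP (Pr i); exact: bigmin_le.
Qed.

Definition between (t h : R) := (0 <= t <= h) || (h <= t <= 0).

Lemma is_derive_line (f : E -> R) (v y : E) (t : R) :
  derivable f (t *: v + y) v ->
  is_derive t 1 (fun s => f (s *: v + y)) ('D_v f (t *: v + y)).
Proof.
have e : (fun h : R => h^-1 *: (((fun s : R => f (s *: v + y)) \o shift t) (h *: 1)
    - f (t *: v + y))) =
  (fun h => h^-1 *: ((f \o shift (t *: v + y)) (h *: v) - f (t *: v + y))).
  apply/funext => h /=.
  by rewrite [h *: 1]mulr1 scalerDl addrA.
by move=> df; apply: DeriveDef; rewrite /derivable /derive e.
Qed.

Lemma axis_mvt f y i (h : R) :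
  (forall t, between t h -> derivable f (t *: ev i + y) (ev i)) ->
  exists2 t, between t h &
    f (h *: ev i + y) - f y = h * partial i f (t *: ev i + y).
Proof.
move=> df; pose phi (s : R) := f (s *: ev i + y).
have dphi t : between t h -> is_derive t 1 phi (partial i f (t *: ev i + y)).
  by move=> th; apply: is_derive_line; exact: df.
have cphi t : between t h -> {for t, continuous phi}.
  move=> /dphi [/derivable1_diffP dp _]; exact: differentiable_continuous.
have phi0 : phi 0 = f y by rewrite /phi scale0r add0r.
have [h0|h0] := leP 0 h.
  have b t : t \in `[0, h] -> between t h by rewrite in_itv /between /= => ->.
  have [||t th e] := @MVT_segment R phi (fun t => partial i f (t *: ev i + y)) 0 h h0.
  - move=> t th; apply: dphi; apply: b; move: th; rewrite !in_itv /= => /andP[t0 t1].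
    by rewrite !ltW.
  - apply: continuous_in_subspaceT => t /[1!inE] th; apply: cphi; exact: b.
  by exists t; [exact: b|rewrite -phi0 -/(phi h) e subr0 mulrC].
have b t : t \in `[h, 0] -> between t h.
  by rewrite in_itv /between /= => ->; rewrite orbT.
have [||t th e] := @MVT_segment R phi (fun t => partial i f (t *: ev i + y)) h 0 (ltW h0).
- move=> t th; apply: dphi; apply: b; move: th; rewrite !in_itv /= => /andP[t0 t1].
  by rewrite !ltW.
- apply: continuous_in_subspaceT => t /[1!inE] th; apply: cphi; exact: b.
by exists t; [exact: b|move: e; rewrite phi0 sub0r -/(phi h); lra].
Qed.

Lemma between_norm (t h r a : R) : `|a| < r -> `|h + a| < r -> between t h -> `|t + a| < r.
Proof.
rewrite !ltr_norml => /andP[a1 a2] /andP[b1 b2] /orP[]/andP[t1 t2]; apply/andP; lra.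
Qed.

(** The corners of the staircase from [p] to [q] that changes one coordinate after the other. *)
Definition mix p q (k : nat) : E := \row_j (if (j < k)%N then q 0 j else p 0 j).

Lemma mix0 p q : mix p q 0 = p.
Proof. by apply/rowP => j; rewrite mxE. Qed.

Lemma mix_full p q : mix p q n.+1 = q.
Proof. by apply/rowP => j; rewrite mxE ltn_ord. Qed.

Lemma mixS p q (k : 'I_n.+1) : mix p q k.+1 = (q 0 k - p 0 k) *: ev k + mix p q k.
Proof.
apply/rowP => j; rewrite coord_shift !mxE ltnS.
have [<-|jk] := eqVneq j k; first by rewrite leqnn ltnn mulr1 subrK.
by rewrite leq_eqVlt val_eqE (negbTE jk) mulr0 add0r.
Qed.

Lemma mix_box x (r : R) p q (k : nat) : box x r p -> box x r q -> box x r (mix p q k).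
Proof. by move=> bp bq i; rewrite mxE; case: ifP => _; [exact: bq|exact: bp]. Qed.

Lemma box_between x r p (k : 'I_n.+1) (s t : R) : box x r p -> box x r (s *: ev k + p) ->
  between t s -> box x r (t *: ev k + p).
Proof.
move=> bp bs ts i; have := bs i; have := bp i; rewrite !coord_shift.
have [_|_] := eqVneq i k; last by rewrite !mulr0 !add0r.
rewrite !mulr1 -!addrA => h1 h2; exact: between_norm h1 h2 ts.
Qed.

(** The one-variable mean value theorem is applied on each edge of the staircase. [Q] need not be
    convex or open; it only has to contain the edges, so that a box minus a plane is allowed later.
    The vector [c] is an approximate gradient: the true gradient at a point yields
    differentiability, and 0 yields a Lipschitz bound. *)
Lemma path_increment f (c : 'I_n.+1 -> R) (e : R) (Q : set E) p q :
  (forall (k : 'I_n.+1) t, between t (q 0 k - p 0 k) -> Q (t *: ev k + mix p q k)) ->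
  (forall i z, Q z -> derivable f z (ev i) /\ `|partial i f z - c i| <= e) ->
  `|f q - f p - \sum_i (q 0 i - p 0 i) * c i| <= e * \sum_i `|q 0 i - p 0 i|.
Proof.
move=> mQ fQ.
have step (k : 'I_n.+1) :
    `|f (mix p q k.+1) - f (mix p q k) - (q 0 k - p 0 k) * c k| <= e * `|q 0 k - p 0 k|.
  have [t tb ->] : exists2 t, between t (q 0 k - p 0 k) &
      f (mix p q k.+1) - f (mix p q k) = (q 0 k - p 0 k) * partial k f (t *: ev k + mix p q k).
    by rewrite mixS; apply: axis_mvt => t /mQ/(fQ k)[].
  by rewrite -mulrBr normrM mulrC ler_wpM2r//; have [] := fQ k _ (mQ _ _ tb).
have -> : f q - f p = \sum_(k < n.+1) (f (mix p q k.+1) - f (mix p q k)).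
  rewrite -[in LHS](mix0 p q) -[X in f X - _](mix_full p q).
  rewrite -(big_mkord xpredT (fun k => f (mix p q k.+1) - f (mix p q k))).
  by rewrite telescope_sumr.
rewrite -sumrB mulr_sumr; apply: le_trans (ler_norm_sum _ _ _) _.
exact: ler_sum.
Qed.

Lemma box_increment f x (r : R) (c : 'I_n.+1 -> R) (e : R) :
  (forall i z, box x r z -> derivable f z (ev i)) ->
  (forall i z, box x r z -> `|partial i f z - c i| <= e) ->
  forall p q, box x r p -> box x r q ->
  `|f q - f p - \sum_i (q 0 i - p 0 i) * c i| <= e * \sum_i `|q 0 i - p 0 i|.
Proof.
move=> df pf p q bp bq; apply: (path_increment (Q := box x r)) => [k t tb|i z bz].
  by apply: (box_between (s := q 0 k - p 0 k)) tb; rewrite -?mixS; exact: mix_box.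
by split; [exact: df|exact: pf].
Qed.

Lemma norm_coord (h : E) i : `|h 0 i| <= `|h|.
Proof.
rewrite [leRHS]/Num.Def.normr/= mx_normrE.
exact: le_trans (le_bigmax _ (fun k : 'I_1 * 'I_n.+1 => `|h k.1 k.2|) (0, i)).
Qed.

Lemma Cinf_differentiable V f y : open V -> Cinf V f -> V y -> differentiable f y.
Proof.
move=> oV Cf Vy.
pose d (h : E) := \sum_i h 0 i * partial i f y.
have lind : linear d.
  move=> a u v; rewrite /d scaler_sumr -big_split /=; apply: eq_bigr => i _.
  by rewrite !mxE mulrDl /GRing.scale /= mulrA.
pose dM := GRing.isLinear.Build _ _ _ _ _ lind.
pose dL : {linear E -> R} := HB.pack d dM.
have cd : continuous dL.
  have : Cinf setT d.
    apply: Cinf_sum => [|i]; first exact: openT.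
    apply: CinfM; [exact: openT| |exact: Cinf_cst].
    by move=> k; exact: Ck_coord.
  by move=> C z; exact: (Cinf_cont C).
apply: (differentiable_eps cd) => eps e0.
  (* The increment estimate is in the sum norm, which is at most [n.+1] times the maximum norm of
     the library. *)
  pose e := eps / n.+1%:R.
  have e1 : 0 < e by rewrite divr_gt0// ltr0n.
  have : \forall z \near y, V z /\ forall i, `|partial i f z - partial i f y| <= e.
    have cp i : \forall z \near y, `|partial i f z - partial i f y| <= e.
      have /(Cinf_cont (y := y)) /(_ Vy) c := Cinf_partial i Cf.
      by apply: filterS (continuous_near c e1) => z /ltW.
    near=> z; split; first by near: z; exact: open_nbhs_nbhs.
    near: z.
    exact: (@filter_forall _ _ (fun i z => `|partial i f z - partial i f y| <= e)).
  move=> /nbhs_boxP[r r0 br].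
  have : \forall h \near (0 : E), `|h| < r.
    by apply/nbhs_ballP; exists r => //= h; rewrite mx_norm_ball /= sub0r normrN.
  apply: filterS => h hr /=.
  have bh : box y r (h + y).
    by move=> i; rewrite mxE addrK; exact: le_lt_trans (norm_coord h i) hr.
  have := box_increment (fun i z bz => Cinf_derivable Cf (br z bz).1)
    (fun i z bz => (br z bz).2 i) (box_center y r0) bh.
  set S := \sum_i _ * _; set T := \sum_i _.
  have -> : S = d h by apply: eq_bigr => i _; rewrite mxE addrK.
  move/le_trans; apply; rewrite /e -mulrA ler_pM2l// ler_pdivrMl ?ltr0n//.
  apply: le_trans (_ : \sum_(i < n.+1) `|h| <= _).
    by apply: ler_sum => i _; rewrite mxE addrK norm_coord.
  by rewrite sumr_const card_ord mulr_natl.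
Unshelve. all: by end_near. Qed.

Lemma chain_curve f (c : R -> E) (dc : 'I_n.+1 -> R) t :
  differentiable f (c t) ->
  (forall i, is_derive t 1 (fun s => c s 0 i) (dc i)) ->
  is_derive t 1 (fun s => f (c s)) (\sum_i dc i * partial i f (c t)).
Proof.
move=> df dcc.
have dct : derivable c t 1.
  by apply/derivable_mxP => i j; rewrite ord1; have [] := dcc j.
have dc1 : differentiable c t by exact/derivable1_diffP.
have dfc : differentiable (f \o c) t by exact: differentiable_comp.
apply: DeriveDef; first by apply: (@diff_derivable R R R (f \o c)).
rewrite (deriveE _ dfc) diff_comp//= -(deriveE _ dc1) (derive_mx dct).
set w := matrix_of_fun _ _.
have -> : w = \sum_i dc i *: ev i.
  apply/rowP => i; rewrite !mxE summxE (bigD1 i)//= !mxE !eqxx mulr1 big1 ?addr0.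
    by have [_ ->] := dcc i.
  by move=> k ki; rewrite !mxE [i == k]eq_sym (negbTE ki) andbF mulr0.
rewrite linear_sum; apply: eq_bigr => i _.
by rewrite linearZ /= /partial deriveE.
Qed.

Lemma chain_partial f (F : E -> E) i y :
  differentiable f (F y) ->
  (forall k, derivable (fun z => F z 0 k) y (ev i)) ->
  derivable (f \o F) y (ev i) /\
  partial i (f \o F) y = \sum_k partial i (fun z => F z 0 k) y * partial k f (F y).
Proof.
move=> df dF.
have e0 : 0 *: ev i + y = y by rewrite scale0r add0r.
have key : is_derive (0 : R) (1 : R) (fun s : R => f (F (s *: ev i + y)))
    (\sum_k partial i (fun z => F z 0 k) y * partial k f (F y)).
  have := @chain_curve f (fun s => F (s *: ev i + y))
    (fun k => partial i (fun z => F z 0 k) y) 0.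
  rewrite e0; apply => // k.
  have := @is_derive_line (fun z => F z 0 k) (ev i) y 0.
  by rewrite e0; apply; exact: dF.
have e : (fun h : R => h^-1 *: (((fun s : R => f (F (s *: ev i + y))) \o shift 0) (h *: 1)
    - f (F (0 *: ev i + y)))) =
  (fun h => h^-1 *: (((f \o F) \o shift y) (h *: ev i) - (f \o F) y)).
  by apply/funext => h /=; rewrite [h *: 1]mulr1 addr0 e0.
have [] := key; rewrite /derivable /derive e => k1 k2.
by split.
Qed.

Lemma jacobianE V (F : E -> E) y i k : open V ->
  (forall k, Cinf V (fun z => F z 0 k)) -> V y ->
  'J F y i k = partial i (fun z => F z 0 k) y.
Proof.
move=> oV CF Vy.
have dF : differentiable F y.
  have -> : F = \sum_k (fun z => F z 0 k *: ev k).
    apply/funext => z; rewrite fct_sumE [LHS]matrix_sum_delta big_ord1.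
    by [].
  apply: differentiable_sum => l; apply: differentiableZl.
  exact: (Cinf_differentiable oV (CF l) Vy).
rewrite /jacobian /lin1_mx mxE -deriveE// derive_mx ?mxE//.
exact: diff_derivable.
Qed.

Lemma derivable_shift f (v y : E) i : derivable f (v + y) (ev i) ->
  derivable (fun p => f (v + p)) y (ev i) /\
  partial i (fun p => f (v + p)) y = partial i f (v + y).
Proof.
have e : (fun h : R => h^-1 *: (((fun p => f (v + p)) \o shift y) (h *: ev i) - f (v + y)))
   = (fun h : R => h^-1 *: ((f \o shift (v + y)) (h *: ev i) - f (v + y))).
  by apply/funext => h /=; rewrite addrCA.
by rewrite /partial /derivable /derive e.
Qed.

(** Mean value arguments only give equal values at two different intermediate points; as the box
    shrinks, continuity turns this into equality at the centre. *)
Lemma eq_at_center (X Y : E -> R) y (r0 : R) :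
  {for y, continuous X} -> {for y, continuous Y} -> 0 < r0 ->
  (forall r, 0 < r -> r <= r0 ->
     exists z w, [/\ box y r z, box y r w & X z = Y w]) ->
  X y = Y y.
Proof.
move=> cX cY r00 XY.
apply/eqP; rewrite -subr_eq0 -normr_le0; apply/ler_addgt0Pl => e e0; rewrite addr0.
have e2 : 0 < e / 2 by rewrite divr_gt0.
have [rb rb0 hb] := continuous_box cX e2.
have [rc rc0 hc] := continuous_box cY e2.
pose r := Num.min r0 (Num.min rb rc).
have rp : 0 < r by rewrite !lt_min r00 rb0.
have [|z [w [bz bw e1]]] := XY r rp; first by rewrite ge_min lexx.
have h1 : `|X z - X y| < e / 2.
  by apply: hb; apply: sub_box bz; rewrite !ge_min lexx !orbT.
have h2 : `|Y w - Y y| < e / 2.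
  by apply: hc; apply: sub_box bw; rewrite !ge_min lexx !orbT.
move: h1 h2; rewrite e1; move: (X y) (Y y) (Y w) => p q s.
rewrite !ltr_norml ler_norml => /andP[? ?] /andP[? ?]; apply/andP; lra.
Qed.

Lemma Clairaut V f i j y : open V -> Cinf V f -> V y ->
  partial i (partial j f) y = partial j (partial i f) y.
Proof.
move=> oV Cf Vy; have [->//|ij] := eqVneq i j.
pose S a b h := f (h *: ev a + (h *: ev b + y)) - f (h *: ev a + y)
   - f (h *: ev b + y) + f y.
(* The second difference [S a b h], symmetric in [a] and [b], is [h^2] times a
   mixed derivative at a nearby point. *)
have main a b h r : a != b -> 0 < h -> h < r -> box y r `<=` V ->
    exists2 z, box y r z & S a b h = h * (h * partial b (partial a f) z).
  move=> ab h0 hr bV.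
  have inb (s t : R) : 0 <= s <= h -> 0 <= t <= h -> box y r (s *: ev a + (t *: ev b + y)).
    move=> /andP[s0 s1] /andP[t0 t1] k; rewrite !coord_shift.
    have [->|ka] := eqVneq k a.
      rewrite (negbTE ab) mulr0 add0r mulr1 addrK ger0_norm//; lra.
    rewrite mulr0 add0r; have [->|kb] := eqVneq k b.
      rewrite mulr1 addrK ger0_norm//; lra.
    by rewrite mulr0 add0r subrr normr0; lra.
  have bet t : between t h -> 0 <= t <= h by rewrite /between => /orP[]//; lra.
  pose phi p := f (h *: ev b + p) - f p.
  have dphi t : 0 <= t <= h -> derivable phi (t *: ev a + y) (ev a) /\
      partial a phi (t *: ev a + y) = partial a f (h *: ev b + (t *: ev a + y))
        - partial a f (t *: ev a + y).
    move=> th.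
    have d1 : derivable f (h *: ev b + (t *: ev a + y)) (ev a).
      apply: (Cinf_derivable Cf); apply: bV; rewrite addrCA; apply: inb => //; lra.
    have d2 : derivable f (t *: ev a + y) (ev a).
      apply: (Cinf_derivable Cf); apply: bV.
      by rewrite -[y in _ + y]add0r -(scale0r (ev b)); apply: inb => //; lra.
    have [d3 e3] := derivable_shift d1.
    split; first exact: derivableB.
    by rewrite -e3; exact: (@deriveB R E R (fun p => f (h *: ev b + p)) f _ _ d3 d2).
  have [t /bet th e1] := axis_mvt (fun t th => (dphi t (bet t th)).1).
  have d4 s : between s h -> derivable (partial a f) (s *: ev b + (t *: ev a + y)) (ev b).
    move=> /bet sh; apply: (Cinf_derivable (Cinf_partial a Cf)); apply: bV.
    by rewrite addrCA; exact: inb.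
  have [s /bet sh e2] := axis_mvt d4.
  exists (s *: ev b + (t *: ev a + y)); first by rewrite addrCA; exact: inb.
  rewrite -e2 -(dphi t th).2 -e1 /phi /S [h *: ev a + (_ + _)]addrCA.
  by rewrite opprB [RHS]addrA [RHS]addrAC.
have symS h : S i j h = S j i h.
  by rewrite /S [h *: ev i + (h *: ev j + y)]addrCA; congr (_ + _); exact: addrAC.
have [ra ra0 bV0] := open_sub_box oV Vy.
apply: (@eq_at_center _ _ _ ra) => //.
- exact: (Cinf_cont (Cinf_partial i (Cinf_partial j Cf)) Vy).
- exact: (Cinf_cont (Cinf_partial j (Cinf_partial i Cf)) Vy).
move=> r r0 rra.
have bV : box y r `<=` V by move=> z bz; apply: bV0; exact: sub_box bz.
have r1 : 0 < r / 2 by rewrite divr_gt0.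
have r2 : r / 2 < r by lra.
have [z bz ez] := main i j (r / 2) r ij r1 r2 bV.
have ji : j != i by rewrite eq_sym.
have [w bw ew] := main j i (r / 2) r ji r1 r2 bV.
exists w, z; split; [exact: bw|exact: bz|].
apply: (mulfI (lt0r_neq0 r1)); apply: (mulfI (lt0r_neq0 r1)).
exact: etrans (esym ew) (etrans (esym (symS _)) ez).
Qed.

End MeanValue.

Opaque partial.

(** * Curvature and Schur's lemma *)

Section MatrixCalculus.
Context {R : realType} {n : nat}.
Local Notation E := 'rV[R]_n.+1.
Local Notation M := 'M[R]_n.+1.
Implicit Types (A B : E -> M) (y : E) (i j k l m : 'I_n.+1).
Variable V : set E.
Hypothesis oV : open V.

Definition mpartial i A y : M := \matrix_(j, k) partial i (fun z => A z j k) y.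

Definition mCinf A := forall j k, Cinf V (fun z => A z j k).

Lemma mpartial_ext A B i y : (forall z, V z -> A z = B z) -> V y ->
  mpartial i A y = mpartial i B y.
Proof.
move=> AB Vy; apply/matrixP => j k; rewrite !mxE.
by apply: (partial_ext _ oV) Vy => z /AB ->.
Qed.

Lemma mCinfD A B : mCinf A -> mCinf B -> mCinf (fun z => A z + B z).
Proof.
move=> CA CB j k; apply: (Cinf_ext oV) (CinfD oV (CA j k) (CB j k)) => z _.
by rewrite mxE.
Qed.

Lemma mCinfN A : mCinf A -> mCinf (fun z => - A z).
Proof.
move=> CA j k; apply: (Cinf_ext oV) (CinfN oV (CA j k)) => z _.
by rewrite mxE.
Qed.

Lemma mCinfM A B : mCinf A -> mCinf B -> mCinf (fun z => A z * B z).
Proof.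
move=> CA CB j k.
have C : Cinf V (fun z => \sum_l A z j l * B z l k).
  by apply: Cinf_sum => // l; exact: CinfM.
by apply: (Cinf_ext oV) C => z _; rewrite mxE.
Qed.

Lemma mCinf_tr A : mCinf A -> mCinf (fun z => (A z)^T).
Proof. by move=> CA j k; apply: (Cinf_ext oV) (CA k j) => z _; rewrite mxE. Qed.

Lemma mCinf_partial A i : mCinf A -> mCinf (mpartial i A).
Proof.
move=> CA j k; apply: (Cinf_ext oV) (Cinf_partial i (CA j k)) => z _.
by rewrite mxE.
Qed.

Lemma mpartialD A B i y : mCinf A -> mCinf B -> V y ->
  mpartial i (fun z => A z + B z) y = mpartial i A y + mpartial i B y.
Proof.
move=> CA CB Vy; apply/matrixP => j k; rewrite !mxE.
rewrite -(partialD i (CA j k) (CB j k) Vy).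
by congr (partial i _ y); apply/funext => z; rewrite mxE.
Qed.

Lemma mpartialN A i y : mCinf A -> V y ->
  mpartial i (fun z => - A z) y = - mpartial i A y.
Proof.
move=> CA Vy; apply/matrixP => j k; rewrite !mxE.
rewrite -(partialN i (CA j k) Vy).
by congr (partial i _ y); apply/funext => z; rewrite mxE.
Qed.

Lemma mpartialM A B i y : mCinf A -> mCinf B -> V y ->
  mpartial i (fun z => A z * B z) y = mpartial i A y * B y + A y * mpartial i B y.
Proof.
move=> CA CB Vy; apply/matrixP => j k; rewrite !mxE -big_split /=.
under [RHS]eq_bigr => l _ do rewrite !mxE -(partialM i (CA j l) (CB l k) Vy).
rewrite -(partial_sum oV) //; last by move=> l; exact: CinfM.
by congr (partial i _ y); apply/funext => z; rewrite mxE.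
Qed.

Lemma mpartial_tr A i y : mpartial i (fun z => (A z)^T) y = (mpartial i A y)^T.
Proof.
apply/matrixP => j k; rewrite !mxE.
by congr (partial i _ y); apply/funext => z; rewrite mxE.
Qed.

Lemma mpartial_cst (A0 : M) i y : mpartial i (fun=> A0) y = 0.
Proof. by apply/matrixP => j k; rewrite !mxE partial_cst. Qed.

Lemma mClairaut A i j y : mCinf A -> V y ->
  mpartial i (mpartial j A) y = mpartial j (mpartial i A) y.
Proof.
move=> CA Vy; apply/matrixP => k l.
have e a b : mpartial a (mpartial b A) y k l = partial a (partial b (fun z => A z k l)) y.
  by rewrite [LHS]mxE; congr (partial a _ y); apply/funext => z; rewrite mxE.
exact: etrans (e i j) (etrans (Clairaut i j oV (CA k l) Vy) (esym (e j i))).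
Qed.

Lemma mpartialE A i y j k : mpartial i A y j k = partial i (fun z => A z j k) y.
Proof. by rewrite mxE. Qed.

End MatrixCalculus.

Opaque mpartial.

(* [zcancel] proves an identity [s = 0] between signed sums of monomials in a
   noncommutative ring, provided no monomial occurs twice with the same sign:
   it brings each monomial next to its opposite. *)
Ltac zcancel :=
  rewrite ?mulrDl ?mulrDr ?mulNr ?mulrN ?mulrA ?opprD ?opprK;
  rewrite -[LHS]add0r ?addrA;
  repeat match goal with |- context [- ?X] =>
    repeat rewrite [_ + X + _]addrAC;
    repeat first [rewrite (subrK X) | rewrite [_ - X + _]addrAC] end;
  reflexivity.

(** [F] is the curvature of a connection with matrices [W], [dF] its derivative by the Leibniz rule
    and [D] the commutator-type covariant derivative. Only three second derivatives occur because
    mixed partial derivatives have been identified; they cancel in the cyclic sum, as do all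
    products. *)
Lemma bianchi_algebra (T : nzRingType)
    (Wi Wj Wm dij dji djm dmj dmi dim dmij djmi dijm : T) :
  let F (Wa Wb dab dba : T) := dab - dba + Wa * Wb - Wb * Wa in
  let dF (Wa Wb dca dcb ddab ddba : T) :=
    ddab - ddba + (dca * Wb + Wa * dcb) - (dcb * Wa + Wb * dca) in
  let D (W X F : T) := X + W * F - F * W in
  D Wm (dF Wi Wj dmi dmj dmij djmi) (F Wi Wj dij dji)
  + D Wi (dF Wj Wm dij dim dijm dmij) (F Wj Wm djm dmj)
  + D Wj (dF Wm Wi djm dji djmi dijm) (F Wm Wi dmi dim) = 0.
Proof. move=> F dF D; rewrite /D /dF /F; zcancel. Qed.

(** The hypothesis is the symmetry of the second derivatives of the metric after metricity has been
    used twice; [T] stands for the transpose of [W] and [e] for that of [d]. *)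
Lemma curv_anti_algebra (T : nzRingType) (g Wi Wj Ti Tj dij dji eij eji : T) :
  eij * g + Tj * (Ti * g + g * Wi) + ((Ti * g + g * Wi) * Wj + g * dij) =
  eji * g + Ti * (Tj * g + g * Wj) + ((Tj * g + g * Wj) * Wi + g * dji) ->
  g * (dij - dji + Wi * Wj - Wj * Wi) + (eij - eji + Tj * Ti - Ti * Tj) * g = 0.
Proof.
move/eqP; rewrite -subr_eq0 => /eqP <-; apply/eqP; rewrite -subr_eq0; apply/eqP.
zcancel.
Qed.

(** Raising an index with the parallel tensor [H] commutes with covariant differentiation; the
    bracketed factor after [F] is the derivative of [H]. *)
Lemma covariant_algebra (T : nzRingType) (F dF W Wt H : T) :
  dF * H + F * (- (W * H) - H * Wt) + W * (F * H) + F * H * Wt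
  = (dF + W * F - F * W) * H.
Proof. apply/eqP; rewrite -subr_eq0; apply/eqP; zcancel. Qed.

(** * The Levi-Civita connection of a metric, its curvature and the second Bianchi identity *)

Section Metric.
Context {R : realType} {n : nat}.
Local Notation E := 'rV[R]_n.+1.
Local Notation M := 'M[R]_n.+1.
Implicit Types (y : E) (i j k l m : 'I_n.+1).
Variables (V : set E) (G : E -> M).
Hypothesis oV : open V.
Hypothesis CG : mCinf V G.
Hypothesis symG : forall y, V y -> (G y)^T = G y.
Hypothesis unitG : forall y, V y -> G y \in unitmx.

Local Notation Gam := (christoffel G).
Local Notation H := (fun y => invmx (G y)).

Lemma metric_entryC i j y : V y -> G y i j = G y j i.
Proof. by move=> Vy; rewrite -[in LHS](symG Vy) mxE. Qed.

Lemma partial_metric_entryC i j k y : V y ->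
  partial k (fun z => G z i j) y = partial k (fun z => G z j i) y.
Proof. by move=> Vy; apply: (partial_ext _ oV) Vy => z Vz; exact: metric_entryC. Qed.

Lemma inv_metric_Cinf : mCinf V H.
Proof. by move=> i j; exact: Cinf_invmx. Qed.

Lemma christoffel_Cinf k i j : Cinf V (Gam k i j).
Proof.
apply: CinfM => //; first exact: Cinf_cst.
apply: Cinf_sum => // l; apply: CinfM => //; first exact: inv_metric_Cinf.
apply: CinfB => //; last exact: Cinf_partial.
by apply: CinfD => //; exact: Cinf_partial.
Qed.

Lemma christoffel_sym k i j y : V y -> Gam k i j y = Gam k j i y.
Proof.
move=> Vy; rewrite /christoffel; congr (_ * _); apply: eq_bigr => l _.
congr (_ * _); congr (_ - _); first by rewrite addrC.
exact: partial_metric_entryC.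
Qed.

Lemma partial_christoffel_sym m k i j y : V y ->
  partial m (Gam k i j) y = partial m (Gam k j i) y.
Proof. by move=> Vy; apply: (partial_ext _ oV) Vy => z Vz; exact: christoffel_sym. Qed.

Lemma christoffel_lower l i j y : V y ->
  \sum_k G y l k * Gam k i j y =
  2^-1 * (partial i (fun z => G z j l) y + partial j (fun z => G z i l) y
     - partial l (fun z => G z i j) y).
Proof.
move=> Vy; rewrite /christoffel.
pose b : 'cV[R]_n.+1 := \col_p (partial i (fun z => G z j p) y +
   partial j (fun z => G z i p) y - partial p (fun z => G z i j) y).
transitivity (2^-1 * (G y *m (invmx (G y) *m b)) l 0); last first.
  by rewrite mulmxA mulmxV ?unitG// mul1mx mxE.
rewrite mxE mulr_sumr; apply: eq_bigr => k _.
rewrite mulrCA; congr (_ * (_ * _)); rewrite mxE; apply: eq_bigr => p _.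
by rewrite mxE.
Qed.

Lemma metricity m i j y : V y ->
  partial m (fun z => G z i j) y =
  \sum_k (G y j k * Gam k m i y) + \sum_k (G y i k * Gam k m j y).
Proof.
move=> Vy; rewrite !christoffel_lower//.
rewrite (partial_metric_entryC j i m Vy); lra.
Qed.

(** Connection matrices: with the upper index as row, the quadratic terms of the curvature are
    matrix products. *)
Definition conn i y : M := \matrix_(k, j) Gam k i j y.

Lemma connE i y k j : conn i y k j = Gam k i j y.
Proof. by rewrite mxE. Qed.

Opaque conn.

Lemma conn_Cinf i : mCinf V (conn i).
Proof.
move=> k j; apply: (Cinf_ext oV) (christoffel_Cinf k i j) => z _.
by rewrite connE.
Qed.

Lemma partial_metric m y : V y ->
  mpartial m G y = (conn m y)^T * G y + G y * conn m y.
Proof.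
move=> Vy; apply/matrixP => i j; rewrite mpartialE !mxE metricity//; congr (_ + _).
  by apply: eq_bigr => k _; rewrite mxE connE mulrC metric_entryC.
by apply: eq_bigr => k _; rewrite connE.
Qed.

Lemma metric_mulV y : V y -> G y * invmx (G y) = 1.
Proof. by move=> Vy; exact: (mulmxV (unitG Vy)). Qed.

Lemma metric_mulVl y : V y -> invmx (G y) * G y = 1.
Proof. by move=> Vy; exact: (mulVmx (unitG Vy)). Qed.

Lemma inv_metric_tr y : V y -> (invmx (G y))^T = invmx (G y).
Proof. by move=> Vy; rewrite trmx_inv symG. Qed.

(** The inverse metric is parallel: differentiate [G * H = 1] and solve with [partial_metric]. *)
Lemma partial_inv_metric m y : V y ->
  mpartial m H y = - (conn m y * invmx (G y)) - invmx (G y) * (conn m y)^T.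
Proof.
move=> Vy.
have : mpartial m (fun z => G z * H z) y = 0.
  rewrite -[RHS](mpartial_cst (1 : M) m y).
  apply: (mpartial_ext oV m _ Vy) => z Vz; exact: metric_mulV.
rewrite (mpartialM oV _ CG inv_metric_Cinf Vy) partial_metric//.
move/(congr1 (fun X => invmx (G y) * X)).
rewrite mulr0 mulrDr !mulrDl [_ * (G y * mpartial _ _ _)]mulrA metric_mulVl//.
rewrite mul1r -(mulrA (conn m y)^T) metric_mulV// mulr1.
rewrite mulrDr (mulrA _ (_ * _) _) (mulrA _ (G y)) metric_mulVl// mul1r => e.
by apply/eqP; rewrite -opprD -addr_eq0 addrC [conn m y * _ + _]addrC e.
Qed.

Definition curv i j y : M :=
  mpartial i (conn j) y - mpartial j (conn i) y
  + conn i y * conn j y - conn j y * conn i y.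

Lemma curv_Cinf i j : mCinf V (curv i j).
Proof.
have Cp a b := mCinf_partial oV a (conn_Cinf b).
have Cc := conn_Cinf.
have CN := mCinfN oV.
have C1 := mCinfD oV (Cp i j) (CN _ (Cp j i)).
exact: (mCinfD oV (mCinfD oV C1 (mCinfM oV (Cc i) (Cc j))) (CN _ (mCinfM oV (Cc j) (Cc i)))).
Qed.

Lemma partial_curv m i j y : V y -> mpartial m (curv i j) y =
  mpartial m (mpartial i (conn j)) y - mpartial m (mpartial j (conn i)) y
  + (mpartial m (conn i) y * conn j y + conn i y * mpartial m (conn j) y)
  - (mpartial m (conn j) y * conn i y + conn j y * mpartial m (conn i) y).
Proof.
move=> Vy.
have Cp a b := mCinf_partial oV a (conn_Cinf b).
have Cc := conn_Cinf.
have CN A := @mCinfN _ _ V oV A.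
have C1 := mCinfD oV (Cp i j) (CN _ (Cp j i)).
have C2 := mCinfM oV (Cc i) (Cc j).
have C3 := mCinfM oV (Cc j) (Cc i).
rewrite (mpartialD m (mCinfD oV C1 C2) (CN _ C3) Vy) (mpartialD m C1 C2 Vy).
rewrite (mpartialD m (Cp i j) (CN _ (Cp j i)) Vy).
rewrite (mpartialN m (Cp j i) Vy) (mpartialN m C3 Vy).
by rewrite (mpartialM oV m (Cc i) (Cc j) Vy) (mpartialM oV m (Cc j) (Cc i) Vy).
Qed.

Lemma bianchi m i j y : V y ->
  (mpartial m (curv i j) y + conn m y * curv i j y - curv i j y * conn m y)
  + (mpartial i (curv j m) y + conn i y * curv j m y - curv j m y * conn i y)
  + (mpartial j (curv m i) y + conn j y * curv m i y - curv m i y * conn j y) = 0.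
Proof.
move=> Vy; rewrite !partial_curv//.
have C a b c := mClairaut oV a b (conn_Cinf c) Vy.
move: (C j m i) (C i m j) (C j i m); clear C.
generalize (mpartial j (mpartial m (conn i)) y) (mpartial m (mpartial j (conn i)) y)
  (mpartial i (mpartial m (conn j)) y) (mpartial m (mpartial i (conn j)) y)
  (mpartial j (mpartial i (conn m)) y) (mpartial i (mpartial j (conn m)) y).
move=> a1 a2 b1 b2 c1 c2 -> -> ->.
exact: bianchi_algebra.
Qed.

Lemma curv_alt i j y : curv j i y = - curv i j y.
Proof. by rewrite /curv !opprD !opprK [- _ + mpartial _ _ _]addrC addrAC. Qed.

(** Commuting the second derivatives of the metric shows that the curvature acts by endomorphisms
    that are skew for [G]. *)
Lemma curv_lower_anti i j y : V y ->
  G y * curv i j y + (curv i j y)^T * G y = 0.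
Proof.
move=> Vy; have Cc := conn_Cinf.
have dd a b : mpartial a (mpartial b G) y =
    (mpartial a (conn b) y)^T * G y + (conn b y)^T * ((conn a y)^T * G y + G y * conn a y)
    + (((conn a y)^T * G y + G y * conn a y) * conn b y + G y * mpartial a (conn b) y).
  transitivity (mpartial a (fun z => (conn b z)^T * G z + G z * conn b z) y).
    by apply: (mpartial_ext oV a _ Vy) => z Vz; exact: partial_metric.
  have CT := mCinf_tr oV (Cc b).
  rewrite (mpartialD a (mCinfM oV CT CG) (mCinfM oV CG (Cc b)) Vy).
  rewrite (mpartialM oV a CT CG Vy) (mpartialM oV a CG (Cc b) Vy).
  by rewrite mpartial_tr partial_metric.
have := mClairaut oV i j CG Vy; rewrite !dd => /curv_anti_algebra <-.
congr (_ + _ * _); rewrite /curv.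
have trM (A B : M) : (A * B)^T = B^T * A^T by exact: trmx_mul.
have trB (A B : M) : (A - B)^T = A^T - B^T by apply/matrixP => a b; rewrite !mxE.
have trD (A B : M) : (A + B)^T = A^T + B^T by apply/matrixP => a b; rewrite !mxE.
by rewrite trB trD trB !trM.
Qed.

Lemma curvE a b y c d : curv a b y c d =
  partial a (Gam c b d) y - partial b (Gam c a d) y
  + \sum_l Gam c a l y * Gam l b d y - \sum_l Gam c b l y * Gam l a d y.
Proof.
have p e f : mpartial e (conn f) y c d = partial e (Gam c f d) y.
  by rewrite mpartialE; congr (partial e _ y); apply/funext => z; rewrite connE.
have mxB (A B : M) : (A - B) c d = A c d - B c d by rewrite !mxE.
have mxD (A B : M) : (A + B) c d = A c d + B c d by rewrite !mxE.
have q e f : (conn e y * conn f y) c d = \sum_l Gam c e l y * Gam l f d y.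
  transitivity (\sum_l conn e y c l * conn f y l d); first by rewrite mxE.
  by apply: eq_bigr => l _; rewrite !connE.
rewrite /curv; apply: etrans (mxB _ _) _; congr (_ - _); last exact: q.
apply: etrans (mxD _ _) _; congr (_ + _); last exact: q.
apply: etrans (mxB _ _) _; congr (_ - _); exact: p.
Qed.

Lemma ricci_curv i j y : V y -> ricci G y i j = \sum_k curv k j y k i.
Proof.
move=> Vy; rewrite mxE; apply: eq_bigr => k _; rewrite curvE.
rewrite (partial_christoffel_sym k k i j Vy) (partial_christoffel_sym j k i k Vy).
rewrite -[RHS]addrA; congr (_ + _); rewrite -sumrB; apply: eq_bigr => l _.
by rewrite (christoffel_sym l i j Vy) (christoffel_sym l i k Vy).
Qed.

Opaque curv.

(** With one more index raised, skewness is plain antisymmetry of the matrix, and the contractions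
    below need Kronecker deltas only, with no metric. *)
Definition curv_up i j y : M := curv i j y * invmx (G y).

Lemma curv_up_Cinf i j : mCinf V (curv_up i j).
Proof. by apply: mCinfM => //; [exact: curv_Cinf|exact: inv_metric_Cinf]. Qed.

Lemma curv_up_alt i j y : curv_up j i y = - curv_up i j y.
Proof. by rewrite /curv_up curv_alt mulNr. Qed.

Lemma curv_up_tr i j y : V y -> (curv_up i j y)^T = - curv_up i j y.
Proof.
move=> Vy; have := curv_lower_anti i j Vy.
move/(congr1 (fun X => invmx (G y) * X * invmx (G y))).
rewrite mulr0 mul0r mulrDr mulrDl mulrA metric_mulVl// mul1r.
rewrite [invmx _ * (_ * G y)]mulrA -(mulrA _ (G y)) metric_mulV// mulr1.
have -> : invmx (G y) * (curv i j y)^T = (curv_up i j y)^T.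
  by rewrite -{1}(inv_metric_tr Vy); exact: (esym (trmx_mul _ _)).
by move/eqP; rewrite addrC addr_eq0 => /eqP.
Qed.

Lemma bianchi_up m i j y : V y ->
  let D a b c := mpartial a (curv_up b c) y
    + conn a y * curv_up b c y + curv_up b c y * (conn a y)^T in
  D m i j + D i j m + D j m i = 0.
Proof.
move=> Vy D.
have e a b c : D a b c =
    (mpartial a (curv b c) y + conn a y * curv b c y - curv b c y * conn a y)
    * invmx (G y).
  rewrite /D (mpartialM oV a (curv_Cinf b c) inv_metric_Cinf Vy).
  by rewrite partial_inv_metric//; exact: covariant_algebra.
by rewrite !e -!mulrDl bianchi// mul0r.
Qed.

End Metric.

(** * Contraction of the second Bianchi identity *)

Section BianchiContraction.
Context {R : realType} {n : nat}.
Local Notation E := 'rV[R]_n.+1.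
Local Notation M := 'M[R]_n.+1.
Implicit Types (y : E) (i j k l m : 'I_n.+1).
Variables (V : set E) (K : 'I_n.+1 -> 'I_n.+1 -> E -> M)
  (W : 'I_n.+1 -> E -> M) (lam : E -> R).
Hypothesis oV : open V.
Hypothesis CK : forall i j, mCinf V (K i j).
Hypothesis altK : forall i j y, K j i y = - K i j y.
Hypothesis trK : forall i j y, V y -> (K i j y)^T = - K i j y.
Hypothesis symW : forall i j k y, V y -> W i y k j = W j y k i.
Hypothesis contrK : forall j l y, V y -> \sum_k K k j y k l = lam y * (j == l)%:R.

(** The connection acts on the matrix indices only. Terms for the lower indices [b] and [c] would
    cancel in the cyclic sum because [W] is symmetric, so they are left out; the price is that
    contractions of [D] keep traces of [W], which cancel at the end. *)
Let D a b c y := mpartial a (K b c) y + W a y * K b c y + K b c y * (W a y)^T.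

Hypothesis bianchiK : forall m i j y, V y -> D m i j y + D i j m y + D j m i y = 0.

Let altKE i j y a b : K j i y a b = - K i j y a b.
Proof. by rewrite altK mxE. Qed.

Let trKE i j y a b : V y -> K i j y b a = - K i j y a b.
Proof. by move=> Vy; have /matrixP/(_ a b) := trK i j Vy; rewrite !mxE. Qed.

Let symK i j y a b : V y -> K j i y b a = K i j y a b.
Proof. by move=> Vy; rewrite trKE// altKE opprK. Qed.

Let contrKr i m y : V y -> \sum_j K i j y m j = lam y * (i == m)%:R.
Proof. by move=> Vy; rewrite -contrK//; apply: eq_bigr => k _; rewrite symK. Qed.

Let contrKl m p y : V y -> \sum_j K j m y p j = - (lam y * (m == p)%:R).
Proof. by move=> Vy; rewrite -contrK// -sumrN; apply: eq_bigr => k _; rewrite trKE. Qed.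

Let contrKc j p y : V y -> \sum_m K j m y m p = - (lam y * (j == p)%:R).
Proof. by move=> Vy; rewrite -contrK// -sumrN; apply: eq_bigr => k _; rewrite altKE. Qed.

Lemma contraction_Cinf : Cinf V lam.
Proof.
have C : Cinf V (fun y => \sum_k K k ord0 y k ord0).
  by apply: Cinf_sum => // k; exact: CK.
by apply: (Cinf_ext oV) C => z Vz; rewrite contrK// eqxx mulr1.
Qed.

Let DE a b c y p q : D a b c y p q = partial a (fun z => K b c z p q) y
  + \sum_l W a y p l * K b c y l q + \sum_l K b c y p l * W a y q l.
Proof.
have mxD (A B : M) : (A + B) p q = A p q + B p q by rewrite mxE.
have mxM (A B : M) : (A * B) p q = \sum_l A p l * B l q by rewrite mxE.
rewrite /D mxD mxD mxM mxM mpartialE; congr (_ + _).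
by apply: eq_bigr => l _; rewrite mxE.
Qed.

Let D_sym m i j y a b : V y -> D m j i y b a = D m i j y a b.
Proof.
move=> Vy; rewrite !DE addrAC; congr (_ + _ + _).
- by apply: (partial_ext _ oV) Vy => z Vz; exact: symK.
- by apply: eq_bigr => p _; rewrite symK// mulrC.
- by apply: eq_bigr => p _; rewrite symK// mulrC.
Qed.

Let sum_delta (f : 'I_n.+1 -> R) i : \sum_k f k * (i == k)%:R = f i.
Proof.
rewrite (bigD1 i)//= eqxx mulr1 big1 ?addr0// => k /negbTE ki.
by rewrite eq_sym ki mulr0.
Qed.

Let contrA i y : V y -> \sum_m \sum_j D m i j y m j =
  partial i lam y + lam y * \sum_m W m y m i.
Proof.
move=> Vy; under eq_bigr do under eq_bigr do rewrite DE.
under eq_bigr do rewrite !big_split /=; rewrite !big_split /= -[RHS]addr0.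
congr (_ + _ + _).
- transitivity (\sum_m partial m lam y * (i == m)%:R); last exact: sum_delta.
  apply: eq_bigr => m _; rewrite -(partial_sum oV) //; last by move=> k; exact: CK.
  transitivity (partial m (fun z => lam z * (i == m)%:R) y).
    by apply: (partial_ext _ oV) Vy => z Vz; exact: contrKr.
  rewrite (partialM m contraction_Cinf (Cinf_cst _ _) Vy) partial_cst.
  by rewrite mulr0 addr0.
- rewrite mulr_sumr; apply: eq_bigr => m _; rewrite exchange_big /=.
  transitivity (\sum_p (lam y * W m y m p) * (i == p)%:R); last exact: sum_delta.
  by apply: eq_bigr => p _; rewrite -mulr_sumr contrKr// mulrCA mulrA.
- rewrite exchange_big /=; apply: big1 => j _.
  (* For fixed [j] this is the antisymmetric matrix [K i j] paired with [W], which is symmetric in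
     the same two indices. *)
  set S := (X in X = 0); suff : S = - S by lra.
  rewrite {1}/S exchange_big /= /S -sumrN; apply: eq_bigr => p _.
  by rewrite -sumrN; apply: eq_bigr => q _; rewrite (trKE i j _ _ Vy) symW// mulNr.
Qed.

Let contrB i y : V y -> \sum_m \sum_j D i j m y m j =
  - (n.+1%:R * partial i lam y) - lam y * \sum_m W m y m i
   - lam y * \sum_m W m y m i.
Proof.
move=> Vy; under eq_bigr do under eq_bigr do rewrite DE.
under eq_bigr do rewrite !big_split /=; rewrite !big_split /=.
congr (_ + _ + _).
- transitivity (\sum_(m < n.+1) - partial i lam y).
    apply: eq_bigr => m _; rewrite -(partial_sum oV) //; last by move=> k; exact: CK.
    rewrite -(partialN i contraction_Cinf Vy).
    apply: (partial_ext _ oV) Vy => z Vz; rewrite contrKl// eqxx mulr1//.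
  by rewrite sumrN sumr_const card_ord mulr_natl.
- rewrite mulr_sumr -sumrN; apply: eq_bigr => m _; rewrite exchange_big /=.
  transitivity (\sum_p (- (lam y * W i y m p)) * (m == p)%:R).
    apply: eq_bigr => p _; rewrite -mulr_sumr contrKl//.
    by rewrite mulrN mulNr mulrCA mulrA.
  by rewrite sum_delta symW.
- rewrite exchange_big /= mulr_sumr -sumrN; apply: eq_bigr => j _.
  rewrite exchange_big /=.
  transitivity (\sum_p (- (lam y * W i y j p)) * (j == p)%:R).
    apply: eq_bigr => p _; rewrite -mulr_suml contrKc//.
    by rewrite !mulNr mulrAC.
  by rewrite sum_delta symW.
Qed.

(** The first and the third cyclic terms have the same contraction [contrA], by [D_sym]; twice
    [contrA] plus [contrB] loses all traces of [W] and leaves [2 - n.+1] times the derivative of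
    [lam]. *)
Lemma contracted_bianchi i y : V y -> (n.+1%:R - 2) * partial i lam y = 0.
Proof.
move=> Vy.
have : \sum_m \sum_j (D m i j y m j + D i j m y m j + D j m i y m j) = 0.
  apply: big1 => m _; apply: big1 => j _.
  by have /matrixP/(_ m j) := bianchiK m i j Vy; rewrite !mxE.
under eq_bigr do rewrite !big_split /=; rewrite !big_split /=.
rewrite contrA// contrB//.
have -> : \sum_m \sum_j D j m i y m j = \sum_m \sum_j D m i j y m j.
  rewrite exchange_big /=; apply: eq_bigr => m _; apply: eq_bigr => j _.
  exact: D_sym.
rewrite contrA//.
move: (partial i lam y) (lam y) (\sum_m _) => a b c; lra.
Qed.

End BianchiContraction.

(** * Schur's lemma for Einstein metrics *)

Section Schur.
Context {R : realType} {n : nat}.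
Local Notation E := 'rV[R]_n.+1.
Local Notation M := 'M[R]_n.+1.
Variables (V : set E) (G : E -> M) (lam : E -> R).
Hypothesis oV : open V.
Hypothesis CG : mCinf V G.
Hypothesis symG : forall y, V y -> (G y)^T = G y.
Hypothesis unitG : forall y, V y -> G y \in unitmx.
Hypothesis einG : forall y, V y -> ricci G y = lam y *: G y.

Let contr j l y : V y -> \sum_k curv_up G k j y k l = lam y * (j == l)%:R.
Proof.
move=> Vy.
transitivity (\sum_i ricci G y i j * invmx (G y) i l).
  under [RHS]eq_bigr => i _ do rewrite (ricci_curv oV symG i j Vy) mulr_suml.
  rewrite exchange_big /=; apply: eq_bigr => k _.
  by rewrite /curv_up mxE.
have /matrixP/(_ j l) := metric_mulV unitG Vy.
rewrite [LHS]mxE [RHS]mxE => <-.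
rewrite mulr_sumr; apply: eq_bigr => i _.
by rewrite einG// mxE (metric_entryC symG i j Vy) mulrA.
Qed.

Let symconn i j k y : V y -> conn G i y k j = conn G j y k i.
Proof. by move=> Vy; rewrite !connE (christoffel_sym oV symG k i j Vy). Qed.

Lemma einstein_Cinf : Cinf V lam.
Proof.
apply: (contraction_Cinf (K := curv_up G) oV) => //.
by move=> i j; exact: curv_up_Cinf.
Qed.

Lemma schur i y : (2 < n.+1)%N -> V y -> partial i lam y = 0.
Proof.
move=> n2 Vy.
have := contracted_bianchi (K := curv_up G) (W := conn G) oV
  (curv_up_Cinf oV CG unitG) (curv_up_alt G) (curv_up_tr oV CG symG unitG)
  symconn contr (bianchi_up oV CG symG unitG) i Vy.
move/eqP; rewrite mulf_eq0 subr_eq0 => /orP[|/eqP//].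
by rewrite eqr_nat => /eqP n2'; rewrite n2' in n2.
Qed.

End Schur.

(** * Conformal change of the Ricci tensor *)

Section RicciAlgebra.
Variables (R : realFieldType) (n : nat).
Local Notation I := 'I_n.+1.
Let delta (i j : I) : R := (i == j)%:R.
Variables (a : I -> I -> I -> R) (da : I -> I -> I -> I -> R)
  (u U : I -> R) (du dU : I -> I -> R) (g : I -> I -> R) (dg : I -> I -> I -> R).
Hypothesis syma : forall k i j, a k i j = a k j i.
Hypothesis symg : forall i j, g i j = g j i.
Hypothesis dgE : forall m i j, dg m i j = \sum_k (g j k * a k m i) + \sum_k (g i k * a k m j).
Hypothesis uE : forall i, u i = \sum_k g i k * U k.
Hypothesis duE : forall j i, du j i = \sum_k (dg j i k * U k + g i k * dU j k).
Hypothesis symdu : forall i j, du i j = du j i.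

(** The difference of the Levi-Civita connections of [e^(2u) g] and [g]; [dc] is its formal
    derivative. Treating all values and derivatives at one point as free variables reduces the Ricci
    formula to algebra with sums. *)
Let c (k i j : I) : R := delta k i * u j + delta k j * u i - g i j * U k.
Let dc (m k i j : I) : R := delta k i * du m j + delta k j * du m i
  - (dg m i j * U k + g i j * dU m k).

Let deltaC i j : delta i j = delta j i.
Proof. by rewrite /delta eq_sym. Qed.

Let deltaxx i : delta i i = 1.
Proof. by rewrite /delta eqxx. Qed.

Let sumD (F H : I -> R) : \sum_k F k + \sum_k H k = \sum_k (F k + H k).
Proof. by rewrite big_split. Qed.

Let sumdelta (f : I -> R) i : \sum_k f k * delta k i = f i.
Proof.
rewrite (bigD1 i)//= deltaxx mulr1 big1 ?addr0// => k /negbTE ki.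
by rewrite /delta ki mulr0.
Qed.

Let sumc (f : I -> R) i j :
  \sum_l f l * c l i j = f i * u j + f j * u i - g i j * \sum_l f l * U l.
Proof.
rewrite -(sumdelta f i) -(sumdelta f j) !mulr_suml mulr_sumr sumD -sumrB.
by apply: eq_bigr => l _; rewrite /c; ring.
Qed.

Let sumdiag (x : R) : \sum_(k < n.+1) x = n.+1%:R * x.
Proof. by rewrite sumr_const card_ord mulr_natl. Qed.

Let sumgU i : \sum_k U k * g i k = u i.
Proof. by rewrite uE; apply: eq_bigr => k _; rewrite mulrC. Qed.

Let N := \sum_k u k * U k.
Let gam l := \sum_k a k k l.

Let ctrace l : \sum_k c k k l = n.+1%:R * u l.
Proof.
transitivity (\sum_k (u l + u k * delta k l - U k * g l k)).
  by apply: eq_bigr => k _; rewrite /c deltaxx (symg k l); ring.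
by rewrite sumrB big_split /= sumdelta sumdiag sumgU addrK.
Qed.

Let ctrace2 i : \sum_l c l i l = n.+1%:R * u i.
Proof.
rewrite -ctrace; apply: eq_bigr => k _; rewrite /c (symg i k); ring.
Qed.

Let cU l i : \sum_k U k * c l i k = delta l i * N.
Proof.
transitivity (\sum_k (delta l i * (u k * U k) + (U k * u i) * delta k l - (U k * g i k) * U l)).
  by apply: eq_bigr => k _; rewrite /c (deltaC k l); ring.
by rewrite sumrB big_split /= -mulr_sumr sumdelta -mulr_suml sumgU -/N; ring.
Qed.

Let X1 i j : \sum_k dc k k i j = du i j + du j i - \sum_k dg k i j * U k
  - g i j * \sum_k dU k k.
Proof.
rewrite -(sumdelta (fun k => du k j) i) -(sumdelta (fun k => du k i) j).
rewrite mulr_sumr sumD -!sumrB; apply: eq_bigr => k _; rewrite /dc; ring.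
Qed.

Let X2 i j : \sum_k dc j k i k = n.+1%:R * du j i.
Proof.
transitivity (\sum_k (du j k * delta k i + du j i - (dg j i k * U k + g i k * dU j k))).
  by apply: eq_bigr => k _; rewrite /dc deltaxx; ring.
by rewrite sumrB big_split /= sumdelta sumdiag -duE; ring.
Qed.

Let Y1 i j : \sum_k \sum_l a k k l * c l i j =
  gam i * u j + gam j * u i - g i j * \sum_l gam l * U l.
Proof.
rewrite -sumc exchange_big /=; apply: eq_bigr => l _.
by rewrite mulr_suml.
Qed.

Let Y2 i j : \sum_k \sum_l c k k l * a l i j = n.+1%:R * \sum_l a l i j * u l.
Proof.
rewrite exchange_big mulr_sumr /=; apply: eq_bigr => l _.
by rewrite -mulr_suml ctrace; ring.
Qed.

Let Y3 i j : \sum_k \sum_l c k k l * c l i j =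
  n.+1%:R * (u i * u j + u j * u i - g i j * N).
Proof.
rewrite -sumc exchange_big mulr_sumr /=; apply: eq_bigr => l _.
by rewrite -mulr_suml ctrace mulrA.
Qed.

(** The part without tensorial meaning. It enters through the mixed products in [Z1] and [Z2] and,
    by metricity ([dgT]), through the derivative of the metric in [X1], with opposite signs in the
    total. *)
Let T i j := \sum_k g i k * \sum_l a k j l * U l.

Let Z1 i j : \sum_k \sum_l a k j l * c l i k =
  \sum_k a k i j * u k + gam j * u i - T i j.
Proof.
rewrite /gam /T mulr_suml sumD -sumrB; apply: eq_bigr => k _.
by rewrite sumc (syma k j i) (syma k k j).
Qed.

Let Z2 i j : \sum_k \sum_l c k j l * a l i k =
  \sum_k a k i j * u k + gam i * u j - T j i.
Proof.
rewrite /gam /T mulr_suml sumD -sumrB exchange_big /=; apply: eq_bigr => k _.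
under eq_bigr do rewrite mulrC.
by rewrite sumc (syma k k i).
Qed.

Let Z3 i j : \sum_k \sum_l c k j l * c l i k =
  (n.+1%:R + 2) * (u i * u j) - 2 * (g i j * N).
Proof.
rewrite exchange_big /=.
transitivity (\sum_l (u l * c l i j + u j * c l i l - g i j * N * delta l i)).
  apply: eq_bigr => l _; under eq_bigr do rewrite mulrC.
  rewrite sumc; under [in X in _ - X]eq_bigr do rewrite mulrC.
  rewrite cU /delta; have [->|_] := eqVneq l i; last by rewrite /=; ring.
  by rewrite (symg i j) /=; ring.
rewrite sumrB big_split /= sumc sumdelta -mulr_sumr ctrace2 -/N; ring.
Qed.

Let dgT i j : \sum_k dg k i j * U k = T i j + T j i.
Proof.
have TE p q : T p q = \sum_l \sum_k g p k * (a k q l * U l).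
  by rewrite exchange_big; apply: eq_bigr => k _; rewrite mulr_sumr.
rewrite !TE sumD; apply: eq_bigr => k _.
rewrite dgE mulrDl !mulr_suml addrC; congr (_ + _); apply: eq_bigr => l _.
  by rewrite (syma l k j) mulrA.
by rewrite (syma l k i) mulrA.
Qed.

(** Expanding [a + c] splits the new Ricci tensor into the old one and the eight sums evaluated in
    [X1] to [Z3]. The result is the classical formula [Ric - (d - 2) (Hess u - du du) - (Lap u + (d
    - 2) |du|^2) g] with [d = n.+1]. *)
Lemma ricci_algebra i j :
  \sum_k ((da k k i j + dc k k i j) - (da j k i k + dc j k i k)
    + \sum_l ((a k k l + c k k l) * (a l i j + c l i j)
              - (a k j l + c k j l) * (a l i k + c l i k))) =
  \sum_k (da k k i j - da j k i k + \sum_l (a k k l * a l i j - a k j l * a l i k))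
  - (n.+1%:R - 2) * (du i j - \sum_k a k i j * u k - u i * u j)
  + g i j * (- \sum_k dU k k - \sum_l gam l * U l - (n.+1%:R - 2) * N).
Proof.
transitivity (\sum_k (da k k i j - da j k i k + \sum_l (a k k l * a l i j - a k j l * a l i k))
  + \sum_k dc k k i j - \sum_k dc j k i k
  + \sum_k \sum_l a k k l * c l i j + \sum_k \sum_l c k k l * a l i j
  + \sum_k \sum_l c k k l * c l i j - \sum_k \sum_l a k j l * c l i k
  - \sum_k \sum_l c k j l * a l i k - \sum_k \sum_l c k j l * c l i k).
  rewrite !(sumD, =^~ sumrB); apply: eq_bigr => k _.
  set S := \sum_l _; set S' := \sum_l (a k k l * a l i j - _).
  suff -> : S = S' + \sum_l a k k l * c l i j + \sum_l c k k l * a l i j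
    + \sum_l c k k l * c l i j - \sum_l a k j l * c l i k
    - \sum_l c k j l * a l i k - \sum_l c k j l * c l i k by ring.
  rewrite /S /S' !(sumD, =^~ sumrB); apply: eq_bigr => l _; ring.
rewrite X1 X2 Y1 Y2 Y3 Z1 Z2 Z3 dgT (symdu j i).
move: (\sum_k (da k k i j - _ + _)) (\sum_k dU k k) (\sum_k a k i j * u k)
  (\sum_l gam l * U l) N (T i j) (T j i) => s1 s2 s3 s4 s5 s6 s7.
ring.
Qed.

End RicciAlgebra.

Section ConformalRicci.
Context {R : realType} {n : nat}.
Local Notation E := 'rV[R]_n.+1.
Local Notation M := 'M[R]_n.+1.
Local Notation delta i j := ((i == j)%:R : R).
Implicit Types (y : E) (i j k l m : 'I_n.+1).
Variables (V : set E) (G Gp : E -> M) (sigma : E -> R).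
Hypothesis oV : open V.
Hypothesis CG : mCinf V G.
Hypothesis symG : forall y, V y -> (G y)^T = G y.
Hypothesis unitG : forall y, V y -> G y \in unitmx.
Hypothesis CGp : mCinf V Gp.
Hypothesis Csigma : Cinf V sigma.
Hypothesis sigma0 : forall y, V y -> sigma y != 0.
Hypothesis GpE : forall y, V y -> Gp y = (sigma y)^-2 *: G y.

Local Notation Gam := (christoffel G).
Local Notation H := (fun y => invmx (G y)).
Local Notation mu := (fun i => partial i sigma).

(* [Gp = e^(2 u) G] with [u = - ln sigma]; [dlog] is the differential of [u] and
   [dlogup] its gradient. *)
Definition dlog i y : R := - (partial i sigma y / sigma y).
Definition dlogup k y : R := \sum_l invmx (G y) k l * dlog l y.
Definition grad k y : R := \sum_l invmx (G y) k l * partial l sigma y.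

Lemma dlog_Cinf i : Cinf V (dlog i).
Proof.
apply: CinfN => //; apply: CinfM => //; first exact: Cinf_partial.
exact: CinfV.
Qed.

Lemma dlogup_Cinf k : Cinf V (dlogup k).
Proof.
apply: Cinf_sum => // l; apply: CinfM => //; last exact: dlog_Cinf.
exact: inv_metric_Cinf.
Qed.

Lemma grad_Cinf k : Cinf V (grad k).
Proof.
apply: Cinf_sum => // l; apply: CinfM => //; last exact: Cinf_partial.
exact: inv_metric_Cinf.
Qed.

Lemma dlogM i y : V y -> dlog i y * sigma y = - partial i sigma y.
Proof. by move=> Vy; rewrite /dlog mulNr divfK// sigma0. Qed.

Lemma dlogupM k y : V y -> dlogup k y * sigma y = - grad k y.
Proof.
move=> Vy; rewrite /dlogup /grad mulr_suml -sumrN; apply: eq_bigr => l _.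
by rewrite -mulrA dlogM// mulrN.
Qed.

(** Differentiating [dlogM], rather than the quotient, keeps the relation free of denominators. *)
Lemma partial_dlog m i y : V y ->
  partial m (dlog i) y * sigma y + dlog i y * partial m sigma y =
  - partial m (partial i sigma) y.
Proof.
move=> Vy; rewrite -(partialM m (dlog_Cinf i) Csigma Vy).
rewrite -(partialN m (Cinf_partial i Csigma) Vy).
by apply: (partial_ext _ oV) Vy => z Vz; exact: dlogM.
Qed.

Lemma partial_dlogup m k y : V y ->
  partial m (dlogup k) y * sigma y + dlogup k y * partial m sigma y =
  - partial m (grad k) y.
Proof.
move=> Vy; rewrite -(partialM m (dlogup_Cinf k) Csigma Vy).
rewrite -(partialN m (grad_Cinf k) Vy).
by apply: (partial_ext _ oV) Vy => z Vz; exact: dlogupM.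
Qed.

Lemma partial_dlogC i j y : V y -> partial i (dlog j) y = partial j (dlog i) y.
Proof.
move=> Vy; apply: (mulIf (sigma0 Vy)).
have := partial_dlog i j Vy; have := partial_dlog j i Vy.
have := Clairaut i j oV Csigma Vy; rewrite /dlog.
generalize (partial i (partial j sigma) y) (partial j (partial i sigma) y)
  (partial i (fun y => - (partial j sigma y / sigma y)) y)
  (partial j (fun y => - (partial i sigma y / sigma y)) y).
move=> a b c d ->.
move: (partial i sigma y) (partial j sigma y) (sigma y) => p q s e1 e2.
have -> : c * s = - b + q / s * p by move: e2; lra.
have -> : d * s = - b + p / s * q by move: e1; lra.
ring.
Qed.

Lemma dlog_lower i y : V y -> dlog i y = \sum_k G y i k * dlogup k y.
Proof.
move=> Vy.
pose b : 'cV[R]_n.+1 := \col_p dlog p y.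
transitivity ((G y *m (invmx (G y) *m b)) i 0).
  by rewrite mulmxA mulmxV ?unitG// mul1mx mxE.
rewrite mxE; apply: eq_bigr => k _; congr (_ * _).
by rewrite mxE; apply: eq_bigr => l _; rewrite mxE.
Qed.

Lemma partial_dlog_lower m i y : V y -> partial m (dlog i) y =
  \sum_k (partial m (fun z => G z i k) y * dlogup k y
          + G y i k * partial m (dlogup k) y).
Proof.
move=> Vy.
transitivity (partial m (fun z => \sum_k G z i k * dlogup k z) y).
  by apply: (partial_ext _ oV) Vy => z Vz; exact: dlog_lower.
have CU := dlogup_Cinf.
rewrite (partial_sum oV)//; last by move=> k; apply: CinfM.
apply: eq_bigr => k _.
exact: (partialM m (CG i k) (CU k) Vy).
Qed.

Lemma partial_conf_metric m i j y : V y ->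
  partial m (fun z => Gp z i j) y =
  (sigma y)^-2 * (partial m (fun z => G z i j) y + 2 * (dlog m y * G y i j)).
Proof.
move=> Vy.
have C2 := CinfM oV Csigma Csigma.
have : partial m (fun z => G z i j) y =
    partial m (fun z => sigma z * sigma z * Gp z i j) y.
  apply: (partial_ext _ oV) Vy => z Vz.
  by rewrite GpE// mxE mulrA -expr2 mulfV ?mul1r// expf_neq0// sigma0.
rewrite (partialM m C2 (CGp i j) Vy) (partialM m Csigma Csigma Vy) => ->.
rewrite GpE// mxE /dlog.
move: (partial m (fun z => Gp z i j) y) (partial m sigma y) (sigma0 Vy) => a b.
move: (sigma y) (G y i j) => s g s0.
by field.
Qed.

Lemma christoffel_conf k i j y : V y -> christoffel Gp k i j y =
  Gam k i j y + (delta k i * dlog j y + delta k j * dlog i y - G y i j * dlogup k y).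
Proof.
move=> Vy.
have iE : invmx (Gp y) = (sigma y) ^+ 2 *: invmx (G y).
  rewrite GpE// invmxZ ?invrK// unitmxZ ?unitG//.
  by rewrite unitfE invr_eq0 expf_neq0// sigma0.
have HG a b : \sum_l invmx (G y) a l * G y l b = delta a b.
  by have /matrixP/(_ a b) := metric_mulVl unitG Vy; rewrite !mxE.
rewrite {1}/christoffel.
transitivity (2^-1 * \sum_l (invmx (G y) k l * (partial i (fun z => G z j l) y
   + partial j (fun z => G z i l) y - partial l (fun z => G z i j) y)
   + 2 * (dlog i y * (invmx (G y) k l * G y l j) + dlog j y * (invmx (G y) k l * G y l i)
   - G y i j * (invmx (G y) k l * dlog l y)))).
  congr (_ * _); apply: eq_bigr => l _; rewrite iE mxE !partial_conf_metric//.
  rewrite (metric_entryC symG l j Vy) (metric_entryC symG l i Vy).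
  move: (partial i (fun z => G z j l) y) (partial j (fun z => G z i l) y)
    (partial l (fun z => G z i j) y) (dlog i y) (dlog j y) (dlog l y) (sigma0 Vy).
  move: (sigma y) (invmx (G y) k l) (G y j l) (G y i l) (G y i j).
  move=> s h g1 g2 g3 p1 p2 p3 u1 u2 u3 s0; by field.
rewrite big_split /= -mulr_sumr sumrB big_split /= -!mulr_sumr !HG mulrDr.
rewrite [2^-1 * (2 * _)]mulrA mulVf ?mul1r ?pnatr_eq0//.
by rewrite [dlog j y * _]mulrC [dlog i y * _]mulrC [X in _ + (X - _) = _]addrC.
Qed.

Lemma partial_christoffel_conf m k i j y : V y ->
  partial m (christoffel Gp k i j) y =
  partial m (Gam k i j) y + (delta k i * partial m (dlog j) y
   + delta k j * partial m (dlog i) y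
   - (partial m (fun z => G z i j) y * dlogup k y + G y i j * partial m (dlogup k) y)).
Proof.
move=> Vy.
have Cd a i0 : Cinf V (fun z => delta k a * dlog i0 z).
  by apply: CinfM => //; [exact: Cinf_cst|exact: dlog_Cinf].
have CU : Cinf V (fun z => G z i j * dlogup k z).
  by apply: CinfM => //; exact: dlogup_Cinf.
have Cdd := CinfD oV (Cd i j) (Cd j i).
have Ca := CinfB oV Cdd CU.
have CGam := christoffel_Cinf oV CG unitG k i j.
transitivity (partial m (fun z => Gam k i j z + (delta k i * dlog j z
   + delta k j * dlog i z - G z i j * dlogup k z)) y).
  by apply: (partial_ext _ oV) Vy => z Vz; exact: christoffel_conf.
rewrite (partialD m CGam Ca Vy) (partialB oV m Cdd CU Vy) (partialD m (Cd i j) (Cd j i) Vy).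
rewrite (partialM m (CG i j) (dlogup_Cinf k) Vy).
by rewrite (partialZ (delta k i) m (dlog_Cinf j) Vy) (partialZ (delta k j) m (dlog_Cinf i) Vy).
Qed.

(** The coefficient of the metric in the conformal change of Ricci: [- Lap u - (d - 2) |du|^2] for
    [u = - ln sigma]. *)
Definition conf_trace y : R := - \sum_k partial k (dlogup k) y
  - \sum_l (\sum_k Gam k k l y) * dlogup l y
  - (n.+1%:R - 2) * \sum_k dlog k y * dlogup k y.

Lemma ricci_conf i j y : V y -> ricci Gp y i j = ricci G y i j
  - (n.+1%:R - 2) * (partial i (dlog j) y - \sum_k Gam k i j y * dlog k y
                     - dlog i y * dlog j y)
  + G y i j * conf_trace y.
Proof.
move=> Vy.
rewrite [ricci G y i j]mxE.
have := @ricci_algebra R n (fun k i j => Gam k i j y)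
  (fun m k i j => partial m (Gam k i j) y)
  (fun i => dlog i y) (fun k => dlogup k y) (fun m i => partial m (dlog i) y)
  (fun m k => partial m (dlogup k) y) (fun i j => G y i j)
  (fun m i j => partial m (fun z => G z i j) y).
move=> /(_ (fun k i j => christoffel_sym oV symG k i j Vy)
  (fun i j => metric_entryC symG i j Vy)
  (fun m i j => metricity oV symG unitG m i j Vy)
  (fun i => dlog_lower i Vy) (fun j i => partial_dlog_lower j i Vy)
  (fun i j => partial_dlogC i j Vy) i j) <-.
rewrite mxE; apply: eq_bigr => k _; congr (_ - _ + _).
- exact: partial_christoffel_conf.
- exact: partial_christoffel_conf.
- apply: eq_bigr => l _; congr (_ * _ - _ * _); exact: christoffel_conf.
Qed.

End ConformalRicci.

(** * The linear system satisfied by the conformal scale *)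

Lemma sum_mul_delta (R : pzRingType) (I : finType) (F : I -> R) m :
  \sum_i F i * (i == m)%:R = F m.
Proof.
rewrite (bigD1 m)//= eqxx mulr1 big1 ?addr0// => k /negbTE km.
by rewrite km mulr0.
Qed.

Section EinsteinScale.
Context {R : realType} {n : nat}.
Local Notation E := 'rV[R]_n.+1.
Local Notation M := 'M[R]_n.+1.
Implicit Types (y : E) (i j k l m : 'I_n.+1).
Variables (D V : set E) (G Gp : E -> M) (sigma lam : E -> R) (x0 : E).
Hypothesis dim2 : (2 < n.+1)%N.
Hypothesis oD : open D.
Hypothesis oV : open V.
Hypothesis VD : V `<=` D.
Hypothesis Dx0 : D x0.
Hypothesis CG : mCinf D G.
Hypothesis symG : forall y, D y -> (G y)^T = G y.
Hypothesis unitG : forall y, D y -> G y \in unitmx.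
Hypothesis CGp : mCinf V Gp.
Hypothesis Csigma : Cinf V sigma.
Hypothesis sigma0 : forall y, V y -> sigma y != 0.
Hypothesis GpE : forall y, V y -> Gp y = (sigma y)^-2 *: G y.
Hypothesis einGp : forall y, V y -> ricci Gp y = lam y *: Gp y.

Local Notation Gam := (christoffel G).
Local Notation mu i := (partial i sigma).
Local Notation d := (n.+1%:R : R).

Lemma Cinf_sub f : Cinf D f -> Cinf V f.
Proof. by move=> Cf k; exact: Ck_sub VD (Cf k). Qed.

Let CGV : mCinf V G. Proof. by move=> i j; exact: Cinf_sub. Qed.
Let symGV y : V y -> (G y)^T = G y. Proof. by move=> /VD; exact: symG. Qed.
Let unitGV y : V y -> G y \in unitmx. Proof. by move=> /VD; exact: unitG. Qed.

Let symGp y : V y -> (Gp y)^T = Gp y.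
Proof. by move=> Vy; rewrite GpE// linearZ /= symGV. Qed.

Let unitGp y : V y -> Gp y \in unitmx.
Proof.
move=> Vy; rewrite GpE// unitmxZ ?unitGV//.
by rewrite unitfE invr_eq0 expf_neq0// sigma0.
Qed.

Lemma einstein_constant i y : V y -> partial i lam y = 0.
Proof. exact: (schur oV CGp symGp unitGp einGp). Qed.

Lemma lam_Cinf : Cinf V lam.
Proof. exact: (einstein_Cinf oV CGp symGp unitGp einGp). Qed.

(** Since [Hess sigma = - sigma (Hess u - du du)], solving the Einstein equation for [Hess sigma]
    produces this multiple of the metric. The formula is singular where [sigma] tends to 0; its
    boundedness near the plane comes only from the differential system. *)
Definition phi y : R :=
  sigma y * (lam y * (sigma y)^-2 - conf_trace G sigma y) / (d - 2).

Let d2 : d - 2 != 0.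
Proof.
rewrite subr_eq0 eqr_nat; apply/eqP => e; by move: dim2; rewrite e.
Qed.

Let d1 : d - 1 != 0.
Proof.
rewrite subr_eq0 (eqr_nat R n.+1 1); apply/eqP => e; by move: dim2; rewrite e.
Qed.

Lemma conf_trace_Cinf : Cinf V (conf_trace G sigma).
Proof.
have Cu := dlog_Cinf oV Csigma sigma0.
have CU := dlogup_Cinf oV CGV unitGV Csigma sigma0.
apply: CinfB => //; last first.
  apply: CinfM => //; first exact: Cinf_cst.
  by apply: Cinf_sum => // k; exact: CinfM.
apply: CinfB => //.
  by apply: CinfN => //; apply: Cinf_sum => // k; exact: Cinf_partial.
apply: Cinf_sum => // l; apply: CinfM => //; apply: Cinf_sum => // k.
exact: christoffel_Cinf.
Qed.

Lemma phi_Cinf : Cinf V phi.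
Proof.
have Cl := lam_Cinf.
have Ci := CinfV oV sigma0 Csigma.
apply: CinfM => //; last exact: Cinf_cst.
apply: CinfM => //; apply: CinfB => //; last exact: conf_trace_Cinf.
apply: CinfM => //.
by apply: (Cinf_ext oV) (CinfM oV Ci Ci) => z Vz; rewrite expr2 invfM.
Qed.

Definition schouten i j y : R := ricci G y i j / (d - 2).

Lemma schouten_Cinf i j : Cinf D (schouten i j).
Proof.
apply: CinfM => //; last exact: Cinf_cst.
have C : Cinf D (fun y => \sum_k curv G k j y k i).
  by apply: Cinf_sum => // k; exact: curv_Cinf.
by apply: (Cinf_ext oD) C => z Dz; rewrite (ricci_curv oD symG i j Dz).
Qed.

Definition hess0 i j y : R :=
  \sum_k Gam k i j y * mu k y - sigma y * schouten i j y.

(* The almost Einstein equation: the trace-free part of [Hess sigma + sigma P]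
   vanishes, where [P] is the Schouten tensor up to a trace term. *)
Lemma hess_sigma i j y : V y ->
  partial i (mu j) y = hess0 i j y + phi y * G y i j.
Proof.
move=> Vy; have s0 := sigma0 Vy.
have /matrixP/(_ i j) := einGp Vy.
rewrite (ricci_conf oV CGV symGV unitGV CGp Csigma sigma0 GpE i j Vy).
rewrite [RHS]mxE GpE// [in RHS]mxE.
have e1 := partial_dlog oV Csigma sigma0 i j Vy.
have e2 := dlogM sigma0 i Vy.
have e3 := dlogM sigma0 j Vy.
have e4 : (\sum_k Gam k i j y * dlog sigma k y) * sigma y = - \sum_k Gam k i j y * mu k y.
  rewrite mulr_suml -sumrN; apply: eq_bigr => k _.
  by rewrite -mulrA (dlogM sigma0 k Vy) mulrN.
rewrite /phi /hess0 /schouten.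
move: e1 e2 e3 e4.
move: (conf_trace _ _ _) (partial i (dlog sigma j) y) (partial i (mu j) y) => S du dm.
move: (\sum_k Gam k i j y * dlog sigma k y) (\sum_k Gam k i j y * mu k y) => s1 s2.
move: (dlog sigma i y) (dlog sigma j y) (mu i y) (mu j y) s0 => ui uj mi mj.
move: (sigma y) (lam y) (ricci G y i j) (G y i j) => s l ric g s0 e1 e2 e3 e4 e.
apply: (mulfI d2).
(* The second derivative of [sigma] is expressed through [dlog], so that the combination occurring
   in [ricci_conf] appears and the Einstein equation [e] can replace it. *)
have -> : (d - 2) * dm = - ((d - 2) * (du - s1 - ui * uj)) * s + (d - 2) * s2.
  have -> : dm = - (du * s + uj * mi) by rewrite e1 opprK.
  have -> : s2 = - (s1 * s) by rewrite e4 opprK.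
  have -> : mi = - (ui * s) by rewrite e2 opprK.
  ring.
have -> : - ((d - 2) * (du - s1 - ui * uj)) = l * (s^-2 * g) - ric - g * S.
  by rewrite -e; ring.
have D2 := d2; move: (n.+1%:R : R) D2 => c D2.
by field; rewrite ?s0 ?D2.
Qed.

Let hess0_Cinf i j : Cinf V (hess0 i j).
Proof.
apply: CinfB => //.
  apply: Cinf_sum => // k; apply: CinfM => //; last exact: Cinf_partial.
  exact: christoffel_Cinf.
by apply: CinfM => //; apply: Cinf_sub; exact: schouten_Cinf.
Qed.

(* The symmetry of [d_i d_m d_j sigma] in [i] and [m], contracted with the inverse
   metric. *)
Lemma partial_phi m y : V y -> (d - 1) * partial m phi y =
  \sum_i \sum_j invmx (G y) i j *
    (partial i (hess0 m j) y - partial m (hess0 i j) y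
     + phi y * (partial i (fun z => G z m j) y - partial m (fun z => G z i j) y)).
Proof.
move=> Vy.
have C := phi_Cinf.
have pE a i j : partial a (partial i (mu j)) y = partial a (hess0 i j) y
    + (partial a phi y * G y i j + phi y * partial a (fun z => G z i j) y).
  have CP := CinfM oV C (CGV i j).
  transitivity (partial a (fun z => hess0 i j z + phi z * G z i j) y).
    by apply: (partial_ext _ oV) Vy => z Vz; exact: hess_sigma.
  by rewrite (partialD a (hess0_Cinf i j) CP Vy) (partialM a C (CGV i j) Vy).
have key i j : partial i (hess0 m j) y - partial m (hess0 i j) y
     + phi y * (partial i (fun z => G z m j) y - partial m (fun z => G z i j) y)
     = partial m phi y * G y i j - partial i phi y * G y m j.
  have := Clairaut i m oV (Cinf_partial j Csigma) Vy.
  move=> /(etrans (esym (pE i m j))) /esym /(etrans (esym (pE m i j))).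
  move: (partial i (hess0 m j) y) (partial m (hess0 i j) y)
    (partial i (fun z => G z m j) y) (partial m (fun z => G z i j) y).
  move: (partial m phi y) (partial i phi y) (phi y) (G y i j) (G y m j).
  by move=> a b c e f p q r s; lra.
under eq_bigr do under eq_bigr do rewrite key mulrBr.
under eq_bigr do rewrite sumrB; rewrite sumrB.
have HG a b : \sum_l invmx (G y) a l * G y l b = (a == b)%:R.
  by have /matrixP/(_ a b) := metric_mulVl unitGV Vy; rewrite !mxE.
have -> : \sum_i \sum_j invmx (G y) i j * (partial m phi y * G y i j)
    = partial m phi y * d.
  transitivity (\sum_(i < n.+1) partial m phi y).
    2: by rewrite sumr_const card_ord mulr_natr.
  apply: eq_bigr => i _.
  transitivity (partial m phi y * \sum_j invmx (G y) i j * G y j i).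
    rewrite mulr_sumr; apply: eq_bigr => j _.
    by rewrite mulrCA (metric_entryC symGV i j Vy).
  by rewrite HG eqxx mulr1.
have -> : \sum_i \sum_j invmx (G y) i j * (partial i phi y * G y m j) = partial m phi y.
  transitivity (\sum_i partial i phi y * (i == m)%:R).
    apply: eq_bigr => i _; rewrite -HG mulr_sumr; apply: eq_bigr => j _.
    by rewrite mulrCA (metric_entryC symGV m j Vy).
  exact: (sum_mul_delta (fun i => partial i phi y) m).
by rewrite mulrBl mul1r mulrC.
Qed.

(** One finite index type for [phi], [sigma] and the components of [mu], so that a single sum [N]
    measures the whole unknown of the linear system. *)
Definition scale_family (o : option (option 'I_n.+1)) : E -> R :=
  match o with None => phi | Some None => sigma | Some (Some i) => mu i end.

Local Notation N y := (\sum_o `|scale_family o y|).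

Lemma scale_family_Cinf o : Cinf V (scale_family o).
Proof.
by case: o => [[i|]|] /=; [exact: Cinf_partial|exact: Csigma|exact: phi_Cinf].
Qed.

(** [f = O(N)] at [x0], along [V] only: the point [x0] need not lie in [V], and the constants must
    hold uniformly up to it. *)
Definition lin_bound (f : E -> R) := exists K r : R, [/\ 0 < r, 0 <= K &
  forall y, box x0 r y -> V y -> `|f y| <= K * N y].

Definition locally_bounded (f : E -> R) := exists K r : R, [/\ 0 < r, 0 <= K &
  forall y, box x0 r y -> `|f y| <= K].

Lemma N_ge0 y : 0 <= N y. Proof. exact: sumr_ge0. Qed.

Lemma Cinf_locally_bounded f : Cinf D f -> locally_bounded f.
Proof.
move=> Cf; have [r r0 hr] := continuous_box (Cinf_cont Cf Dx0) ltr01.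
exists (1 + `|f x0|), r; split=> // y /hr h.
rewrite -[f y](subrK (f x0)); apply: le_trans (ler_normD _ _) _.
by rewrite lerD2r ltW.
Qed.

Lemma lin_bound_ext f g : (forall y, V y -> f y = g y) -> lin_bound f -> lin_bound g.
Proof.
move=> fg [K [r [r0 K0 h]]]; exists K, r; split=> // y by_ Vy.
by rewrite -fg//; exact: h.
Qed.

Lemma lin_boundD f g : lin_bound f -> lin_bound g -> lin_bound (fun y => f y + g y).
Proof.
move=> [K [r [r0 K0 h]]] [K' [r' [r0' K0' h']]].
exists (K + K'), (Num.min r r').
split; [by rewrite lt_min r0|exact: addr_ge0|move=> y by_ Vy].
rewrite mulrDl; apply: le_trans (ler_normD _ _) _; apply: lerD.
    by apply: h => //; apply: sub_box by_; rewrite ge_min lexx.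
  by apply: h' => //; apply: sub_box by_; rewrite ge_min lexx orbT.
Qed.

Lemma lin_boundM f g : locally_bounded f -> lin_bound g -> lin_bound (fun y => f y * g y).
Proof.
move=> [K [r [r0 K0 h]]] [K' [r' [r0' K0' h']]].
exists (K * K'), (Num.min r r').
split; [by rewrite lt_min r0|exact: mulr_ge0|move=> y by_ Vy].
rewrite normrM -mulrA; apply: ler_pM => //.
    by apply: h => //; apply: sub_box by_; rewrite ge_min lexx.
  by apply: h' => //; apply: sub_box by_; rewrite ge_min lexx orbT.
Qed.

Lemma locally_bounded_cst (a : R) : locally_bounded (fun=> a).
Proof. by exists `|a|, 1; split. Qed.

Lemma lin_boundZ a f : lin_bound f -> lin_bound (fun y => a * f y).
Proof. by apply: lin_boundM; exact: locally_bounded_cst. Qed.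

Lemma lin_boundN f : lin_bound f -> lin_bound (fun y => - f y).
Proof. by move=> /(lin_boundZ (-1)); apply: lin_bound_ext => y _; rewrite mulN1r. Qed.

Lemma lin_boundB f g : lin_bound f -> lin_bound g -> lin_bound (fun y => f y - g y).
Proof. by move=> lf lg; apply: lin_boundD lf _; exact: lin_boundN. Qed.

Lemma lin_bound_sum (I : Type) (s : seq I) (f : I -> E -> R) :
  (forall k : I, lin_bound (f k)) -> lin_bound (fun y => \sum_(k <- s) f k y).
Proof.
move=> lf; elim: s => [|k s IH].
  exists 0, 1; split=> // y _ _; by rewrite big_nil normr0 mul0r.
by apply: lin_bound_ext (lin_boundD (lf k) IH) => y _; rewrite big_cons.
Qed.

Lemma lin_bound_family o : lin_bound (scale_family o).
Proof.
exists 1, 1; split=> // y _ _; rewrite mul1r (bigD1 o)//= lerDl.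
exact: sumr_ge0.
Qed.

(** The system closes. The derivative of [sigma] is [mu], that of [mu] is given by [hess_sigma], and
    that of [phi] by [partial_phi]; all coefficients are smooth across [x0] because they come from
    [G] alone. *)
Lemma lin_bound_partial_family i o : lin_bound (partial i (scale_family o)).
Proof.
have lF := lin_bound_family.
have lphi : lin_bound phi := lF None.
have lsig : lin_bound sigma := lF (Some None).
have lmu k : lin_bound (mu k) := lF (Some (Some k)).
have CGam k a b : Cinf D (Gam k a b) := christoffel_Cinf oD CG unitG k a b.
have CGamV k a b : Cinf V (Gam k a b) := Cinf_sub (CGam k a b).
have CS a b := schouten_Cinf a b.
have CSV a b : Cinf V (schouten a b) := Cinf_sub (CS a b).
have lh0 a b : lin_bound (hess0 a b).
  apply: lin_boundB.
    apply: lin_bound_sum => k; apply: lin_boundM => //.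
    exact: Cinf_locally_bounded.
  apply: (lin_bound_ext (f := fun y => schouten a b y * sigma y)).
    by move=> y _; rewrite mulrC.
  by apply: lin_boundM => //; exact: Cinf_locally_bounded.
have lm a b : lin_bound (partial a (mu b)).
  apply: (lin_bound_ext (f := fun y => hess0 a b y + G y a b * phi y)).
    by move=> y Vy; rewrite hess_sigma// mulrC.
  apply: lin_boundD => //; apply: lin_boundM => //.
  exact: Cinf_locally_bounded (CG a b).
(* [hess0] contains first derivatives of [sigma] only, so its derivatives contain second ones at
   most, and these are controlled by [lm]. Hence no third derivative survives in [partial_phi]. *)
have ldh m a b : lin_bound (partial m (hess0 a b)).
  apply: (lin_bound_ext (f := fun y =>
      \sum_k (partial m (Gam k a b) y * mu k y + Gam k a b y * partial m (mu k) y)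
      - (schouten a b y * mu m y + partial m (schouten a b) y * sigma y))).
    move=> y Vy.
    have C1 k := CinfM oV (CGamV k a b) (Cinf_partial k Csigma).
    have C2 := CinfM oV Csigma (CSV a b).
    have C3 : Cinf V (fun z => \sum_k Gam k a b z * mu k z) by exact: Cinf_sum.
    rewrite (partialB oV m C3 C2 Vy) (partial_sum oV _ m C1 Vy).
    rewrite (partialM m Csigma (CSV a b) Vy); congr (_ - (_ + _)).
    - by apply: eq_bigr => k _; rewrite (partialM m (CGamV k a b) (Cinf_partial k Csigma) Vy).
    - exact: mulrC.
    - exact: mulrC.
  apply: lin_boundB.
    apply: lin_bound_sum => k; apply: lin_boundD; apply: lin_boundM => //.
      by apply: Cinf_locally_bounded; exact: Cinf_partial.
    exact: Cinf_locally_bounded.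
  apply: lin_boundD; apply: lin_boundM => //; apply: Cinf_locally_bounded => //.
  exact: Cinf_partial.
case: o => [[k|]|]; [exact: lm|exact: lmu|].
apply: (lin_bound_ext (f := fun y => (d - 1)^-1 *
   \sum_a \sum_b invmx (G y) a b *
    (partial a (hess0 i b) y - partial i (hess0 a b) y
     + (partial a (fun z => G z i b) y - partial i (fun z => G z a b) y) * phi y))).
  move=> y Vy; apply: (mulfI d1); rewrite mulVKf// [RHS]partial_phi//.
  apply: eq_bigr => a _; apply: eq_bigr => b _; congr (_ * (_ + _)).
  exact: mulrC.
apply: lin_boundZ; apply: lin_bound_sum => a; apply: lin_bound_sum => b.
apply: lin_boundM.
  exact: (Cinf_locally_bounded (inv_metric_Cinf oD CG unitG a b)).
apply: lin_boundD; first exact: lin_boundB.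
apply: lin_boundM => //; apply: Cinf_locally_bounded; apply: CinfB => //; apply: Cinf_partial; exact: CG.
Qed.

(** Solving the definition of [phi] for [lam] gives [lam = sigma ((d - 2) phi + Lap sigma) - (d - 1)
    |d sigma|^2], where the Laplacian is the divergence of [gr]. Every term has a factor [sigma] or
    [mu k], with a cofactor of order [N]. *)
Lemma lam_lin_bound : exists (L0 : E -> R) (L : 'I_n.+1 -> E -> R),
  [/\ lin_bound L0, forall k, lin_bound (L k) &
      forall y, V y -> lam y = sigma y * L0 y + \sum_k mu k y * L k y].
Proof.
pose gr k := grad G sigma k.
have lgr k : lin_bound (gr k).
  apply: lin_bound_sum => l; apply: lin_boundM.
    exact: (Cinf_locally_bounded (inv_metric_Cinf oD CG unitG k l)).
  exact: (lin_bound_family (Some (Some l))).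
have ldgr m k : lin_bound (partial m (gr k)).
  apply: (lin_bound_ext (f := fun y => \sum_l (partial m (fun z => invmx (G z) k l) y * mu l y
     + invmx (G y) k l * partial m (mu l) y))).
    have CH l := Cinf_sub (inv_metric_Cinf oD CG unitG k l).
    move=> y Vy.
    rewrite [RHS](partial_sum oV (F := fun l z => invmx (G z) k l * mu l z) _ m _ Vy); last first.
      by move=> l; apply: CinfM => //; exact: Cinf_partial.
    apply: eq_bigr => l _.
    by rewrite (partialM m (CH l) (Cinf_partial l Csigma) Vy).
  apply: lin_bound_sum => l.
  have CH := inv_metric_Cinf oD CG unitG k l.
  apply: lin_boundD; apply: lin_boundM.
  - by apply: Cinf_locally_bounded; exact: Cinf_partial.
  - exact: (lin_bound_family (Some (Some l))).
  - exact: Cinf_locally_bounded.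
  - exact: (lin_bound_partial_family m (Some (Some l))).
exists (fun y => (d - 2) * phi y + \sum_k partial k (gr k) y
  + \sum_l (\sum_k Gam k k l y) * gr l y), (fun k y => - (d - 1) * gr k y).
split.
- apply: lin_boundD; [apply: lin_boundD|].
  + by apply: lin_boundZ; exact: (lin_bound_family None).
  + exact: lin_bound_sum.
  + apply: lin_bound_sum => l; apply: lin_boundM => //.
    by apply: Cinf_locally_bounded; apply: Cinf_sum => // k; exact: christoffel_Cinf.
- by move=> k; exact: lin_boundZ.
move=> y Vy; have s0 := sigma0 Vy.
have e1 k : partial k (gr k) y = - (partial k (dlogup G sigma k) y * sigma y)
    - dlogup G sigma k y * mu k y.
  by rewrite -opprD (partial_dlogup oV CGV unitGV Csigma sigma0 k k Vy) opprK.
have e2 l : gr l y = - (dlogup G sigma l y * sigma y).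
  by rewrite (dlogupM G sigma0 l Vy) opprK.
have e3 k : mu k y = - (dlog sigma k y * sigma y) by rewrite (dlogM sigma0 k Vy) opprK.
under eq_bigr do rewrite e1.
under [X in _ + X]eq_bigr do rewrite e2 e3.
under [X in _ * (_ + X)]eq_bigr do rewrite e2.
under eq_bigr do rewrite e3.
rewrite sumrB sumrN -mulr_suml.
have -> : \sum_k dlogup G sigma k y * (- (dlog sigma k y * sigma y)) =
    - (\sum_k dlog sigma k y * dlogup G sigma k y) * sigma y.
  by rewrite mulNr mulr_suml -sumrN; apply: eq_bigr => k _; ring.
have -> : \sum_l (\sum_k Gam k k l y) * (- (dlogup G sigma l y * sigma y)) =
    - (\sum_l (\sum_k Gam k k l y) * dlogup G sigma l y) * sigma y.
  by rewrite mulNr mulr_suml -sumrN; apply: eq_bigr => k _; ring.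
have -> : \sum_k - (dlog sigma k y * sigma y) * (- (d - 1) * (- (dlogup G sigma k y * sigma y)))
   = - (d - 1) * (\sum_k dlog sigma k y * dlogup G sigma k y) * (sigma y * sigma y).
  rewrite mulr_sumr mulr_suml; apply: eq_bigr => k _.
  move: (dlog sigma k y) (dlogup G sigma k y) (sigma y) => p q r; ring.
rewrite /phi /conf_trace.
move: (\sum_k partial k (dlogup G sigma k) y) (\sum_k dlog sigma k y * dlogup G sigma k y)
  (\sum_l (\sum_k Gam k k l y) * dlogup G sigma l y) => a b c'.
move: (sigma y) (lam y) s0 => s l s0.
have D2 := d2; move: (n.+1%:R : R) D2 => c D2.
by field; rewrite ?s0 ?D2.
Qed.

End EinsteinScale.

(** * Extension across a plane of codimension 2 *)

Section Extension.
Context {R : realType} {n : nat}.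
Local Notation E := 'rV[R]_n.+1.
Local Notation ev i := (delta_mx 0 i : E).
Implicit Types (p q x y z : E) (i j k : 'I_n.+1).

Definition dist1 p q : R := \sum_i `|q 0 i - p 0 i|.

Lemma dist1_ge0 p q : 0 <= dist1 p q.
Proof. exact: sumr_ge0. Qed.

Lemma dist1C p q : dist1 p q = dist1 q p.
Proof. by apply: eq_bigr => i _; rewrite distrC. Qed.

Lemma dist1xx p : dist1 p p = 0.
Proof. by apply: big1 => i _; rewrite subrr normr0. Qed.

Lemma dist1_triangle q p z : dist1 p z <= dist1 p q + dist1 q z.
Proof.
rewrite /dist1 -big_split /=; apply: ler_sum => i _.
by rewrite addrC; exact: ler_distD.
Qed.

(** McShane's extension: the infimum over [p] in [S] of [f p + C * dist1 p z] has the same Lipschitz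
    constant. *)
Lemma lipschitz_extend (S : set E) (f : E -> R) (C : R) : 0 <= C -> S !=set0 ->
  (forall p q, S p -> S q -> `|f q - f p| <= C * dist1 p q) ->
  exists g : E -> R, (forall p, S p -> g p = f p) /\
    forall p q, `|g q - g p| <= C * dist1 p q.
Proof.
move=> C0 [p0 Sp0] lf.
pose B z : set R := [set f p + C * dist1 p z | p in S].
have tri p q z : C * dist1 p z <= C * dist1 p q + C * dist1 q z.
  by rewrite -mulrDr; apply: ler_wpM2l => //; exact: dist1_triangle.
have lbB z : lbound (B z) (f p0 - C * dist1 p0 z).
  move=> _ [p Sp <-].
  have := lf _ _ Sp Sp0; have := tri p z p0; rewrite (dist1C z p0).
  move: (C * dist1 p p0) (C * dist1 p z) (C * dist1 p0 z) (f p) (f p0) => a b c d e.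
  rewrite ler_norml => h1 /andP[h2 h3]; lra.
have B0 z : B z !=set0 by exists (f p0 + C * dist1 p0 z), p0.
pose g z := inf (B z).
have gle p z : S p -> g z <= f p + C * dist1 p z.
  by move=> Sp; apply: ge_inf; [eexists; exact: lbB|exists p].
have leg m z : lbound (B z) m -> m <= g z by exact: lb_le_inf.
exists g; split=> [p Sp|].
  apply/eqP; rewrite eq_le; apply/andP; split.
    by have := gle p p Sp; rewrite dist1xx mulr0 addr0.
  apply: leg => _ [q Sq <-]; have := lf _ _ Sq Sp.
  move: (C * dist1 q p) (f p) (f q) => c d e.
  rewrite ler_norml => /andP[h2 h3]; lra.
have half p q : g q - C * dist1 p q <= g p.
  apply: leg => _ [s Ss <-]; have := gle s q Ss; have := tri s p q.
  move: (C * dist1 p q) (C * dist1 s p) (C * dist1 s q) (f s) (g q) => c d e k l; lra.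
move=> p q; have := half p q; have := half q p; rewrite (dist1C q p).
move: (C * dist1 p q) (g p) (g q) => c d e h1 h2.
rewrite ler_norml; apply/andP; lra.
Qed.

Section CodimensionTwo.
Variables (x0 : E) (a b : 'I_n.+1).
Hypothesis ab : a != b.

(* [off] is the complement of the codimension 2 plane; [gen] the complement of
   two hyperplanes containing it, in which points can be joined inside [off] by
   changing the coordinates one after the other. *)
Definition off y := (y 0 a != x0 0 a) || (y 0 b != x0 0 b).
Definition gen y := (y 0 a != x0 0 a) && (y 0 b != x0 0 b).

Lemma gen_off y : gen y -> off y.
Proof. by rewrite /gen /off => /andP[->]. Qed.

(** A move along one axis changes at most one of the coordinates [a] and [b], and meeting the plane
    would require both to become critical. *)
Lemma off_shift p (t : R) k : gen p -> off (t *: ev k + p).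
Proof.
rewrite /gen /off !coord_shift => /andP[pa pb].
have [ak|ak] := eqVneq a k; last by rewrite mulr0 add0r pa.
by rewrite (_ : b == k = false) ?mulr0 ?add0r ?pb ?orbT// -ak eq_sym (negbTE ab).
Qed.

Lemma mix_gen p q (k : nat) : gen p -> gen q -> gen (mix p q k).
Proof.
rewrite /gen !mxE => /andP[pa pb] /andP[qa qb].
by apply/andP; split; case: ifP.
Qed.

(** The staircase between two points of [gen] has its corners in [gen]; its edges may cross a
    hyperplane but never the plane. So the bound also relates points in different components of
    [gen]. *)
Lemma gen_increment r (f : E -> R) (c : R) p q :
  (forall i z, box x0 r z -> off z ->
     derivable f z (ev i) /\ `|partial i f z| <= c) ->
  box x0 r p -> gen p -> box x0 r q -> gen q ->
  `|f q - f p| <= c * dist1 p q.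
Proof.
move=> fQ bp gp bq gq.
have := @path_increment R n f (fun=> 0) c (fun z => box x0 r z /\ off z) p q.
rewrite big1 ?subr0 => [|i _]; last by rewrite mulr0.
apply=> [k t tb|i z []]; last by rewrite subr0; exact: fQ.
split; last by apply: off_shift; exact: mix_gen.
by apply: (box_between (s := q 0 k - p 0 k)) tb; rewrite -?mixS; exact: mix_box.
Qed.

Variables (A : finType) (V : set E) (h : A -> E -> R) (r0 K : R).
Hypothesis oV : open V.
Hypothesis Ch : forall o, Cinf V (h o).
Hypothesis r00 : 0 < r0.
Hypothesis K0 : 0 <= K.
Hypothesis offV : forall y, box x0 r0 y -> off y -> V y.

Local Notation N y := (\sum_o `|h o y|).

Hypothesis dh : forall o i y, box x0 r0 y -> off y -> `|partial i (h o) y| <= K * N y.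

Let N_cont y : V y -> {for y, continuous (fun z => N z)}.
Proof.
move=> Vy; elim: (index_enum A) => [|o s IH].
  have -> : (fun z => \sum_(i <- [::]) `|h i z|) = (fun=> 0).
    by apply/funext => z; rewrite big_nil.
  exact: cst_continuous.
have -> : (fun z => \sum_(i <- o :: s) `|h i z|) = (fun z => `|h o z| + \sum_(i <- s) `|h i z|).
  by apply/funext => z; rewrite big_cons.
apply: (@continuousD _ _ _ (fun z => `|h o z|) (fun z => \sum_(i <- s) `|h i z|)) => //.
apply: (@continuous_comp _ _ _ (h o) Num.norm); last exact: norm_continuous.
exact: (Cinf_cont (Ch o) Vy).
Qed.

(* On a segment short enough that [#|A| K |s| <= 1/2], the maximum of [N] is at
   most [N p + N_max / 2]. *)
Let growth p k (s : R) : box x0 r0 p -> box x0 r0 (s *: ev k + p) -> gen p ->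
  #|A|%:R * K * `|s| <= 2^-1 ->
  forall t, between t s -> N (t *: ev k + p) <= 2 * N p.
Proof.
move=> bp bs gp small.
have offt t : off (t *: ev k + p) by exact: off_shift.
have boxt t : between t s -> box x0 r0 (t *: ev k + p) by exact: box_between.
have Vt t : between t s -> V (t *: ev k + p) by move=> /boxt bt; exact: offV.
pose psi (t : R) := N (t *: ev k + p).
have cpsi t : between t s -> {for t, continuous psi}.
  move=> ts; apply: (@continuous_comp _ _ _ (fun t : R => t *: ev k + p) (fun z => N z)).
    apply: continuousD; last exact: cst_continuous.
    exact: scalel_continuous.
  exact: N_cont (Vt t ts).
have [tm [tms mx]] : exists tm, between tm s /\ forall t, between t s -> psi t <= psi tm.
  have [s0|s0] := leP 0 s.
    have e t : (t \in `[0, s]) = between t s.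
      rewrite in_itv /between /=; apply/idP/idP => [->//|/orP[]// /andP[h1 h2]].
      by apply/andP; lra.
    have [|t ts mx] := @EVT_max R psi 0 s s0.
      by apply: continuous_in_subspaceT => t /[1!inE] /=; rewrite e; exact: cpsi.
    by exists t; split; [rewrite -e|move=> u; rewrite -e; exact: mx].
  have e t : (t \in `[s, 0]) = between t s.
    rewrite in_itv /between /=; apply/idP/idP => [->//|/orP[]// /andP[h1 h2]].
      by rewrite orbT.
    by apply/andP; lra.
  have [|t ts mx] := @EVT_max R psi s 0 (ltW s0).
    by apply: continuous_in_subspaceT => t /[1!inE] /=; rewrite e; exact: cpsi.
  by exists t; split; [rewrite -e|move=> u; rewrite -e; exact: mx].
have tms' : `|tm| <= `|s|.
  move: tms; rewrite /between => /orP[]/andP[h1 h2].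
    by rewrite !ger0_norm//; lra.
  by rewrite !ler0_norm//; lra.
have btw u t : between u t -> between t s -> between u s.
  by rewrite /between => /orP[]/andP[h1 h2] /orP[]/andP[h3 h4]; apply/orP; lra.
have Nm : N (tm *: ev k + p) <= N p + #|A|%:R * K * `|s| * psi tm.
  apply: le_trans (_ : \sum_o (`|h o p| + K * `|s| * psi tm) <= _); last first.
    by rewrite big_split /= sumr_const -[X in _ + X <= _]mulr_natl !mulrA.
  apply: ler_sum => o _.
  have [u ut eu] := axis_mvt (fun u (ut : between u tm) =>
     Cinf_derivable (Ch o) (Vt u (btw _ _ ut tms))).
  rewrite -[h o (tm *: _ + _)](subrK (h o p)) eu addrC.
  apply: le_trans (ler_normD _ _) _; rewrite lerD2l normrM mulrC.
  have us : between u s by exact: btw ut tms.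
  rewrite -mulrA [`|s| * _]mulrC mulrA; apply: ler_pM => //.
  apply: le_trans (dh o k (boxt _ us) (offt _)) _.
  by apply: ler_wpM2l => //; exact: mx.
move=> t ts; apply: le_trans (mx t ts) _.
have psi0 : 0 <= psi tm by exact: sumr_ge0.
have := ler_wpM2r psi0 small; move: Nm; rewrite -/(psi tm).
move: (psi tm) (N p) (#|A|%:R * K * `|s|) => u v w; nra.
Qed.

Let base (r : R) : E := x0 + r *: (ev a + ev b).

Let base_coord (r : R) i : base r 0 i - x0 0 i = r * ((i == a) || (i == b))%:R.
Proof.
have -> : base r 0 i = x0 0 i + r * ((i == a)%:R + (i == b)%:R) by rewrite !mxE eqxx.
rewrite addrAC subrr add0r; have [->|_] := eqVneq i a.
  by rewrite (negbTE ab) addr0.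
by rewrite add0r.
Qed.

Lemma base_gen (r : R) : r != 0 -> gen (x0 + r *: (ev a + ev b)).
Proof.
move=> rn; rewrite /gen -!(subr_eq0 _ (x0 0 _)) -/(base r) !base_coord.
by rewrite !eqxx orbT mulr1 rn.
Qed.

Lemma base_box (r s : R) : `|s| < r -> box x0 r (x0 + s *: (ev a + ev b)).
Proof.
move=> sr i; rewrite -/(base s) base_coord; case: (_ || _) => /=.
  by rewrite mulr1.
by rewrite mulr0 normr0; exact: le_lt_trans sr.
Qed.

(** A discrete Gronwall estimate. Each edge of a staircase from a fixed base point at most doubles
    [N], which gives the factor [2 ^+ n.+1] on [gen]; one further edge reaches the remaining points
    off the plane. *)
Lemma codim2_bound : exists r C : R, [/\ 0 < r, r <= r0, 0 <= C &
  forall z, box x0 r z -> off z -> N z <= C].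
Proof.
(* Coordinates of two points of the box of radius [r] differ by less than [2 * r]; with [r <= D^-1]
   every edge then satisfies the smallness condition of [growth]. *)
pose D := 4 * (#|A|%:R * K + 1).
have c0 : 0 <= #|A|%:R * K by rewrite mulr_ge0.
have D0 : 0 < D by rewrite /D; lra.
pose r := Num.min r0 (D^-1).
have r1 : 0 < r by rewrite lt_min r00 invr_gt0.
have rr0 : r <= r0 by rewrite ge_min lexx.
have small (s : R) : `|s| < 2 * r -> #|A|%:R * K * `|s| <= 2^-1.
  move=> sr; apply: le_trans (ler_wpM2l c0 (ltW sr)) _.
  have rD : r <= D^-1 by rewrite ge_min lexx orbT.
  have : r * D <= 1 by rewrite -ler_pdivlMr// div1r.
  rewrite /D; move: (#|A|%:R * K) c0 => c hc; nra.
have diff p q k : box x0 r p -> box x0 r q -> `|q 0 k - p 0 k| < 2 * r.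
  move=> bp bq; rewrite -(subrKA (x0 0 k)).
  apply: le_lt_trans (ler_normD _ _) _.
  have := bp k; have := bq k; rewrite (distrC (x0 0 k)).
  move: (`|q 0 k - x0 0 k|) (`|p 0 k - x0 0 k|) => u v; lra.
have up z : box x0 r z -> box x0 r0 z by exact: sub_box.
have half : `|r / 2| < r by rewrite gtr0_norm; lra.
have half0 : r / 2 != 0 by rewrite lt0r_neq0//; lra.
pose ps := base (r / 2).
have gps : gen ps by exact: base_gen.
have bps : box x0 r ps by exact: base_box.
have Ngen p : box x0 r p -> gen p -> N p <= 2 ^+ n.+1 * N ps.
  move=> bp gp.
  have st (k : nat) : (k <= n.+1)%N -> N (mix ps p k) <= 2 ^+ k * N ps.
    elim: k => [_|k IH kn].
      by rewrite mix0 mul1r.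
    have := growth (up _ (mix_box k bps bp)) (k := Ordinal kn)
      (s := p 0 (Ordinal kn) - ps 0 (Ordinal kn)).
    rewrite -(mixS ps p (Ordinal kn)) => /(_ (up _ (mix_box k.+1 bps bp)) (mix_gen k gps gp)).
    move=> /(_ (small _ (diff _ _ _ bps bp)) (p 0 (Ordinal kn) - ps 0 (Ordinal kn))).
    rewrite -(mixS ps p (Ordinal kn)) => Nk.
    apply: le_trans (Nk _) _.
      by rewrite /between; case: (leP 0 (p 0 (Ordinal kn) - _)) => /= ?; rewrite ?lexx ?orbT//= ltW.
    by rewrite exprS -mulrA ler_pM2l//; apply: IH; exact: ltnW.
  by have := st n.+1 (leqnn _); rewrite mix_full.
have Nps : 0 <= N ps by exact: sumr_ge0.
exists r, (2 * (2 ^+ n.+1 * N ps)); split=> //.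
  by rewrite !mulr_ge0// exprn_ge0.
move=> z bz oz.
have [gz|ngz] := boolP (gen z).
  apply: le_trans (Ngen z bz gz) _; rewrite ler_peMl ?ler1n// mulr_ge0// exprn_ge0//.
(* Exactly one of the two coordinates is critical. Moving it away by [r / 2] lands in [gen] inside
   the box, and [z] is reached back from there along one axis. *)
have [k [zk gz']] : exists k, z 0 k = x0 0 k /\ gen ((r / 2) *: ev k + z).
  move: oz ngz; rewrite /off /gen; have [za|za] := eqVneq (z 0 a) (x0 0 a).
    move=> /= zb _; exists a; split=> //; rewrite !coord_shift eqxx mulr1 za.
    rewrite (_ : b == a = false) ?mulr0 ?add0r ?zb ?andbT; last by rewrite eq_sym (negbTE ab).
    by rewrite -subr_eq0 addrK.
  move=> /= _; rewrite negbK => /eqP zb; exists b; split=> //.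
  rewrite !coord_shift eqxx mulr1 zb (negbTE ab) mulr0 add0r za /=.
  by rewrite -subr_eq0 addrK.
set p' := _ *: ev k + z in gz'.
have bp' : box x0 r p'.
  move=> i; rewrite coord_shift; have [->|_] := eqVneq i k.
    by rewrite mulr1 zk addrK.
  by rewrite mulr0 add0r; exact: bz.
have zE : z = (- (r / 2)) *: ev k + p' by rewrite /p' addrA scaleNr addNr add0r.
have bz' : box x0 r (- (r / 2) *: ev k + p') by rewrite -zE.
rewrite {1}zE; apply: le_trans (growth (up _ bp') (up _ bz') gz' _ _) _.
- by apply: small; rewrite normrN; lra.
- by rewrite /between lexx; apply/orP; right => /=; lra.
- by rewrite ler_pM2l//; exact: Ngen.
Qed.

End CodimensionTwo.
End Extension.

(** * Lipschitz extension of the scale and the case of vanishing [sigma] *)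

Section ScaleExtension.
Context {R : realType} {n : nat}.
Local Notation E := 'rV[R]_n.+1.
Local Notation M := 'M[R]_n.+1.
Local Notation ev i := (delta_mx 0 i : E).
Implicit Types (y p q z : E) (i j k l m : 'I_n.+1).
Variables (D V : set E) (G Gp : E -> M) (sigma lam : E -> R) (x0 : E).
Variables (a b : 'I_n.+1) (r1 : R).
Hypothesis dim2 : (2 < n.+1)%N.
Hypothesis oD : open D.
Hypothesis oV : open V.
Hypothesis VD : V `<=` D.
Hypothesis Dx0 : D x0.
Hypothesis CG : mCinf D G.
Hypothesis symG : forall y, D y -> (G y)^T = G y.
Hypothesis unitG : forall y, D y -> G y \in unitmx.
Hypothesis CGp : mCinf V Gp.
Hypothesis Csigma : Cinf V sigma.
Hypothesis sigma_gt0 : forall y, V y -> 0 < sigma y.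
Hypothesis GpE : forall y, V y -> Gp y = (sigma y)^-2 *: G y.
Hypothesis einGp : forall y, V y -> ricci Gp y = lam y *: Gp y.
Hypothesis ab : a != b.
Hypothesis r10 : 0 < r1.
Hypothesis offV : forall y, box x0 r1 y -> off x0 a b y -> V y.

Local Notation fam := (scale_family G sigma lam).
Local Notation mu i := (partial i sigma).
Local Notation N y := (\sum_o `|fam o y|).
Local Notation lin := (lin_bound V G sigma lam x0).

Let sigma0 y : V y -> sigma y != 0.
Proof. by move=> /sigma_gt0 /lt0r_neq0. Qed.

Let Cfam o : Cinf V (fam o).
Proof. exact: (scale_family_Cinf oV VD CG symG unitG CGp Csigma sigma0 GpE einGp). Qed.

Lemma lin_bound_finite (I : finType) (f : I -> E -> R) :
  (forall k : I, lin (f k)) -> exists K r : R, [/\ 0 < r, 0 <= K &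
  forall (k : I) y, box x0 r y -> V y -> `|f k y| <= K * N y].
Proof.
move=> lf.
have lnorm (k : I) : lin (fun y => `|f k y|).
  have [K [r [r0 K0 h]]] := lf k; exists K, r; split=> // y by_ Vy.
  by rewrite normr_id; exact: h.
have [K [r [r0 K0 h]]] := lin_bound_sum (index_enum I) lnorm.
exists K, r; split=> // k y by_ Vy; apply: le_trans (h y by_ Vy).
rewrite [leRHS]ger0_norm; last exact: sumr_ge0.
by rewrite (bigD1 k)//= lerDl; exact: sumr_ge0.
Qed.

(** Constancy across the components of [gen]: [gen_increment] with gradient bound 0, by Schur's
    lemma off the plane. *)
Lemma lam_gen_constant r p q : r <= r1 -> box x0 r p -> gen x0 a b p ->
  box x0 r q -> gen x0 a b q -> lam q = lam p.
Proof.
move=> rr bp gp bq gq.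
have Cl := lam_Cinf oV VD symG unitG CGp sigma0 GpE einGp.
have : `|lam q - lam p| <= 0 * dist1 p q.
  apply: (gen_increment ab _ bp gp bq gq) => i z bz oz.
  have Vz : V z by apply: offV => //; exact: sub_box bz.
  split; first exact: (Cinf_derivable Cl Vz).
  by rewrite (einstein_constant dim2 oV VD symG unitG CGp sigma0 GpE einGp i Vz) normr0.
by rewrite mul0r normr_le0 subr_eq0 => /eqP.
Qed.

(** The bound on [N] turns the linear estimates into absolute ones. In the formula for [lam] only
    the cofactors are estimated this way, so that the smallness of [sigma] and [mu] is retained. *)
Lemma scale_bounds : exists r C : R, [/\ 0 < r, r <= r1, 0 <= C,
  forall z o i, box x0 r z -> off x0 a b z -> `|partial i (fam o) z| <= C &
  forall z, box x0 r z -> off x0 a b z ->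
    `|lam z| <= C * (sigma z + \sum_k `|mu k z|)].
Proof.
have lp i o := lin_bound_partial_family dim2 oD oV VD Dx0 CG symG unitG CGp
  Csigma sigma0 GpE einGp i o.
have [K [r [r0 K0 hK]]] := lin_bound_finite (f := fun io => partial io.1 (fam io.2))
  (fun io => lp io.1 io.2).
have [L0 [L [lL0 lL lamE]]] := lam_lin_bound dim2 oD oV VD Dx0 CG symG unitG CGp
  Csigma sigma0 GpE einGp.
have [K1 [s [s0 K10 hK1]]] := lin_bound_finite
  (f := fun o : option 'I_n.+1 => if o is Some k then L k else L0)
  (fun o => match o with Some k => lL k | None => lL0 end).
pose r2 := Num.min r1 (Num.min r s).
have r20 : 0 < r2 by rewrite !lt_min r10 r0.
have offV2 y : box x0 r2 y -> off x0 a b y -> V y.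
  by move=> b2; apply: offV; apply: sub_box b2; rewrite ge_min lexx.
have hK2 o i y : box x0 r2 y -> off x0 a b y -> `|partial i (fam o) y| <= K * N y.
  move=> b2 oy; apply: (hK (i, o)); last exact: offV2.
  by apply: sub_box b2; rewrite !ge_min lexx !orbT.
have [r3 [C [r30 r32 C0 hC]]] := codim2_bound ab Cfam r20 K0 offV2 hK2.
have r31 : r3 <= r1 by apply: le_trans r32 _; rewrite ge_min lexx.
exists r3, ((K + K1) * C); split=> //; first by rewrite mulr_ge0// addr_ge0.
  move=> z o i bz oz.
  apply: le_trans (hK2 o i z (sub_box r32 bz) oz) _.
  have := hC z bz oz; have := N_ge0 G sigma lam z.
  move: (N z) => v v0 vC; nra.
move=> z bz oz.
have Vz : V z by apply: offV2 => //; exact: sub_box bz.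
have bs : box x0 s z.
  by apply: sub_box bz; apply: le_trans r32 _; rewrite !ge_min lexx !orbT.
have hL o : `|(if o is Some k then L k else L0) z| <= (K + K1) * C.
  apply: le_trans (hK1 o z bs Vz) _.
  have := hC z bz oz; have := N_ge0 G sigma lam z.
  move: (N z) => v v0 vC; nra.
rewrite lamE// mulrDr mulr_sumr; apply: le_trans (ler_normD _ _) _; apply: lerD.
  rewrite normrM (gtr0_norm (sigma_gt0 Vz)) mulrC; apply: ler_wpM2r.
    exact: ltW (sigma_gt0 Vz).
  exact: (hL None).
apply: le_trans (ler_norm_sum _ _ _) _; apply: ler_sum => k _.
by rewrite normrM mulrC; apply: ler_wpM2r => //; exact: (hL (Some k)).
Qed.

(** On [gen] the family is Lipschitz for [dist1], so each member extends to the whole space;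
    agreement with the original is claimed on [gen] only. The last clause is the second-order
    argument that a nonnegative function vanishing at [x0] has small differential nearby. *)
Lemma scale_extension : exists (r C : R) (ext : option (option 'I_n.+1) -> E -> R),
  [/\ [/\ 0 < r, r <= r1 & 0 <= C],
   forall o p q, `|ext o q - ext o p| <= C * dist1 p q,
   forall o p, box x0 r p -> gen x0 a b p -> ext o p = fam o p &
   ext (Some None) x0 = 0 ->
     forall p, box x0 r p -> gen x0 a b p -> lam p = 0].
Proof.
have [r [C [r0 rr1 C0 hd hl]]] := scale_bounds.
have offVr y : box x0 r y -> off x0 a b y -> V y.
  by move=> br; apply: offV; exact: sub_box br.
have lip o p q : (box x0 r `&` gen x0 a b) p -> (box x0 r `&` gen x0 a b) q ->
    `|fam o q - fam o p| <= C * dist1 p q.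
  move=> [bp gp] [bq gq]; apply: (gen_increment ab _ bp gp bq gq) => i z bz oz.
  by split; [exact: (Cinf_derivable (Cfam o) (offVr z bz oz))|exact: hd].
have S0 : (box x0 r `&` gen x0 a b) !=set0.
  exists (x0 + (r / 2) *: (ev a + ev b)); split.
    by apply: base_box; rewrite // gtr0_norm; lra.
  by apply: base_gen => //; rewrite lt0r_neq0//; lra.
have ex o := lipschitz_extend C0 S0 (lip o).
pose ext o := sval (cid (ex o)).
have extE o p : box x0 r p -> gen x0 a b p -> ext o p = fam o p.
  by move=> bp gp; exact: (svalP (cid (ex o))).1.
have extL o p q : `|ext o q - ext o p| <= C * dist1 p q.
  exact: (svalP (cid (ex o))).2.
clearbody ext.
exists r, C, ext; split=> //.
move=> ext0 p bp gp.
pose d : R := n.+1%:R.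
have d1 : 1 <= d by rewrite /d ler1n.
(* The sum of the later bounds: [sigma] contributes [d * C * s ^+ 2], at most [d * C * s], and each
   of the [d] components of [mu] contributes [(d + 1) * C * s]. *)
pose Q := C * (d * C + d * ((d + 1) * C)).
have Q0 : 0 <= Q by rewrite /Q; nra.
(* At distance [s^2] from [x0], [sigma = O(s^2)]; as [sigma] is still positive at
   distance [s] along each axis, [mu = O(s)], and so [lam = O(s)]. *)
have small s : 0 < s -> s <= 1 -> s < r / 2 -> `|lam p| <= Q * s.
  move=> s0 s1 sr.
  (* A generic point, so that axis moves from it avoid the plane; at distance of order [s ^+ 2], so
     that [sigma] is negligible against a move of length [s]. *)
  pose ps := x0 + (s ^+ 2) *: (ev a + ev b).
  have ss : s ^+ 2 <= s by rewrite expr2; nra.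
  have ss0 : 0 < s ^+ 2 by rewrite exprn_gt0.
  have bps2 : box x0 (r / 2) ps.
    by apply: base_box => //; rewrite gtr0_norm//; lra.
  have bps : box x0 r ps by apply: sub_box bps2; lra.
  have gps : gen x0 a b ps by apply: base_gen => //; rewrite lt0r_neq0.
  have Vps : V ps by apply: offVr => //; exact: gen_off.
  have sigps : sigma ps <= d * C * s ^+ 2.
    have := extL (Some None) x0 ps.
    rewrite ext0 subr0 extE//.
    rewrite /= gtr0_norm ?sigma_gt0// => /le_trans; apply.
    rewrite mulrAC [_ * C]mulrC; apply: ler_wpM2l => //.
    rewrite /d mulr_natl -[in leRHS](card_ord n.+1) -sumr_const; apply: ler_sum => i _.
    have bb : box x0 (s ^+ 2 + s ^+ 2 * 1) ps by apply: base_box => //; rewrite gtr0_norm//; lra.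
    rewrite leNgt; apply/negP => h.
    have /(_ i) : box x0 (`|ps 0 i - x0 0 i|) ps by apply: base_box => //; rewrite gtr0_norm.
    by rewrite ltxx.
  (* Taylor expansion of order two along an axis, from two uses of the mean value theorem; the left
     side of [0 <=] dominates the positive value of [sigma] at the end of the move. *)
  have muneg i (t : R) : `|t| = s -> 0 <= sigma ps + t * mu i ps + C * s ^+ 2.
    move=> ts.
    have boxt u : between u t -> box x0 r (u *: ev i + ps).
      move=> ut; apply: (box_between (s := t)) => // k; rewrite coord_shift.
      rewrite -addrA; apply: le_lt_trans (ler_normD _ _) _.
      have h1 := bps2 k.
      have h2 : `|t * (k == i)%:R| <= s.
        by rewrite normrM ts; case: (k == i); rewrite ?normr1 ?normr0; lra.
      by move: h1 h2; move: (`|ps 0 k - x0 0 k|) (`|t * _|) => u1 u2; lra.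
    have offt u : off x0 a b (u *: ev i + ps) by exact: off_shift.
    have Vt u : between u t -> V (u *: ev i + ps) by move=> /boxt bu; exact: offVr.
    have btt : between t t.
      by rewrite /between; case: (leP 0 t) => /= h; rewrite ?lexx ?orbT//= ltW.
    have [u ut eu] := axis_mvt (fun u (ut : between u t) => Cinf_derivable Csigma (Vt u ut)).
    have btw v : between v u -> between v t.
      by move: ut; rewrite /between => /orP[]/andP[h1 h2] /orP[]/andP[h3 h4]; apply/orP; lra.
    have [v vu ev'] := axis_mvt (fun v (vu : between v u) =>
      Cinf_derivable (Cinf_partial i Csigma) (Vt v (btw v vu))).
    have hv := hd _ (Some (Some i)) i (boxt v (btw v vu)) (offt v).
    have us : `|u| <= s.
      rewrite -ts; move: ut; rewrite /between => /orP[]/andP[h1 h2].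
        by rewrite !ger0_norm//; lra.
      by rewrite !ler0_norm//; lra.
    have st := sigma_gt0 (Vt t btt).
    have e1 : sigma (t *: ev i + ps) = sigma ps + t * partial i sigma (u *: ev i + ps).
      by rewrite -eu [RHS]addrC subrK.
    have e2 : partial i sigma (u *: ev i + ps) = mu i ps
        + u * partial i (partial i sigma) (v *: ev i + ps) by rewrite -ev' [RHS]addrC subrK.
    rewrite e1 e2 in st.
    move: hv st; rewrite /=; move: (partial i (partial i sigma) _) => w hw st.
    have : t * (u * w) <= s * (s * C).
      apply: le_trans (ler_norm _) _; rewrite !normrM ts.
      apply: ler_wpM2l; first exact: ltW.
      by apply: ler_pM.
    move: st; rewrite mulrDr expr2; move: (sigma ps) (mu i ps) => x y.
    move=> h1 h2; lra.
  (* The moves by [s] and [- s] together bound [s * |mu i ps|] by [(d + 1) * C * s ^+ 2]. *)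
  have mups i : `|mu i ps| <= (d + 1) * C * s.
    have := muneg i s (gtr0_norm s0); have := muneg i (- s); rewrite normrN gtr0_norm//.
    move=> /(_ erefl); move: sigps; move: (sigma ps) (mu i ps) => x y h1 h2 h3.
    have h4 : s * y <= s * ((d + 1) * C * s) by move: h1 h2 h3; rewrite expr2; nra.
    have h5 : s * (- y) <= s * ((d + 1) * C * s) by move: h1 h2 h3; rewrite expr2; nra.
    rewrite ler_norml; apply/andP; split.
      by rewrite lerNl -(ler_pM2l s0).
    by rewrite -(ler_pM2l s0).
  (* [lam] has the same value at [p] and at [ps], so its bound at points tending to [x0] applies to
     the fixed [p]. *)
  rewrite (lam_gen_constant rr1 bps gps bp gp).
  apply: le_trans (hl ps bps (gen_off gps)) _.
  rewrite /Q -mulrA; apply: ler_wpM2l => //; rewrite mulrDl; apply: lerD.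
    apply: le_trans sigps _; apply: ler_wpM2l => //.
    by rewrite mulr_ge0//; lra.
  apply: le_trans (_ : \sum_(k < n.+1) (d + 1) * C * s <= _).
    by apply: ler_sum => i _; exact: mups.
  by rewrite sumr_const card_ord -[leLHS]mulr_natl -/d !mulrA.
apply/eqP; rewrite -normr_le0; apply/ler_addgt0Pl => e e0; rewrite addr0.
pose s := Num.min 1 (Num.min (r / 4) (e / (Q + 1))).
have s0 : 0 < s by rewrite !lt_min ltr01 !divr_gt0//; lra.
have sr : s <= r / 4 by rewrite !ge_min lexx !orbT.
have se : s <= e / (Q + 1) by rewrite !ge_min lexx !orbT.
apply: le_trans (small s s0 _ _) _.
- by rewrite ge_min lexx.
- by lra.
have : s * (Q + 1) <= e by rewrite -ler_pdivlMr//; lra.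
nra.
Qed.

End ScaleExtension.

(** * Geodesics with Lipschitz Christoffel symbols *)

Section Picard.
Context {R : realType}.
Local Notation mu := (@lebesgue_measure R).

Lemma continuous_antiderivative (h : R -> R) : continuous h ->
  exists H : R -> R, H 0 = 0 /\ forall t : R, `|t| < 2 -> is_derive t (1 : R) H (h t).
Proof.
move=> ch.
(* The integral starts at -2 to have 0 in the interior of the interval; the later time interval has
   [d < 1], well inside radius 2. *)
pose F x := (\int[mu]_(t in [set` `[-2, x]]) (h t))%R.
exists (fun x => F x - F 0); split; first by rewrite subrr.
move=> t; rewrite ltr_norml => /andP[t1 t2].
have ih : mu.-integrable `[-2, 2] (EFin \o h).
  apply: continuous_compact_integrable; first exact: segment_compact.
  exact: continuous_subspaceT.
have [dF F'] := continuous_FTC1_closed t2 ih t1 (ch t).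
have : is_derive t 1 F (h t) by apply: DeriveDef; [exact: dF|rewrite -F' derive1E].
move=> dFt.
have := is_deriveB dFt (is_derive_cst (F 0) t 1).
by rewrite subr0.
Qed.

(** The intervals of radius [2 * m / 2 ^+ k] around [x k] intersect pairwise, and the supremum of
    their lower ends lies in all of them. This gives the limit together with its explicit rate. *)
Lemma geometric_limit (x : nat -> R) (m : R) :
  (forall k, `|x k.+1 - x k| <= m / 2 ^+ k) ->
  exists l, forall k, `|l - x k| <= 2 * m / 2 ^+ k.
Proof.
move=> hx.
have m0 : 0 <= m by have := le_trans (normr_ge0 _) (hx 0%N); rewrite expr0 divr1.
have cauchy k j : `|x (j + k)%N - x k| <= 2 * m / 2 ^+ k - 2 * m / 2 ^+ (j + k).
  elim: j => [|j IH]; first by rewrite add0n !subrr normr0.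
  rewrite addSn -(subrKA (x (j + k)%N)) addrC; apply: le_trans (ler_normD _ _) _.
  have h := hx (j + k)%N.
  have e : 2 * m / 2 ^+ (j + k).+1 = m / 2 ^+ (j + k).
    by rewrite exprS invfM; field.
  have e2 : 2 * m / 2 ^+ (j + k) = m / 2 ^+ (j + k) + m / 2 ^+ (j + k) by ring.
  rewrite e; move: IH h; rewrite e2.
  rewrite addrC; move: (`|x (j + k)%N - x k|) (`|_ - x (j + k)%N|) (m / _) (2 * m / _) => p q r s; lra.
have pos k : 0 <= 2 * m / 2 ^+ k by rewrite divr_ge0// ?mulr_ge0// exprn_ge0.
have LU k j : x j - 2 * m / 2 ^+ j <= x k + 2 * m / 2 ^+ k.
  have [kj|/ltnW jk] := leqP k j.
    have := cauchy k (j - k)%N; rewrite subnK//; have := pos j; have := pos k.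
    by rewrite ler_norml => p q /andP[? ?]; lra.
  have := cauchy j (k - j)%N; rewrite subnK//; have := pos j; have := pos k.
  by rewrite ler_norml => p q /andP[? ?]; lra.
pose S : set R := [set x j - 2 * m / 2 ^+ j | j in setT].
exists (sup S) => k; rewrite ler_distl; apply/andP; split.
  apply: ub_le_sup; last by exists k.
  by exists (x k + 2 * m / 2 ^+ k) => _ [j _ <-]; exact: LU.
apply: sup_le_ub; first by exists (x 0%N - 2 * m / 2 ^+ 0), 0%N.
by move=> _ [j _ <-]; exact: LU.
Qed.

Lemma geometric_small (m e : R) : 0 < e -> exists k, m / 2 ^+ k < e.
Proof.
move=> e0; have [k hk] : exists k : nat, m / e < k%:R.
  exists (Num.truncn (m / e)).+1; exact: truncnS_gt.
exists k; rewrite ltr_pdivrMr ?exprn_gt0// mulrC -ltr_pdivrMr//.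
apply: lt_le_trans hk _; rewrite -natrX ler_nat; exact: ltnW (ltn_expl _ _).
Qed.

(** The 1-Lipschitz retraction onto a segment. Composed with it, a local vector field becomes
    globally Lipschitz, so the iteration needs no control of exit times. *)
Definition clamp (c r x : R) : R := Num.max (c - r) (Num.min x (c + r)).

Lemma clamp_id c r x : `|x - c| <= r -> clamp c r x = x.
Proof.
rewrite ler_norml => /andP[h1 h2]; rewrite /clamp.
by rewrite min_l ?max_r//; lra.
Qed.

Lemma clamp_bound c r x : 0 <= r -> `|clamp c r x - c| <= r.
Proof.
move=> r0; rewrite /clamp ler_norml; case: (leP x (c + r)) => h.
  by case: (leP (c - r) x) => h'; apply/andP; lra.
by case: (leP (c - r) (c + r)) => h'; apply/andP; lra.
Qed.

Lemma clamp_lip c r x y : `|clamp c r x - clamp c r y| <= `|x - y|.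
Proof.
rewrite /clamp; case: (leP x (c + r)) => h1; case: (leP y (c + r)) => h2;
  case: (leP (c - r) x) => h3; case: (leP (c - r) y) => h4;
  case: (leP (c - r) (c + r)) => h5; rewrite ?subrr ?normr0//;
  rewrite ler_norml; case: (ger0P (x - y)) => h6; apply/andP; lra.
Qed.

Lemma continuous_lipschitz (f : R -> R) (g : R -> R) :
  (forall x y, `|f x - f y| <= `|g x - g y|) -> continuous g -> continuous f.
Proof.
move=> fg cg t; apply/(@cvgrPdist_lt _ R^o) => e e0.
have := cg t => /(@cvgrPdist_lt _ R^o)/(_ e e0).
by apply: filterS => x; apply: le_lt_trans.
Qed.

Lemma clamp_continuous c r : continuous (clamp c r).
Proof. apply: (continuous_lipschitz (g := id)); [exact: clamp_lip|by move=> x; exact: cvg_id]. Qed.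

Lemma derive_bound (g dg : R -> R) (m t : R) : g 0 = 0 ->
  (forall s : R, `|s| <= `|t| -> is_derive s (1 : R) g (dg s)) ->
  (forall s, `|s| <= `|t| -> `|dg s| <= m) -> `|g t| <= m * `|t|.
Proof.
move=> g0 dgs hm.
have cg s : `|s| <= `|t| -> {for s, continuous g}.
  by move=> /dgs [/derivable1_diffP dp _]; exact: differentiable_continuous.
have : exists2 s, `|s| <= `|t| & `|g t| = `|dg s| * `|t|.
  have [t0|t0] := leP 0 t.
    have t2 s : s \in `[0, t] -> `|s| <= `|t|.
      by rewrite in_itv /= => /andP[s0 s1]; rewrite !ger0_norm.
    have [||s st e] := @MVT_segment R g dg 0 t t0.
    - move=> s sI; apply: dgs; apply: t2; move: sI; rewrite !in_itv /= => /andP[? ?].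
      by rewrite !ltW.
    - by apply: continuous_in_subspaceT => s /[1!inE] st; exact: cg (t2 s st).
    by exists s; [exact: t2|rewrite -normrM; move: e; rewrite g0 !subr0 => ->].
  have t2 s : s \in `[t, 0] -> `|s| <= `|t|.
    by rewrite in_itv /= => /andP[s0 s1]; rewrite (ler0_norm s1) (ltr0_norm t0); lra.
  have [||s st e] := @MVT_segment R g dg t 0 (ltW t0).
  - move=> s sI; apply: dgs; apply: t2; move: sI; rewrite !in_itv /= => /andP[? ?].
    by rewrite !ltW.
  - by apply: continuous_in_subspaceT => s /[1!inE] st; exact: cg (t2 s st).
  by exists s; [exact: t2|rewrite -normrM; move: e; rewrite g0 !sub0r mulrN => /oppr_inj ->].
by move=> [s st ->]; apply: ler_wpM2r => //; exact: hm.
Qed.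

Variables (I : finType) (F : (I -> R) -> I -> R) (K : R) (z0 : I -> R).
Hypothesis K0 : 0 <= K.
Hypothesis lipF : forall u v i, `|F u i - F v i| <= K * \sum_j `|u j - v j|.

Let cont (z : R -> I -> R) := forall i, continuous (fun s => z s i).

Let F_cont z i : cont z -> continuous (fun s => F (z s) i).
Proof.
move=> cz t; apply/(@cvgrPdist_lt _ R^o) => e e0.
pose c : R := K * #|I|%:R + 1.
have c0 : 0 < c by rewrite /c ltr_pwDr// mulr_ge0.
have ec : 0 < e / c by rewrite divr_gt0.
have : \forall s \near t, forall j, `|z t j - z s j| < e / c.
  apply: (@filter_forall _ _ (fun j s => `|z t j - z s j| < e / c) (nbhs t)) => j.
  by have := cz j t => /(@cvgrPdist_lt _ R^o)/(_ _ ec).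
apply: filterS => s hs; apply: le_lt_trans (lipF _ _ _) _.
apply: le_lt_trans (_ : K * (#|I|%:R * (e / c)) < e).
  apply: ler_wpM2l => //; rewrite mulr_natl -sumr_const.
  by apply: ler_sum => j _; exact: ltW.
have -> : K * (#|I|%:R * (e / c)) = e * (K * #|I|%:R) / c by move: (c^-1) => w; ring.
by rewrite ltr_pdivrMr// ltr_pM2l// /c; lra.
Qed.

Theorem picard_lindelof : exists (d : R) (z : R -> I -> R),
  [/\ 0 < d, z 0 = z0 &
   forall t i, `|t| < d -> is_derive t (1 : R) (fun s => z s i) (F (z t) i)].
Proof.
(* A chosen antiderivative vanishing at 0; the value on discontinuous functions is a dummy, since
   only continuous ones occur. *)
pose AD (h : R -> R) : R -> R :=
  if pselect (continuous h) is left ch then sval (cid (continuous_antiderivative ch)) else h.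
have AD0 (h : R -> R) : continuous h -> AD h 0 = 0.
  by move=> ch; rewrite /AD; case: pselect => // ch'; case: cid => H [].
have ADd (h : R -> R) (t : R) : continuous h -> `|t| < 2 -> is_derive t (1 : R) (AD h) (h t).
  by move=> ch t2; rewrite /AD; case: pselect => // ch'; case: cid => H [? ] /=; exact.
clearbody AD.
pose c : R := K * #|I|%:R + 1.
have cn : 0 <= K * #|I|%:R by rewrite mulr_ge0.
have c0 : 0 < c by rewrite /c; lra.
(* Makes the Picard operator a contraction with factor 1/2 in the sum norm; the summand 1 in [c]
   keeps [d] below 1. *)
pose d : R := (2 * c)^-1.
have d0 : 0 < d by rewrite invr_gt0; lra.
have dc : c * d = 2^-1 by rewrite /d; field; rewrite lt0r_neq0.
have d1 : d < 1 by move: dc; rewrite /c; nra.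
have ADlip (h1 h2 : R -> R) (m t : R) : continuous h1 -> continuous h2 -> 0 <= m ->
    (forall s, `|h1 s - h2 s| <= m) -> `|t| <= d -> `|AD h1 t - AD h2 t| <= m * d.
  move=> c1 c2 m1 hm td.
  apply: le_trans (_ : m * `|t| <= _); last exact: ler_wpM2l.
  apply: (derive_bound (g := AD h1 - AD h2) (dg := fun s => h1 s - h2 s)) => //.
    by change (AD h1 0 - AD h2 0 = 0); rewrite !AD0// subrr.
  by move=> s st; apply: is_deriveB; apply: ADd => //; lra.
have ADbd (h : R -> R) (m t : R) : continuous h -> 0 <= m -> (forall s, `|h s| <= m) ->
    `|t| <= d -> `|AD h t| <= m * d.
  move=> ch m1 hm td; apply: le_trans (_ : m * `|t| <= _); last exact: ler_wpM2l.
  apply: (derive_bound (dg := h)) => //; first exact: AD0.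
  by move=> s st; apply: ADd => //; lra.
(* Freezing time outside the interval gives iterates that are continuous on the whole line, with
   estimates valid for all times. *)
pose cl := clamp 0 d.
have cld t : `|cl t| <= d by have := clamp_bound 0 t (ltW d0); rewrite subr0.
have cl2 t : `|cl t| < 2 by apply: le_lt_trans (cld t) _; lra.
pose T (z : R -> I -> R) : R -> I -> R :=
  fun t i => z0 i + AD (fun s => F (z s) i) (cl t).
have T_cont z : cont z -> cont (T z).
  move=> cz i t; have ch := @F_cont z i cz.
  have cA : {for cl t, continuous (AD (fun s => F (z s) i))}.
    have [/derivable1_diffP dp _] := ADd _ _ ch (cl2 t).
    exact: differentiable_continuous.
  apply: (@continuousD _ _ _ (fun=> z0 i) (fun t => AD (fun s => F (z s) i) (cl t))).
    exact: cst_continuous.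
  apply: (@continuous_comp _ _ _ cl (AD (fun s => F (z s) i))) => //.
  exact: clamp_continuous.
have T_lip z y m : cont z -> cont y -> 0 <= m ->
    (forall s, \sum_j `|z s j - y s j| <= m) ->
    forall t, \sum_j `|T z t j - T y t j| <= m / 2.
  move=> cz cy m0 hm t.
  apply: le_trans (_ : \sum_(j : I) K * m * d <= _).
    apply: ler_sum => j _; rewrite /T opprD addrACA subrr add0r.
    apply: ADlip => //; [exact: F_cont|exact: F_cont|by rewrite mulr_ge0|].
    by move=> s; apply: le_trans (lipF _ _ _) _; apply: ler_wpM2l.
  have e : K * m * d *+ #|I| = m * (c * d - d) by rewrite -mulr_natl /c; ring.
  rewrite sumr_const [leLHS](_ : _ = m * (c * d - d)); last exact: e.
  by rewrite dc; apply: ler_wpM2l => //; lra.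
pose zn := fix zn k := if k is k'.+1 then T (zn k') else fun _ => z0.
have zn_cont k : cont (zn k).
  elim: k => [|k IH]; last exact: T_cont.
  by move=> i t; exact: cst_continuous.
pose m0 := \sum_i `|F z0 i|.
have m00 : 0 <= m0 by exact: sumr_ge0.
have step k t : \sum_i `|zn k.+1 t i - zn k t i| <= m0 / 2 ^+ k.
  elim: k t => [|k IH] t.
    rewrite expr0 divr1; apply: ler_sum => i _ /=.
    rewrite /T addrC addKr.
    have cz : continuous (fun _ : R => F z0 i) by move=> u; exact: cst_continuous.
    apply: le_trans (ADbd _ _ _ cz (normr_ge0 _) (fun=> lexx _) (cld t)) _.
    by rewrite ler_piMr// ltW.
  have := T_lip (zn k.+1) (zn k) _ (zn_cont k.+1) (zn_cont k) _ IH t.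
  rewrite exprSr invfM mulrA; apply.
  by rewrite divr_ge0// exprn_ge0.
have lim t i : exists l, forall k, `|l - zn k t i| <= 2 * m0 / 2 ^+ k.
  apply: (geometric_limit (x := fun k => zn k t i)) => k.
  apply: le_trans (step k t).
  by rewrite (bigD1 i)//= lerDl; exact: sumr_ge0.
pose z t i := sval (cid (lim t i)).
have zP t i k : `|z t i - zn k t i| <= 2 * m0 / 2 ^+ k := svalP (cid (lim t i)) k.
clearbody z.
have z_cont : cont z.
  move=> i t; apply/(@cvgrPdist_lt _ R^o) => e e0.
  have e3 : 0 < e / 3 by lra.
  have [k hk] := geometric_small (2 * m0) e3.
  have := zn_cont k i t => /(@cvgrPdist_lt _ R^o)/(_ _ e3).
  apply: filterS => s hs.
  have h1 := zP t i k; have h2 := zP s i k; rewrite distrC in h2.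
  have := ler_distD (zn k t i) (z t i) (z s i).
  have := ler_distD (zn k s i) (zn k t i) (z s i).
  move: h1 h2 hs hk; move: (2 * m0 / 2 ^+ k) => w.
  move: (`|z t i - zn k t i|) (`|zn k s i - z s i|) (`|zn k t i - zn k s i|) => p q r.
  move: (`|zn k t i - z s i|) (`|z t i - z s i|) => u v; lra.
have zT t i : z t i = T z t i.
  apply/eqP; rewrite -subr_eq0 -normr_le0; apply/ler_addgt0Pl => e e0; rewrite addr0.
  have [k hk] := geometric_small (#|I|%:R * (2 * m0) + 2 * m0) e0.
  have pw : 0 < 2 ^+ k :> R by rewrite exprn_gt0.
  have hz s : \sum_j `|zn k s j - z s j| <= #|I|%:R * (2 * m0) / 2 ^+ k.
    rewrite -mulrA mulr_natl -sumr_const; apply: ler_sum => j _.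
    by rewrite distrC; exact: zP.
  have h0 : 0 <= #|I|%:R * (2 * m0) / 2 ^+ k.
    by rewrite divr_ge0// ?mulr_ge0// ltW.
  have h1 := T_lip (zn k) z _ (zn_cont k) z_cont h0 hz t.
  have h2 : `|T (zn k) t i - T z t i| <= #|I|%:R * (2 * m0) / 2 ^+ k / 2.
    by apply: le_trans h1; rewrite (bigD1 i)//= lerDl; exact: sumr_ge0.
  have h3 := zP t i k.+1.
  have h4 : 2 * m0 / 2 ^+ k.+1 <= 2 * m0 / 2 ^+ k.
    rewrite ler_wpM2l ?mulr_ge0// exprS invfM.
    by rewrite ler_piMl ?invf_le1// ?invr_ge0 ?ltW// ltr1n.
  have := ler_distD (T (zn k) t i) (z t i) (T z t i).
  have {}h3 : `|z t i - T (zn k) t i| <= 2 * m0 / 2 ^+ k.+1 by exact: h3.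
  have {}hk : #|I|%:R * (2 * m0) / 2 ^+ k + 2 * m0 / 2 ^+ k < e by rewrite -mulrDl.
  move: h2 h3 h4 hk; move: (#|I|%:R * (2 * m0) / 2 ^+ k) h0 => w w0.
  move: (2 * m0 / 2 ^+ k) (2 * m0 / 2 ^+ k.+1) => w1 w2.
  move: (`|T (zn k) t i - T z t i|) (`|z t i - T (zn k) t i|) (`|z t i - T z t i|) => p q r; lra.
exists d, z; split=> //.
  apply/funext => i; rewrite zT /T /cl clamp_id ?subrr ?normr0 ?ltW//.
  by rewrite AD0 ?addr0//; exact: F_cont.
move=> t i td.
have t2 : `|t| < 2 by lra.
have hd := ADd _ t (@F_cont z i z_cont) t2.
have hs := is_deriveD (is_derive_cst (z0 i) t (1 : R)) hd.
rewrite add0r in hs.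
apply: near_eq_is_derive hs.
have : \forall s \near t, `|s| < d.
  have ct : {for t, continuous (fun s : R => `|s|)} by exact: norm_continuous.
  exact: (@cvgr_lt R _ (nbhs t) _ (fun s : R => `|s|) _ ct).
apply: filterS => s sd; rewrite [RHS]zT /T /cl clamp_id// subr0; exact: ltW.
Qed.

End Picard.

(** * The algebra of bounded Lipschitz functions *)

Section BoundedLipschitz.
Context {R : realType} {T : Type}.
Variable dd : T -> T -> R.
Hypothesis dd0 : forall u v, 0 <= dd u v.
Implicit Types (S : set T) (f g : T -> R).

(* Bounded and Lipschitz, with a common constant. *)
Definition blip S f := exists2 K : R, 0 <= K & forall u v, S u -> S v ->
  `|f u - f v| <= K * dd u v /\ `|f u| <= K.

Lemma blip_sub S S' f : S' `<=` S -> blip S f -> blip S' f.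
Proof. by move=> SS [K K0 h]; exists K => // u v /SS Su /SS; exact: h. Qed.

Lemma blip_ext S f g : (forall u, S u -> f u = g u) -> blip S f -> blip S g.
Proof. by move=> fg [K K0 h]; exists K => // u v Su Sv; rewrite -!fg//; exact: h. Qed.

Lemma blip_cst S (a : R) : blip S (fun=> a).
Proof. by exists `|a| => // u v _ _; rewrite subrr normr0 mulr_ge0. Qed.

Lemma blipD S f g : blip S f -> blip S g -> blip S (fun u => f u + g u).
Proof.
move=> [K K0 h] [L L0 k]; exists (K + L) => [|u v Su Sv]; first exact: addr_ge0.
have [h1 h2] := h u v Su Sv; have [k1 k2] := k u v Su Sv; split.
  rewrite opprD addrACA mulrDl; apply: le_trans (ler_normD _ _) _; exact: lerD.
by apply: le_trans (ler_normD _ _) _; exact: lerD.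
Qed.

Lemma blipM S f g : blip S f -> blip S g -> blip S (fun u => f u * g u).
Proof.
move=> [K K0 h] [L L0 k]; exists (2 * (K * L) + K * L) => [|u v Su Sv].
  by rewrite addr_ge0// ?mulr_ge0// mulr_ge0.
have [h1 h2] := h u v Su Sv; have [k1 k2] := k u v Su Sv.
have [_ h3] := h v u Sv Su; have [_ k3] := k v u Sv Su.
have KL : 0 <= K * L by exact: mulr_ge0.
split; last by rewrite normrM; apply: le_trans (ler_pM (normr_ge0 _) (normr_ge0 _) h2 k2) _; lra.
have -> : f u * g u - f v * g v = (f u - f v) * g u + f v * (g u - g v) by ring.
apply: le_trans (ler_normD _ _) _; rewrite !normrM.
have e1 : `|f u - f v| * `|g u| <= K * dd u v * L by exact: ler_pM.
have e2 : `|f v| * `|g u - g v| <= K * (L * dd u v) by exact: ler_pM.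
have := mulr_ge0 KL (dd0 u v); move: e1 e2; rewrite mulrDl -!mulrA [dd u v * L]mulrC.
move: (K * (L * dd u v)) => w; lra.
Qed.

Lemma blipN S f : blip S f -> blip S (fun u => - f u).
Proof.
by move=> [K K0 h]; exists K => // u v Su Sv; rewrite -opprD !normrN; exact: h.
Qed.

Lemma blipB S f g : blip S f -> blip S g -> blip S (fun u => f u - g u).
Proof. by move=> hf hg; apply: blipD => //; exact: blipN. Qed.

Lemma blip_sum S (I : Type) (r : seq I) (f : I -> T -> R) :
  (forall k : I, blip S (f k)) -> blip S (fun u => \sum_(k <- r) f k u).
Proof.
move=> hf; elim: r => [|k r IH].
  by apply: blip_ext (blip_cst S 0) => u _; rewrite big_nil.
by apply: blip_ext (blipD (hf k) IH) => u _; rewrite big_cons.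
Qed.

Lemma blipV S f (e : R) : 0 < e -> (forall u, S u -> e <= `|f u|) -> blip S f ->
  blip S (fun u => (f u)^-1).
Proof.
move=> e0 fe [K K0 h]; exists (K / e ^+ 2 + e^-1) => [|u v Su Sv].
  by rewrite addr_ge0// ?invr_ge0 ?divr_ge0// ltW// exprn_gt0.
have fu : f u != 0 by rewrite -normr_gt0; exact: lt_le_trans (fe u Su).
have fv : f v != 0 by rewrite -normr_gt0; exact: lt_le_trans (fe v Sv).
have ie w : S w -> `|(f w)^-1| <= e^-1.
  by move=> Sw; rewrite normfV lef_pV2 ?posrE ?fe//; exact: lt_le_trans (fe w Sw).
split.
  have -> : (f u)^-1 - (f v)^-1 = - ((f u - f v) * ((f u)^-1 * (f v)^-1)).
    by field; rewrite ?fu ?fv.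
  rewrite normrN normrM [X in _ * X]normrM.
  have h1 : `|(f u)^-1| * `|(f v)^-1| <= e^-1 * e^-1 by apply: ler_pM; rewrite ?ie.
  have h2 := (h u v Su Sv).1.
  apply: le_trans (ler_pM (normr_ge0 _) (mulr_ge0 (normr_ge0 _) (normr_ge0 _)) h2 h1) _.
  rewrite mulrDl expr2 invfM -!mulrA; have := dd0 u v.
  have ei : 0 <= e^-1 by rewrite invr_ge0 ltW.
  move=> duv; have := mulr_ge0 ei duv.
  have -> : K * (dd u v * (e^-1 * e^-1)) = K * (e^-1 * (e^-1 * dd u v)) by ring.
  lra.
apply: le_trans (ie u Su) _; rewrite lerDr divr_ge0// ltW// exprn_gt0//.
Qed.

Lemma blip_comp (T' : Type) (dd' : T' -> T' -> R) (S : set T) (S' : set T')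
    (p : T' -> T) f : (forall u, S' u -> S (p u)) ->
  (forall u v, dd (p u) (p v) <= dd' u v) -> blip S f ->
  exists2 K : R, 0 <= K & forall u v, S' u -> S' v ->
   `|f (p u) - f (p v)| <= K * dd' u v /\ `|f (p u)| <= K.
Proof.
move=> Sp dp [K K0 h]; exists K => // u v /Sp Su /Sp Sv.
have [h1 h2] := h _ _ Su Sv; split=> //.
by apply: le_trans h1 _; exact: ler_wpM2l.
Qed.

End BoundedLipschitz.

(** * Local existence of geodesics *)

Section LocalGeodesic.
Context {R : realType} {n : nat}.
Local Notation E := 'rV[R]_n.+1.
Local Notation M := 'M[R]_n.+1.
Local Notation ev i := (delta_mx 0 i : E).
Implicit Types (y p q z : E) (i j k l m : 'I_n.+1).

Lemma Cinf_blip (D : set E) (f : E -> R) x0 : open D -> D x0 -> Cinf D f ->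
  exists2 r, 0 < r & blip dist1 (box x0 r) f.
Proof.
move=> oD Dx Cf.
have [rD rD0 bD] := open_sub_box oD Dx.
pose e := \sum_i (`|partial i f x0| + 1).
have e0 : 0 <= e by apply: sumr_ge0 => i _; exact: addr_ge0.
have [r r0 hr] : exists2 r, 0 < r & forall i : 'I_n.+1, forall z, box x0 r z ->
    `|partial i f z| <= e.
  apply: (finite_box (P := fun i r => forall z, box x0 r z -> `|partial i f z| <= e)).
    by move=> i r s rs h z bz; apply: h; exact: sub_box bz.
  move=> i; have [r r0 h] := continuous_box (Cinf_cont (Cinf_partial i Cf) Dx) ltr01.
  exists r => // z /h hz; rewrite -[partial i f z](subrK (partial i f x0)).
  apply: le_trans (ler_normD _ _) _.
  apply: le_trans (_ : `|partial i f x0| + 1 <= _).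
    by rewrite addrC lerD2l; exact: ltW.
  by rewrite /e (bigD1 i)//= lerDl; apply: sumr_ge0 => j _; exact: addr_ge0.
have [s s0 hs] := continuous_box (Cinf_cont Cf Dx) ltr01.
pose t := Num.min rD (Num.min r s).
exists t; first by rewrite !lt_min rD0 r0.
have tD z : box x0 t z -> D z.
  by move=> bz; apply: bD; apply: sub_box bz; rewrite ge_min lexx.
exists (e + (1 + `|f x0|)); first by rewrite !addr_ge0.
move=> u v bu bv; split.
  have := box_increment (c := fun=> 0) (e := e)
    (fun i z bz => Cinf_derivable Cf (tD z bz)) _ bv bu.
  rewrite big1 ?subr0; last by move=> i _; rewrite mulr0.
  move=> h; apply: le_trans (h _) _.
    move=> i z bz; rewrite subr0; apply: hr; apply: sub_box bz.
    by rewrite !ge_min lexx !orbT.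
  rewrite -/(dist1 v u) dist1C; apply: ler_wpM2r; first exact: dist1_ge0.
  by rewrite lerDl addr_ge0.
have := hs u (sub_box _ bu); rewrite !ge_min lexx !orbT => /(_ isT) h.
rewrite -[f u](subrK (f x0)); apply: le_trans (ler_normD _ _) _.
move: h e0; move: (`|f u - f x0|) (`|f x0|) => a b; lra.
Qed.

Lemma lipschitz_blip (f : E -> R) (C r : R) x0 : 0 <= C -> 0 < r ->
  (forall p q, `|f q - f p| <= C * dist1 p q) -> blip dist1 (box x0 r) f.
Proof.
move=> C0 r0 lf.
pose K := C + (C * (n.+1%:R * r) + `|f x0|).
have K1 : 0 <= C * (n.+1%:R * r) by rewrite mulr_ge0// mulr_ge0// ltW.
exists K; first by rewrite !addr_ge0.
move=> u v bu bv; split.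
  rewrite dist1C; apply: le_trans (lf _ _) _; apply: ler_wpM2r; first exact: dist1_ge0.
  by rewrite lerDl addr_ge0.
rewrite -[f u](subrK (f x0)); apply: le_trans (ler_normD _ _) _.
rewrite /K addrA lerD2r; apply: le_trans (lf _ _) _; rewrite ler_wpDl//.
apply: ler_wpM2l => //; apply: le_trans (_ : \sum_(i < n.+1) r <= _).
  by apply: ler_sum => i _; apply: ltW; exact: bu.
by rewrite sumr_const card_ord mulr_natl.
Qed.

(** The second-order equation becomes a first-order system on positions [inl] and velocities [inr].
    Both are clamped around their initial values, which makes the quadratic right side globally
    Lipschitz; for short time the solution stays within the clamps and solves the original
    equation. *)
Lemma geodesic_ode (Gt : 'I_n.+1 -> 'I_n.+1 -> 'I_n.+1 -> E -> R) x0 (r : R)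
    (v0 : 'I_n.+1 -> R) : 0 < r ->
  (forall k i j, blip dist1 (box x0 r) (Gt k i j)) ->
  exists (d : R) (c : R -> E) (v : R -> 'I_n.+1 -> R),
  [/\ 0 < d, c 0 = x0, v 0 = v0 &
   forall t k, `|t| < d ->
     [/\ is_derive t (1 : R) (fun s => c s 0 k) (v t k),
         is_derive t (1 : R) (fun s => v s k)
           (- \sum_i \sum_j Gt k i j (c t) * v t i * v t j),
         box x0 r (c t) & `|v t k - v0 k| <= 2^-1]].
Proof.
move=> r0 lG.
pose I := ('I_n.+1 + 'I_n.+1)%type.
pose dd (u w : I -> R) := \sum_j `|u j - w j|.
have dd0 u w : 0 <= dd u w by exact: sumr_ge0.
pose pr (u : I -> R) : E := \row_i clamp (x0 0 i) (r / 2) (u (inl i)).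
have r2 : 0 <= r / 2 by lra.
have prb u : box x0 r (pr u).
  move=> i; rewrite mxE; apply: le_lt_trans (clamp_bound _ _ r2) _; lra.
have ddl u w : dist1 (pr u) (pr w) <= dd u w.
  rewrite dist1C /dist1 /dd big_sumType /=.
  apply: le_trans (_ : \sum_i `|u (inl i) - w (inl i)| <= _).
    by apply: ler_sum => i _; rewrite !mxE; exact: clamp_lip.
  by rewrite lerDl; exact: sumr_ge0.
have bG k i j : blip dd setT (fun u => Gt k i j (pr u)).
  exact: (@blip_comp _ _ dist1 _ dd (box x0 r) setT pr).
pose vv (u : I -> R) k := clamp (v0 k) 2^-1 (u (inr k)).
have half : 0 <= 2^-1 :> R by rewrite invr_ge0.
have bv k : blip dd setT (fun u => vv u k).
  exists (1 + (2^-1 + `|v0 k|)); first by rewrite !addr_ge0.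
  move=> u w _ _; split.
    apply: le_trans (clamp_lip _ _ _ _) _.
    apply: le_trans (_ : dd u w <= _).
      by rewrite /dd (bigD1 (inr k))//= lerDl; exact: sumr_ge0.
    by rewrite ler_peMl// lerDl addr_ge0.
  rewrite -[vv u k](subrK (v0 k)); apply: le_trans (ler_normD _ _) _.
  have := clamp_bound (v0 k) (u (inr k)) half; rewrite -/(vv u k).
  by move: (`|vv u k - v0 k|) (`|v0 k|) => a b; lra.
pose F (u : I -> R) (o : I) : R := match o with
  | inl k => vv u k
  | inr k => - \sum_i \sum_j Gt k i j (pr u) * vv u i * vv u j end.
have bF o : blip dd setT (fun u => F u o).
  case: o => k /=; first exact: bv.
  apply: blipN; apply: (blip_sum dd0) => i; apply: (blip_sum dd0) => j.
  exact: (blipM dd0 (blipM dd0 (bG k i j) (bv i)) (bv j)).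
pose K := \sum_o s2val (cid2 (bF o)).
have K0 : 0 <= K by apply: sumr_ge0 => o _; exact: (s2valP (cid2 (bF o))).
have lF u w o : `|F u o - F w o| <= K * \sum_j `|u j - w j|.
  have [h _] := s2valP' (cid2 (bF o)) u w Logic.I Logic.I.
  apply: le_trans h _; apply: ler_wpM2r; first exact: dd0.
  rewrite /K (bigD1 o)//= lerDl; apply: sumr_ge0 => o' _.
  exact: (s2valP (cid2 (bF o'))).
have [d [z [d0 z0 dz]]] := picard_lindelof
  (fun o : I => match o with inl k => x0 0 k | inr k => v0 k end) K0 lF.
have zc (o : I) : {for 0, continuous (fun s => z s o)}.
  have n0 : `|0 : R| < d by rewrite normr0.
  have [/derivable1_diffP dp _] := dz 0 o n0.
  exact: differentiable_continuous.
have ex (o : I) (e : R) : 0 < e -> exists2 d', 0 < d' & forall s, `|s| < d' -> `|z s o - z 0 o| <= e.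
  move=> e0; have : \forall s \near (0 : R), `|z s o - z 0 o| < e.
    by apply: (@cvgr_distC_lt _ R^o _ _ _ (fun s => z s o) _ (zc o)).
  move=> /nbhs_ballP[d' /= d'0 h]; exists d' => // s sd; apply: ltW; apply: h.
  by rewrite /ball /= sub0r normrN.
(* The solution is kept within [r / 4], below the clamping radius [r / 2] for positions, and within
   1/2 for velocities, where [clamp] is the identity. *)
have [d1 d10 hd1] : exists2 d', 0 < d' & forall o : I, forall s, `|s| < d' ->
    `|z s o - z 0 o| <= (if o is inl _ then r / 4 else 2^-1).
  apply: (finite_box (P := fun o d' => forall s, `|s| < d' ->
    `|z s o - z 0 o| <= (if o is inl _ then r / 4 else 2^-1))).
    by move=> o u w uw h s su; apply: h; exact: lt_le_trans uw.
  by case=> k; apply: ex; rewrite ?invr_gt0//; lra.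
exists (Num.min d d1), (fun t => \row_k z t (inl k)), (fun t k => z t (inr k)).
split.
- by rewrite lt_min d0.
- by apply/rowP => k; rewrite mxE z0.
- by apply/funext => k; rewrite z0.
move=> t k; rewrite lt_min => /andP[td td1].
have hl i : `|z t (inl i) - x0 0 i| <= r / 4 by have := hd1 (inl i) t td1; rewrite z0.
have hr i : `|z t (inr i) - v0 i| <= 2^-1 by have := hd1 (inr i) t td1; rewrite z0.
have prE : pr (z t) = \row_k z t (inl k).
  by apply/rowP => i; rewrite !mxE clamp_id//; have := hl i; lra.
have vvE i : vv (z t) i = z t (inr i) by rewrite /vv clamp_id.
split=> //.
- have := dz t (inl k) td; rewrite /F vvE => h.
  by apply: near_eq_is_derive h; near=> s; rewrite mxE.
- have := dz t (inr k) td; rewrite /F prE.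
  by under eq_bigr do under eq_bigr do rewrite !vvE.
- by move=> i; rewrite mxE; have := hl i; lra.
Unshelve. all: by end_near. Qed.

End LocalGeodesic.

(** * Vanishing Einstein factor, or a geodesic issuing from the plane *)

Section LocalDichotomy.
Context {R : realType} {n : nat}.
Local Notation E := 'rV[R]_n.+1.
Local Notation M := 'M[R]_n.+1.
Local Notation delta i j := ((i == j)%:R : R).
Implicit Types (y p q z : E) (i j k l m : 'I_n.+1).
Variables (D V : set E) (G Gp : E -> M) (sigma lam : E -> R) (x0 : E).
Variables (a b : 'I_n.+1) (r1 : R).
Hypothesis dim2 : (2 < n.+1)%N.
Hypothesis oD : open D.
Hypothesis oV : open V.
Hypothesis VD : V `<=` D.
Hypothesis Dx0 : D x0.
Hypothesis CG : mCinf D G.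
Hypothesis symG : forall y, D y -> (G y)^T = G y.
Hypothesis unitG : forall y, D y -> G y \in unitmx.
Hypothesis CGp : mCinf V Gp.
Hypothesis Csigma : Cinf V sigma.
Hypothesis sigma_gt0 : forall y, V y -> 0 < sigma y.
Hypothesis GpE : forall y, V y -> Gp y = (sigma y)^-2 *: G y.
Hypothesis einGp : forall y, V y -> ricci Gp y = lam y *: Gp y.
Hypothesis ab : a != b.
Hypothesis r10 : 0 < r1.
Hypothesis offV : forall y, box x0 r1 y -> off x0 a b y -> V y.

Let sigma0 y : V y -> sigma y != 0.
Proof. by move=> /sigma_gt0 /lt0r_neq0. Qed.

(** The formula is [christoffel_conf] with [dlog] replaced by [- m / s], for Lipschitz [m] and [s]
    that are to be the extensions of [mu] and [sigma]. Since [s x0] is not 0, division is harmless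
    near [x0]. *)
Lemma extended_christoffel_blip (s : E -> R) (m : 'I_n.+1 -> E -> R) (C : R) :
  0 <= C -> s x0 != 0 ->
  (forall p q, `|s q - s p| <= C * dist1 p q) ->
  (forall k p q, `|m k q - m k p| <= C * dist1 p q) ->
  exists2 r, 0 < r & forall k i j, blip dist1 (box x0 r) (fun y =>
    christoffel G k i j y + (delta k i * (- (m j y / s y)) + delta k j * (- (m i y / s y))
      - G y i j * \sum_l invmx (G y) k l * (- (m l y / s y)))).
Proof.
move=> C0 s0 ls lm.
have dd0 := @dist1_ge0 R n.
have sp : 0 < `|s x0| / 2 by rewrite divr_gt0// normr_gt0.
(* One finite family of conditions, for which a common radius exists; [None] carries the lower bound
   on [s]. *)
pose P (o : option (('I_n.+1 * 'I_n.+1) * 'I_n.+1)) (r : R) := match o with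
  | None => forall y, box x0 r y -> `|s x0| / 2 <= `|s y|
  | Some (k, i, j) => [/\ blip dist1 (box x0 r) (christoffel G k i j),
      blip dist1 (box x0 r) (fun y => G y i j) &
      blip dist1 (box x0 r) (fun y => invmx (G y) i j)] end.
have [r r0 Pr] : exists2 r, 0 < r & forall o, P o r.
  apply: finite_box.
    move=> [[[k i] j]|] u w uw /=.
      by case=> h1 h2 h3; split; apply: (blip_sub (sub_box uw)).
    by move=> h y by_; apply: h; exact: sub_box by_.
  move=> [[[k i] j]|] /=; last first.
    pose r := `|s x0| / 2 / (C * n.+1%:R + 1).
    have c0 : 0 < C * n.+1%:R + 1 by rewrite ltr_wpDl// mulr_ge0.
    have rp : 0 < r by rewrite divr_gt0.
    exists r => // y by_.
    have h1 := ls x0 y.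
    have h2 : dist1 x0 y <= n.+1%:R * r.
      rewrite mulr_natl -[n.+1 in leRHS]card_ord -sumr_const.
      by apply: ler_sum => l _; apply: ltW; exact: by_.
    have h3 : C * dist1 x0 y <= `|s x0| / 2.
      apply: le_trans (ler_wpM2l C0 h2) _; rewrite mulrA.
      have e : (C * n.+1%:R + 1) * r = `|s x0| / 2 by rewrite /r mulrC divfK ?lt0r_neq0.
      by rewrite -e mulrDl mul1r lerDl ltW.
    have := ler_normD (s x0 - s y) (s y); rewrite subrK distrC.
    move: h1 h3; move: (C * dist1 x0 y) (`|s y - s x0|) (`|s x0|) (`|s y|) => u v w x; lra.
  have [u u0 hu] := Cinf_blip oD Dx0 (christoffel_Cinf oD CG unitG k i j).
  have [v v0 hv] := Cinf_blip oD Dx0 (CG i j).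
  have [w w0 hw] := Cinf_blip oD Dx0 (inv_metric_Cinf oD CG unitG i j).
  exists (Num.min u (Num.min v w)); first by rewrite !lt_min u0 v0.
  split.
  - by apply: blip_sub hu; apply: sub_box; rewrite ge_min lexx.
  - by apply: blip_sub hv; apply: sub_box; rewrite !ge_min lexx orbT.
  - by apply: blip_sub hw; apply: sub_box; rewrite !ge_min lexx !orbT.
exists r => // k i j.
have bs : blip dist1 (box x0 r) (fun y => (s y)^-1).
  have h1 : blip dist1 (box x0 r) s :=  (lipschitz_blip x0 C0 r0 ls).
  have h2 : forall u, box x0 r u -> `|s x0| / 2 <= `|s u| by exact: (Pr None).
  exact: (blipV dd0 sp h2 h1).
have bu l : blip dist1 (box x0 r) (fun y => - (m l y / s y)).
  have h1 : blip dist1 (box x0 r) (m l) :=  (lipschitz_blip x0 C0 r0 (lm l)).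
  by apply: blipN; exact: (blipM dd0 h1 bs).
have bd u v (f : E -> R) : blip dist1 (box x0 r) f ->
    blip dist1 (box x0 r) (fun y => delta u v * f y).
  by apply: (blipM dd0); exact: blip_cst.
apply: blipD.
  by have [] := Pr (Some (k, i, j)).
apply: blipB; first by apply: blipD; exact: bd.
apply: (blipM dd0); first by have [] := Pr (Some (k, i, j)).
apply: (blip_sum dd0) => l; apply: (blipM dd0) => //.
by have [] := Pr (Some (k, k, l)).
Qed.

(** The alternative is whether the extended [sigma] vanishes at [x0]. If not, the extended
    Christoffel symbols agree on [gen] with those of [Gp], so the solution from [x0] is a geodesic
    of [Gp] as long as it runs in [gen]. *)
Theorem local_dichotomy :
  (exists2 r, 0 < r <= r1 & forall p, box x0 r p -> gen x0 a b p -> lam p = 0) \/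
  (exists (d : R) (c : R -> E) (v : R -> 'I_n.+1 -> R),
    [/\ 0 < d, c 0 = x0,
     forall t k, `|t| < d -> is_derive t (1 : R) (fun s => c s 0 k) (v t k) &
     forall t, 0 < t < d -> V (c t) /\
       forall k, is_derive t (1 : R) (fun s => v s k)
           (- \sum_i \sum_j christoffel Gp k i j (c t) * v t i * v t j)]).
Proof.
have [r [C [ext [[r0 rr1 C0] extL extE extv]]]] := scale_extension dim2 oD oV VD Dx0
  CG symG unitG CGp Csigma sigma_gt0 GpE einGp ab r10 offV.
have [e0|e0] := eqVneq (ext (Some None) x0) 0.
  by left; exists r; [rewrite r0|exact: extv].
right.
pose s := ext (Some None); pose m k := ext (Some (Some k)).
have [r2 r20 hb] := extended_christoffel_blip (s := s) (m := m) C0 e0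
  (extL (Some None)) (fun k => extL (Some (Some k))).
pose Gt k i j y := christoffel G k i j y + (delta k i * (- (m j y / s y))
  + delta k j * (- (m i y / s y))
  - G y i j * \sum_l invmx (G y) k l * (- (m l y / s y))).
pose r3 := Num.min r r2.
have r30 : 0 < r3 by rewrite lt_min r0.
have bGt k i j : blip dist1 (box x0 r3) (Gt k i j).
  by apply: blip_sub (hb k i j); apply: sub_box; rewrite ge_min lexx orbT.
(* As velocities stay within 1/2 of their initial values, the coordinates [a] and [b] both grow at
   rate at least 1/2, so the curve lies in [gen] for all positive times. *)
pose v0 k : R := (delta k a + delta k b).
have [d [c [v [d0 c0 vv0 hcv]]]] := geodesic_ode v0 r30 bGt.
have cE t k : (k == a) || (k == b) -> 0 < t -> t < d -> x0 0 k < c t 0 k.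
  move=> kab t0 td.
  have vk : v0 k = 1.
    rewrite /v0; case/orP: kab => /eqP ->; rewrite eqxx.
      by rewrite (negbTE ab) addr0.
    by rewrite eq_sym (negbTE ab) add0r.
  have := @derive_bound R ((fun s => c s 0 k) - (fun s => s + x0 0 k))
    (fun s => v s k - 1) (2^-1) t.
  have g0 : ((fun s => c s 0 k) - (fun s => s + x0 0 k)) 0 = 0.
    by change (c 0 0 k - (0 + x0 0 k) = 0); rewrite c0 add0r subrr.
  have inb u : `|u| <= `|t| -> `|u| < d by rewrite (gtr0_norm t0); lra.
  move=> /(_ g0) h.
  have {h} : `|c t 0 k - (t + x0 0 k)| <= 2^-1 * `|t|.
    apply: h => u /inb ud.
      apply: is_deriveB; first by have [] := hcv u k ud.
      have := is_deriveD (is_derive_id u (1 : R)) (is_derive_cst (x0 0 k) u (1 : R)).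
      by rewrite addr0.
    by have [_ _ _] := hcv u k ud; rewrite vk.
  rewrite (gtr0_norm t0) ler_norml => /andP[h1 h2].
  by move: h1 h2 t0; move: (c t 0 k) (x0 0 k) => p q; lra.
exists d, c, v; split=> //.
  by move=> t k td; have [] := hcv t k td.
move=> t /andP[t0 td].
have td' : `|t| < d by rewrite gtr0_norm.
have bc : box x0 r3 (c t) by have [_ _ h _] := hcv t a td'.
have bcr : box x0 r (c t) by apply: sub_box bc; rewrite ge_min lexx.
have gc : gen x0 a b (c t).
  by rewrite /gen !gt_eqF// cE// eqxx ?orbT.
have Vc : V (c t) by apply: offV; [exact: sub_box bcr|exact: gen_off].
split=> // k; have [_ h _ _] := hcv t k td'.
suff e i j : Gt k i j (c t) = christoffel Gp k i j (c t).
  by under eq_bigr do under eq_bigr do rewrite -e.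
have CGV : mCinf V G by move=> i' j' k'; exact: (Ck_sub VD (CG i' j' k')).
have symGV y : V y -> (G y)^T = G y by move=> /VD; exact: symG.
have unitGV y : V y -> G y \in unitmx by move=> /VD; exact: unitG.
rewrite (christoffel_conf oV symGV unitGV CGp Csigma sigma0 GpE k i j Vc).
rewrite /Gt /s /m !extE//=.
congr (_ + (_ - _ * _)); apply: eq_bigr => l _.
by rewrite extE.
Qed.

End LocalDichotomy.

(** * Invariance of the geodesic equation *)

Section RealDerivatives.
Context {R : realType}.
Implicit Types (f g : R -> R) (t : R).

Lemma is_derive_sumR m (f : 'I_m -> R -> R) (df : 'I_m -> R) t :
  (forall i, is_derive t (1 : R) (f i) (df i)) ->
  is_derive t (1 : R) (fun s => \sum_i f i s) (\sum_i df i).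
Proof.
move=> h; have -> : (fun s => \sum_i f i s) = \sum_(i < m) f i.
  by apply/funext => s; rewrite fct_sumE.
exact: is_derive_sum.
Qed.

Lemma is_derive_mulR f g (df dg : R) t : is_derive t (1 : R) f df ->
  is_derive t (1 : R) g dg ->
  is_derive t (1 : R) (fun s => f s * g s) (df * g t + f t * dg).
Proof.
move=> hf hg; have := is_deriveM hf hg.
by rewrite addrC [g t *: _]mulrC.
Qed.

Lemma is_derive_unique f (a b : R) t : is_derive t (1 : R) f a ->
  is_derive t (1 : R) f b -> a = b.
Proof. by move=> [_ <-] [_ <-]. Qed.

End RealDerivatives.

Section EulerLagrange.
Context {R : realType} {n : nat}.
Local Notation E := 'rV[R]_n.+1.
Local Notation M := 'M[R]_n.+1.
Implicit Types (y : E) (i j k l m : 'I_n.+1).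

Lemma lower_inj (A : M) (x : 'I_n.+1 -> R) : A \in unitmx ->
  (forall m, \sum_l A m l * x l = 0) -> forall k, x k = 0.
Proof.
move=> uA h k; pose b : 'cV[R]_n.+1 := \col_l x l.
have : A *m b = 0.
  by apply/colP => m; rewrite !mxE -[RHS](h m); apply: eq_bigr => l _; rewrite mxE.
move/(congr1 (mulmx (invmx A))); rewrite mulmxA mulVmx// mul1mx mulmx0.
by move/colP/(_ k); rewrite !mxE.
Qed.

Lemma contract_swap (u : 'I_n.+1 -> R) (D : 'I_n.+1 -> 'I_n.+1 -> 'I_n.+1 -> R)
    (w : 'I_n.+1 -> R) :
  \sum_i u i * (2^-1 * \sum_k \sum_l D i k l * w k * w l) =
  2^-1 * \sum_k w k * \sum_l (\sum_i u i * D i k l) * w l.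
Proof.
transitivity (\sum_i \sum_k \sum_l 2^-1 * (u i * D i k l * w k * w l)).
  apply: eq_bigr => i _; rewrite mulrCA !mulr_sumr; apply: eq_bigr => k _.
  by rewrite !mulr_sumr; apply: eq_bigr => l _; rewrite !mulrA.
rewrite exchange_big mulr_sumr /=; apply: eq_bigr => k _.
rewrite exchange_big /= !mulr_sumr; apply: eq_bigr => l _.
rewrite mulr_suml !mulr_sumr; apply: eq_bigr => i _; ring.
Qed.

Section Point.
Variables (V : set E) (G : E -> M).
Hypothesis oV : open V.
Hypothesis symG : forall y, V y -> (G y)^T = G y.
Hypothesis unitG : forall y, V y -> G y \in unitmx.

Lemma christoffel_lower_contract m y (v : 'I_n.+1 -> R) : V y ->
  \sum_l G y m l * (\sum_i \sum_j christoffel G l i j y * v i * v j) =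
  \sum_i \sum_j partial i (fun z => G z m j) y * v i * v j
  - 2^-1 * \sum_i \sum_j partial m (fun z => G z i j) y * v i * v j.
Proof.
move=> Vy.
transitivity (\sum_i \sum_j (\sum_l G y m l * christoffel G l i j y) * v i * v j).
  under eq_bigr do rewrite mulr_sumr; rewrite exchange_big; apply: eq_bigr => i _.
  under eq_bigr do rewrite mulr_sumr; rewrite exchange_big; apply: eq_bigr => j _.
  by rewrite !mulr_suml; apply: eq_bigr => l _; rewrite !mulrA.
pose A i j := partial i (fun z => G z m j) y * v i * v j.
pose B i j := partial m (fun z => G z i j) y * v i * v j.
transitivity (\sum_i \sum_j (2^-1 * A i j + 2^-1 * A j i - 2^-1 * B i j)).
  apply: eq_bigr => i _; apply: eq_bigr => j _.
  rewrite (christoffel_lower unitG m i j Vy) /A /B.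
  rewrite (partial_metric_entryC oV symG j m i Vy) (partial_metric_entryC oV symG i m j Vy).
  move: (partial i _ y) (partial j _ y) (partial m _ y) (v i) (v j) => a b c d e; ring.
under eq_bigr do rewrite sumrB big_split /= -!mulr_sumr.
rewrite sumrB big_split /= -!mulr_sumr [X in _ + _ * X - _]exchange_big /=.
pose S := \sum_i \sum_j A i j; pose T := \sum_i \sum_j B i j.
change (2^-1 * S + 2^-1 * S - 2^-1 * T = S - 2^-1 * T).
by move: S T => p q; lra.
Qed.

Lemma euler_lagrange y (v a : 'I_n.+1 -> R) : V y ->
  (forall k, a k = - \sum_i \sum_j christoffel G k i j y * v i * v j) <->
  (forall m, \sum_l ((\sum_i v i * partial i (fun z => G z m l) y) * v l + G y m l * a l)
     = 2^-1 * \sum_i \sum_j partial m (fun z => G z i j) y * v i * v j).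
Proof.
move=> Vy.
have e m : \sum_l (\sum_i v i * partial i (fun z => G z m l) y) * v l =
    \sum_i \sum_j partial i (fun z => G z m j) y * v i * v j.
  rewrite exchange_big /=; apply: eq_bigr => l _; rewrite mulr_suml.
  by apply: eq_bigr => i _; rewrite [v i * _]mulrC.
split=> [h m|h k].
  rewrite big_split /= e.
  have -> : \sum_l G y m l * a l =
      - \sum_l G y m l * (\sum_i \sum_j christoffel G l i j y * v i * v j).
    by rewrite -sumrN; apply: eq_bigr => l _; rewrite h mulrN.
  by rewrite christoffel_lower_contract// opprB addrC subrK.
have : forall k, a k + \sum_i \sum_j christoffel G k i j y * v i * v j = 0.
  apply: (lower_inj (unitG Vy)) => m.
  under eq_bigr do rewrite mulrDr; rewrite big_split /= christoffel_lower_contract//.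
  have := h m; rewrite big_split /= e => <-.
  by move: (\sum_i _) (\sum_l _) => p q; lra.
by move=> /(_ k) h'; apply/eqP; rewrite -subr_eq0 opprK h'.
Qed.

End Point.

Variables (V W : set E) (G H : E -> M) (F : E -> E).
Hypothesis oV : open V.
Hypothesis oW : open W.
Hypothesis CG : mCinf V G.
Hypothesis symG : forall y, V y -> (G y)^T = G y.
Hypothesis unitG : forall y, V y -> G y \in unitmx.
Hypothesis CH : mCinf W H.
Hypothesis symH : forall y, W y -> (H y)^T = H y.
Hypothesis unitH : forall y, W y -> H y \in unitmx.
Hypothesis CF : forall k, Cinf V (fun z => F z 0 k).
Hypothesis FW : forall y, V y -> W (F y).

Local Notation J i k := (partial i (fun z => F z 0 k)).

Hypothesis GH : forall y i j, V y ->
  G y i j = \sum_k \sum_l J i k y * H (F y) k l * J j l y.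

Let CJ i k : Cinf V (J i k). Proof. exact: Cinf_partial. Qed.

Let dH i j y : V y -> differentiable (fun z => H z i j) (F y).
Proof. by move=> Vy; exact: (Cinf_differentiable oW (CH i j) (FW Vy)). Qed.

Let partialHF m i j y : V y ->
  derivable (fun z => H (F z) i j) y (delta_mx 0 m) /\
  partial m (fun z => H (F z) i j) y = \sum_k J m k y * partial k (fun z => H z i j) (F y).
Proof.
move=> Vy; have := @chain_partial R n (fun z => H z i j) F m y (dH i j Vy).
by apply=> k; exact: (Cinf_derivable (CF k) Vy).
Qed.

Let jac y : M := \matrix_(i, k) J i k y.

Let unit_jac y : V y -> jac y \in unitmx.
Proof.
move=> Vy; have := unitG Vy.
have -> : G y = jac y *m (H (F y) *m (jac y)^T).
  apply/matrixP => i j; rewrite GH// mxE; apply: eq_bigr => k _.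
  rewrite !mxE mulr_sumr; apply: eq_bigr => l _; rewrite !mxE.
  by rewrite mulrA.
by rewrite unitmx_mul => /andP[].
Qed.

(** The defects of the two Euler-Lagrange equations are related by the Jacobian of [F], which is
    invertible because [G] is; so one vanishes with the other. *)
Lemma geodesic_transfer (c : R -> E) (v : R -> 'I_n.+1 -> R) (t : R) :
  V (c t) ->
  (\forall s \near t, V (c s) /\ forall i, is_derive s (1 : R) (fun u => c u 0 i) (v s i)) ->
  (forall k, is_derive t (1 : R) (fun s => v s k)
    (- \sum_i \sum_j christoffel G k i j (c t) * v t i * v t j)) ->
  (\forall s \near t, forall k, is_derive s (1 : R) (fun u => F (c u) 0 k)
     (\sum_i v s i * J i k (c s))) /\
  forall k, is_derive t (1 : R) (fun s => \sum_i v s i * J i k (c s))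
    (- \sum_i \sum_j christoffel H k i j (F (c t)) *
        (\sum_l v t l * J l i (c t)) * (\sum_l v t l * J l j (c t))).
Proof.
move=> Vt near_c dv.
have dc s : V (c s) -> (forall i, is_derive s (1 : R) (fun u => c u 0 i) (v s i)) ->
    forall f, Cinf V f -> is_derive s (1 : R) (fun u => f (c u)) (\sum_i v s i * partial i f (c s)).
  move=> Vs ds f Cf; apply: chain_curve ds.
  exact: (Cinf_differentiable oV Cf Vs).
split.
  apply: filterS near_c => s [Vs ds] k.
  exact: (dc s Vs ds _ (CF k)).
have [_ dct] := nbhs_singleton near_c.
pose w s k := \sum_i v s i * J i k (c s).
pose DJ m k := \sum_i v t i * partial i (J m k) (c t).
have dJt m k : is_derive t (1 : R) (fun s => J m k (c s)) (DJ m k) by exact: (dc t Vt dct _ (CJ m k)).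
pose a k := - \sum_i \sum_j christoffel G k i j (c t) * v t i * v t j.
pose b k := \sum_i (v t i * DJ i k + J i k (c t) * a i).
have dw k : is_derive t (1 : R) (fun s => w s k) (b k).
  apply: is_derive_sumR => i.
  have := is_derive_mulR (dv i) (dJt i k); rewrite addrC.
  by rewrite [a i * _]mulrC.
have dFt k : is_derive t (1 : R) (fun u => F (c u) 0 k) (w t k) by exact: (dc t Vt dct _ (CF k)).
have dHt k l : is_derive t (1 : R) (fun s => H (F (c s)) k l)
    (\sum_i w t i * partial i (fun z => H z k l) (F (c t))).
  exact: (chain_curve (c := fun u => F (c u)) (dH k l Vt) dFt).
pose DH k l := \sum_i w t i * partial i (fun z => H z k l) (F (c t)).
pose q s k := \sum_l H (F (c s)) k l * w s l.
pose q' k := \sum_l (DH k l * w t l + H (F (c t)) k l * b l).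
have dq k : is_derive t (1 : R) (fun s => q s k) (q' k).
  by apply: is_derive_sumR => l; exact: is_derive_mulR.
(* The momenta [G v] in the first chart are [J (H w)]. *)
have dp m : is_derive t (1 : R) (fun s => \sum_l G (c s) m l * v s l)
    (\sum_k (DJ m k * q t k + J m k (c t) * q' k)).
  have h : is_derive t (1 : R) (fun s => \sum_k J m k (c s) * q s k)
      (\sum_k (DJ m k * q t k + J m k (c t) * q' k)).
    by apply: is_derive_sumR => k; exact: is_derive_mulR.
  apply: near_eq_is_derive h.
  apply: filterS near_c => s [Vs _].
  transitivity (\sum_l \sum_k \sum_i J m k (c s) * H (F (c s)) k i * J l i (c s) * v s l).
    rewrite exchange_big /=; apply: eq_bigr => k _; rewrite /q mulr_sumr exchange_big /=.
    apply: eq_bigr => i _; rewrite /w !mulr_sumr; apply: eq_bigr => l _; ring.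
  apply: eq_bigr => l _; rewrite GH// mulr_suml; apply: eq_bigr => k _.
  by rewrite mulr_suml.
have dGt m l : is_derive t (1 : R) (fun s => G (c s) m l) (\sum_i v t i * partial i (fun z => G z m l) (c t)).
  exact: (dc t Vt dct _ (CG m l)).
have el1 m : \sum_k (DJ m k * q t k + J m k (c t) * q' k) =
    2^-1 * \sum_i \sum_j partial m (fun z => G z i j) (c t) * v t i * v t j.
  rewrite -((euler_lagrange oV symG unitG (v t) a Vt).1 (fun k => erefl) m).
  apply: (is_derive_unique (dp m)).
  by apply: is_derive_sumR => l; exact: is_derive_mulR.
(* The energy is differentiated in direction [m] with [v] fixed, once from each expression of the
   metric. The position enters through both [H] and the Jacobian, whence two kinds of terms. *)
have el2 m : \sum_i \sum_j partial m (fun z => G z i j) (c t) * v t i * v t j =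
    2 * (\sum_k DJ m k * q t k) + \sum_k w t k *
      \sum_l (\sum_i J m i (c t) * partial i (fun z => H z k l) (F (c t))) * w t l.
  pose ln (s : R) : E := s *: delta_mx 0 m + c t.
  have ln0 : ln 0 = c t by rewrite /ln scale0r add0r.
  have dl f : derivable f (c t) (delta_mx 0 m) ->
      is_derive (0 : R) (1 : R) (fun s => f (ln s)) (partial m f (c t)).
    have := @is_derive_line R n f (delta_mx 0 m) (c t) 0.
    by rewrite -/(ln 0) ln0.
  have dlC f : Cinf V f -> is_derive (0 : R) (1 : R) (fun s => f (ln s)) (partial m f (c t)).
    by move=> Cf; apply: dl; exact: (Cinf_derivable Cf Vt).
  pose om s k := \sum_i v t i * J i k (ln s).
  pose pi s k := \sum_l H (F (ln s)) k l * om s l.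
  have om0 k : om 0 k = w t k by rewrite /om ln0.
  have pi0 k : pi 0 k = q t k.
    by rewrite /pi /q; apply: eq_bigr => l _; rewrite om0 ln0.
  (* Symmetry of the second derivatives of [F]: varying the transformed velocity in direction [m]
     gives the derivative along the curve of row [m] of the Jacobian. *)
  have dom k : is_derive (0 : R) (1 : R) (fun s => om s k) (DJ m k).
    have -> : DJ m k = \sum_i (0 * J i k (ln 0) + v t i * partial m (J i k) (c t)).
      apply: eq_bigr => i _; rewrite mul0r add0r.
      exact: (congr1 (fun x => v t i * x) (Clairaut i m oV (CF k) Vt)).
    apply: is_derive_sumR => i.
    exact: (is_derive_mulR (is_derive_cst (v t i) (0 : R) (1 : R)) (dlC _ (CJ i k))).
  have dpi k : is_derive (0 : R) (1 : R) (fun s => pi s k)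
      (\sum_l ((\sum_i J m i (c t) * partial i (fun z => H z k l) (F (c t))) * om 0 l
        + H (F (ln 0)) k l * DJ m l)).
    apply: is_derive_sumR => l; apply: is_derive_mulR => //.
    have [h <-] := partialHF m k l Vt; exact: (dl _ h).
  apply: (@is_derive_unique R (fun s => \sum_i \sum_j G (ln s) i j * v t i * v t j) _ _ 0).
    apply: is_derive_sumR => i; apply: is_derive_sumR => j.
    have h := is_derive_mulR (is_derive_mulR (dlC _ (CG i j)) (is_derive_cst (v t i) (0 : R) (1 : R)))
      (is_derive_cst (v t j) (0 : R) (1 : R)).
    by rewrite /= !mulr0 !addr0 in h; exact: h.
  have h : is_derive (0 : R) (1 : R) (fun s => \sum_k om s k * pi s k) (\sum_k (DJ m k * pi 0 k + om 0 k *
     \sum_l ((\sum_i J m i (c t) * partial i (fun z => H z k l) (F (c t))) * om 0 l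
        + H (F (ln 0)) k l * DJ m l))).
    by apply: is_derive_sumR => k; apply: is_derive_mulR.
  have Vln : \forall s \near (0 : R), V (ln s).
    have cl : {for 0, continuous ln}.
      apply: (@continuousD _ _ _ (fun s : R => s *: (delta_mx 0 m : E)) (fun=> c t)).
        exact: scalel_continuous.
      exact: cst_continuous.
    by apply: cl; rewrite ln0; exact: open_nbhs_nbhs.
  have -> : 2 * (\sum_k DJ m k * q t k) + \sum_k w t k *
      \sum_l (\sum_i J m i (c t) * partial i (fun z => H z k l) (F (c t))) * w t l
    = \sum_k (DJ m k * pi 0 k + om 0 k *
     \sum_l ((\sum_i J m i (c t) * partial i (fun z => H z k l) (F (c t))) * om 0 l
        + H (F (ln 0)) k l * DJ m l)).
    under [RHS]eq_bigr do rewrite big_split mulrDr /= pi0 om0.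
    rewrite [RHS]big_split /= [X in _ = _ + X]big_split /= [RHS]addrCA [RHS]addrC.
    congr (_ + _); last first.
      by apply: eq_bigr => k _; congr (_ * _); apply: eq_bigr => l _; rewrite om0.
    rewrite mulr_natl mulr2n; congr (_ + _).
    transitivity (\sum_k \sum_l DJ m k * (H (F (c t)) k l * w t l)).
      by apply: eq_bigr => k _; rewrite /q mulr_sumr.
    rewrite exchange_big /=; apply: eq_bigr => k _; rewrite mulr_sumr.
    apply: eq_bigr => l _; rewrite ln0.
    by rewrite (metric_entryC symH l k (FW Vt)); ring.
  apply: near_eq_is_derive h.
  apply: filterS Vln => s Vs.
  transitivity (\sum_i \sum_j \sum_k \sum_l (J i k (ln s) * H (F (ln s)) k l * J j l (ln s)) * v t i * v t j).
    rewrite /om /pi; under eq_bigr do rewrite mulr_suml.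
    rewrite exchange_big /=; apply: eq_bigr => i _.
    rewrite [RHS]exchange_big /=; apply: eq_bigr => k _.
    rewrite [RHS]exchange_big /= mulr_sumr; apply: eq_bigr => l _.
    rewrite /om !mulr_sumr; apply: eq_bigr => j _.
    move: (J i k (ln s)) (H (F (ln s)) k l) (J j l (ln s)) => x y z; ring.
  apply: eq_bigr => i _; apply: eq_bigr => j _; rewrite GH// !mulr_suml.
  by apply: eq_bigr => k _; rewrite !mulr_suml.
(* The Euler-Lagrange defect for [H]. In [el1] and [el2] the terms with [DJ] cancel, which leaves
   that the Jacobian annihilates [x]. *)
pose x k := q' k - 2^-1 * (\sum_i \sum_j partial k (fun z => H z i j) (F (c t)) * w t i * w t j).
have key : forall k, x k = 0.
  apply: (lower_inj (unit_jac Vt)) => m; rewrite /x.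
  have := el1 m; rewrite el2 big_split /= mulrDr mulrA mulVf ?pnatr_eq0// mul1r.
  move/addrI => e1.
  transitivity (\sum_k J m k (c t) * q' k - 2^-1 * \sum_k w t k *
    \sum_l (\sum_i J m i (c t) * partial i (fun z => H z k l) (F (c t))) * w t l).
    under eq_bigr do rewrite mxE mulrBr.
    rewrite sumrB; congr (_ - _).
    exact: (contract_swap (fun i => J m i (c t))
      (fun i k l => partial i (fun z => H z k l) (F (c t))) (w t)).
  by rewrite e1 subrr.
have el3 : forall k, b k = - \sum_i \sum_j christoffel H k i j (F (c t)) * w t i * w t j.
  apply/(euler_lagrange oW symH unitH (w t) b (FW Vt)) => m.
  by move: (key m) => /eqP; rewrite subr_eq0 => /eqP.
by move=> k; have := dw k; rewrite el3.
Qed.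

End EulerLagrange.

(** * Charts and the boundary *)

Section Charts.
Local Notation coord := Defs.coord.
Context {R : realType} {n : nat} {M : topologicalType}.
Local Notation E := 'rV[R]_n.+1.
Local Notation ev i := (delta_mx 0 i : E).
Implicit Types (phi psi : chart R n M) (x : M) (y z u : E) (U W : set M).
Variable X : manifold R n M.

Lemma pnt_coord phi x : atlas X phi -> dom phi x -> pnt phi (coord phi x) = x.
Proof. by move=> /(atlas_chart (m := X)) [_ _ _ + _]; apply. Qed.

Lemma open_dom phi : atlas X phi -> open (dom phi).
Proof. by move=> /(atlas_chart (m := X)) []. Qed.

Lemma coord_half phi x : atlas X phi -> dom phi x -> 0 <= coord phi x 0 ord0.
Proof.
move=> /(atlas_chart (m := X)) [_ [B _ e] _ _ _].
move=> dx.
have : (coord phi @` dom phi) (coord phi x) by exists x.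
by rewrite e => -[].
Qed.

Lemma pnt_near phi x U : atlas X phi -> dom phi x -> open U -> U x ->
  exists2 r, 0 < r & forall y, box (coord phi x) r y ->
    (coord phi @` dom phi) y -> U (pnt phi y).
Proof.
move=> /(atlas_chart (m := X)) [_ _ _ pc cp] dx oU Ux.
have ix : (coord phi @` dom phi) (coord phi x) by exists x.
have /subspace_continuousP/(_ _ ix) h := cp.
have : nbhs (pnt phi (coord phi x)) U by rewrite pc//; exact: open_nbhs_nbhs.
move=> /h hh.
have /nbhs_boxP[r r0 hr] : nbhs (coord phi x) (fun y => (coord phi @` dom phi) y -> U (pnt phi y)).
  exact: hh.
by exists r.
Qed.

Lemma half_space_near phi x : atlas X phi -> dom phi x ->
  exists2 r, 0 < r & forall y, box (coord phi x) r y -> 0 <= y 0 ord0 ->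
    (coord phi @` dom phi) y.
Proof.
move=> /(atlas_chart (m := X)) [_ [B oB e] _ _ _] dx.
have : (coord phi @` dom phi) (coord phi x) by exists x.
rewrite e => -[_ Bx].
have [r r0 hr] := open_sub_box oB Bx.
by exists r => // y by_ y0; split=> //; exact: hr.
Qed.

Lemma coord_near phi x (A : set E) : atlas X phi -> dom phi x ->
  nbhs (coord phi x) A -> \forall z \near x, dom phi z /\ A (coord phi z).
Proof.
move=> aphi dx nA.
have [od _ cc _ _] := atlas_chart aphi.
have /subspace_continuousP/(_ _ dx) h := cc.
have h1 : \forall z \near x, dom phi z -> A (coord phi z) by exact: (h _ nA).
have h2 : \forall z \near x, dom phi z by exact: open_nbhs_nbhs.
by apply: filterS2 h1 h2 => z h1 h2; split=> //; exact: h1.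
Qed.

(** The two-sided derivative exists, so quotients from the right determine it. On the left, outside
    the half-space, the composed transition maps are uncontrolled. *)
Lemma right_derive_id (h : R -> R) (d e : R) : 0 < e ->
  (forall t, 0 <= t < e -> h t = t) -> is_derive (0 : R) (1 : R) h d -> d = 1.
Proof.
move=> e0 ht dh.
have h0 : h 0 = 0 by apply: ht; rewrite lexx.
have df : is_derive (0 : R) (1 : R) (fun s => h s - s) (d - 1).
  exact: (is_deriveB dh (is_derive_id (0 : R) (1 : R))).
apply/eqP; rewrite -subr_eq0 -normr_le0; apply/ler_addgt0Pl => eps eps0; rewrite addr0.
have [dd dv] := df.
have := dd; rewrite /derivable => /cvg_ex[l hl].
have ll : l = d - 1.
  by rewrite -dv /derive; apply/esym/cvg_lim.
move: hl => /(@cvgrPdist_lt _ R^o)/(_ _ eps0); rewrite near_withinE => /nbhs_ballP[r /= r0 hr].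
pose s := Num.min (e / 2) (r / 2).
have s0 : 0 < s by rewrite lt_min !divr_gt0.
have se : s < e by apply: le_lt_trans (_ : e / 2 < e); [rewrite ge_min lexx|lra].
have sr : s < r by apply: le_lt_trans (_ : r / 2 < r); [rewrite ge_min lexx orbT|lra].
have := hr s; rewrite /ball /= sub0r normrN gtr0_norm// => /(_ sr (lt0r_neq0 s0)).
rewrite addr0 [s *: 1]mulr1 (ht s) ?(ltW s0)//= h0 !subrr scaler0 subr0 ll.
exact: ltW.
Qed.

Lemma min_derive0 (f : E -> R) (r : R) y i : 0 < r ->
  derivable f y (ev i) -> (forall z, box y r z -> f y <= f z) -> partial i f y = 0.
Proof.
move=> r0 df mf.
have e0 : 0 *: ev i + y = y by rewrite scale0r add0r.
pose g (s : R) := f (s *: ev i + y).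
have dg : is_derive (0 : R) (1 : R) g (partial i f y).
  by have := @is_derive_line R n f (ev i) y 0; rewrite e0; apply.
pose d := partial i f y.
have small eps : 0 < eps -> exists2 s0, 0 < s0 & forall s,
    `|s| < s0 -> s != 0 -> `|d - s^-1 * (g s - g 0)| < eps.
  move=> eps0; have [dd dv] := dg.
  have := dd; rewrite /derivable => /cvg_ex[l hl].
  have ll : l = d by rewrite /d -dv /derive; apply/esym/cvg_lim.
  move: hl => /(@cvgrPdist_lt _ R^o)/(_ _ eps0); rewrite near_withinE => /nbhs_ballP[s0 /= s00 hs].
  exists s0 => // s ss sn; have := hs s; rewrite /ball /= sub0r normrN => /(_ ss sn).
  by rewrite addr0 [s *: 1]mulr1 ll.
have ming s : `|s| < r -> 0 <= g s - g 0.
  move=> sr; rewrite subr_ge0 /g e0; apply: mf => k; rewrite coord_shift addrK.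
  by rewrite normrM; case: (k == i); rewrite ?normr1 ?normr0 ?mulr1 ?mulr0.
apply/eqP; rewrite -/d; apply: contraT => dn.
have nd : 0 < `|d| by rewrite normr_gt0.
have [s0 s00 hs] := small `|d| (nd).
pose s := Num.min (s0 / 2) (r / 2).
have sp : 0 < s by rewrite lt_min !divr_gt0.
have ss0 : s < s0 by apply: le_lt_trans (_ : s0 / 2 < s0); [rewrite ge_min lexx|lra].
have sr : s < r by apply: le_lt_trans (_ : r / 2 < r); [rewrite ge_min lexx orbT|lra].
have h1 := hs s; rewrite gtr0_norm// in h1; have {}h1 := h1 ss0 (lt0r_neq0 sp).
have h2 := hs (- s); rewrite normrN gtr0_norm// oppr_eq0 in h2.
have {}h2 := h2 ss0 (lt0r_neq0 sp).
have m1 := ming s; rewrite gtr0_norm// in m1; have {}m1 := m1 sr.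
have m2 := ming (- s); rewrite normrN gtr0_norm// in m2; have {}m2 := m2 sr.
have si : 0 < s^-1 by rewrite invr_gt0.
have q1 : 0 <= s^-1 * (g s - g 0) by rewrite mulr_ge0// ltW.
have q2 : (- s)^-1 * (g (- s) - g 0) <= 0 by rewrite invrN mulNr oppr_le0 mulr_ge0// ltW.
move: h1 h2 q1 q2; move: (s^-1 * _) ((- s)^-1 * _) => p q.
have [d0|d0] := leP 0 d.
  rewrite (ger0_norm d0) !ltr_norml => /andP[? ?] /andP[? ?] ? ?; lra.
rewrite (ltr0_norm d0) !ltr_norml => /andP[? ?] /andP[? ?] ? ?; lra.
Qed.

(* If [x] is interior for [psi], the first coordinate of the transition from
   [psi] to [phi] has a minimum at [x], hence zero differential; but composed
   with the inverse transition it is the identity on the normal axis. *)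
Lemma boundary_coord phi psi x : atlas X phi -> atlas X psi ->
  dom phi x -> dom psi x -> coord phi x 0 ord0 = 0 -> coord psi x 0 ord0 = 0.
Proof.
move=> aphi apsi dphi dpsi b0; apply/eqP; apply: contraT => bn.
have b1 : 0 < coord psi x 0 ord0 by rewrite lt_neqAle eq_sym bn coord_half.
have [ra ra0 ha] := half_space_near apsi dpsi.
have [rb rb0 hb] := pnt_near apsi dpsi (open_dom aphi) dphi.
have [rc rc0 hc] := half_space_near aphi dphi.
have [rd rd0 hd] := pnt_near aphi dphi (open_dom apsi) dpsi.
have ox : overlap phi psi (coord phi x) by exists x.
have ox' : overlap psi phi (coord psi x) by exists x.
have [[sphi _] [spsi _]] : compatible phi psi /\ compatible psi phi.
  by split; exact: (atlas_compatible (m := X)).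
have [V [f [oV Vx sf ff]]] := spsi ord0 (coord psi x) ox'.
have ex k := sphi k (coord phi x) ox.
pose VV k := sval (cid (ex k)).
have exF k := svalP (cid (ex k)).
pose g k := sval (cid (exF k)).
have gP k : [/\ open (VV k), VV k (coord phi x), smooth_on (VV k) (g k) &
   forall z, VV k z -> overlap phi psi z -> transition phi psi z 0 k = g k z].
  exact: (svalP (cid (exF k))).
(* The inward normal axis of [phi] at [x], seen in [psi]. The components of the transition have
   separate smooth extensions [g k], defined also for negative [t]. *)
pose gam (t : R) : E := \row_k g k (t *: ev ord0 + coord phi x).
have inter : exists2 r, 0 < r & forall z, box (coord psi x) r z -> overlap psi phi z.
  exists (Num.min (Num.min ra rb) (coord psi x 0 ord0)).
    by rewrite !lt_min ra0 rb0.
  move=> z bz.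
  have z0 : 0 <= z 0 ord0.
    have : `|z 0 ord0 - coord psi x 0 ord0| < coord psi x 0 ord0.
      by apply: lt_le_trans (bz ord0) _; rewrite ge_min lexx orbT.
    by rewrite ltr_norml => /andP[h _]; lra.
  have iz : (coord psi @` dom psi) z.
    by apply: ha => //; apply: sub_box bz; rewrite !ge_min lexx.
  have dz : dom phi (pnt psi z).
    by apply: hb => //; apply: sub_box bz; rewrite !ge_min lexx !orbT.
  by case: iz dz => w dw <-; rewrite pnt_coord// => dw'; exists w.
have [r r0 hr] := inter.
have [s s0 hs] := open_sub_box oV Vx.
have fx : f (coord psi x) = 0.
  by rewrite -ff// /transition pnt_coord.
have fmin z : box (coord psi x) (Num.min r s) z -> f (coord psi x) <= f z.
  move=> bz; rewrite fx.
  have oz : overlap psi phi z by apply: hr; apply: sub_box bz; rewrite ge_min lexx.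
  have Vz : V z by apply: hs; apply: sub_box bz; rewrite ge_min lexx orbT.
  rewrite -ff// /transition; case: oz => w [dw dw'] <-.
  by rewrite pnt_coord//; exact: coord_half.
have Cf := smooth_on_Cinf sf.
have df0 i : partial i f (coord psi x) = 0.
  apply: (min_derive0 (r := Num.min r s)) fmin; first by rewrite lt_min r0.
  exact: (Cinf_derivable Cf Vx).
have gam0 : gam 0 = coord psi x.
  apply/rowP => k; rewrite mxE scale0r add0r; have [_ Vk _ gk] := gP k.
  by rewrite -gk// /transition pnt_coord.
have dgam k : is_derive (0 : R) (1 : R) (fun t => gam t 0 k) (partial ord0 (g k) (coord phi x)).
  have [oVk Vk sg _] := gP k.
  have e0 : 0 *: ev ord0 + coord phi x = coord phi x by rewrite scale0r add0r.
  have := @is_derive_line R n (g k) (ev ord0) (coord phi x) 0.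
  rewrite e0 => /(_ (Cinf_derivable (smooth_on_Cinf sg) Vk)) h.
  by apply: near_eq_is_derive h; near=> t; rewrite mxE.
have df : is_derive (0 : R) (1 : R) (fun t => f (gam t)) 0.
  have := @chain_curve R n f gam _ 0 _ dgam; rewrite gam0.
  move=> /(_ (Cinf_differentiable oV Cf Vx)).
  by rewrite big1// => i _; rewrite df0 mulr0.
have [e e0 he] : exists2 e, 0 < e & forall t, 0 <= t < e -> f (gam t) = t.
  have : \forall t \near (0 : R), V (gam t) /\ forall k, VV k (t *: ev ord0 + coord phi x).
    have cl : {for 0, continuous (fun t : R => t *: ev ord0 + coord phi x)}.
      apply: (@continuousD _ _ _ (fun t : R => t *: ev ord0) (fun=> coord phi x)).
        exact: scalel_continuous.
      exact: cst_continuous.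
    have h1 : \forall t \near (0 : R), V (gam t).
      have cg : {for 0, continuous gam}.
        have : derivable gam 0 1.
          by apply/derivable_mxP => i j; rewrite ord1; have [] := dgam j.
        by move=> /derivable1_diffP; exact: differentiable_continuous.
      by apply: cg; rewrite gam0; exact: open_nbhs_nbhs.
    have h2 : \forall t \near (0 : R), forall k, VV k (t *: ev ord0 + coord phi x).
      apply: (@filter_forall _ _ (fun k t => VV k (t *: ev ord0 + coord phi x)) (nbhs (0 : R))) => k.
      have [oVk Vk _ _] := gP k.
      by apply: cl; rewrite scale0r add0r; exact: open_nbhs_nbhs.
    by apply: filterS2 h1 h2.
  move=> /nbhs_ballP[e /= e0 he].
  exists (Num.min e (Num.min rc rd)); first by rewrite !lt_min e0 rc0.
  move=> t /andP[t0]; rewrite !lt_min => /andP[te /andP[tc td]].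
  have [Vg Vk] : V (gam t) /\ forall k, VV k (t *: ev ord0 + coord phi x).
    by apply: he; rewrite /ball /= sub0r normrN ger0_norm.
  have bt q : t < q -> box (coord phi x) q (t *: ev ord0 + coord phi x).
    move=> tq k; rewrite coord_shift addrK normrM ger0_norm//.
    by case: (k == ord0); rewrite ?normr1 ?normr0 ?mulr1 ?mulr0//; exact: le_lt_trans tq.
  have it : (coord phi @` dom phi) (t *: ev ord0 + coord phi x).
    by apply: hc; [exact: bt|rewrite coord_shift eqxx mulr1 b0 addr0].
  have dt : dom psi (pnt phi (t *: ev ord0 + coord phi x)) by apply: hd => //; exact: bt.
  case: it => w dw ew; move: dt; rewrite -ew pnt_coord// => dw'.
  have gw : gam t = coord psi w.
    apply/rowP => k; rewrite mxE; have [_ _ _ gk] := gP k.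
    rewrite -gk//; last by exists w.
    by rewrite /transition -ew pnt_coord.
  rewrite gw -ff; first last.
  - by exists w.
  - by rewrite -gw.
  by rewrite /transition pnt_coord// ew coord_shift eqxx mulr1 b0 addr0.
have := right_derive_id e0 he df => /eqP.
by rewrite eq_sym oner_eq0.
Unshelve. all: by end_near. Qed.

End Charts.

(** * Metrics and geodesics in the charts of a manifold without boundary *)

Section ClosedManifold.
Local Notation coord := Defs.coord.
Context {R : realType} {n : nat} {M : topologicalType}.
Local Notation E := 'rV[R]_n.+1.
Implicit Types (phi psi : chart R n M) (x : M) (y z : E) (U W : set M).
Variable X : manifold R n M.
Hypothesis noboundary : boundary X = set0.

(** Charts take values in the half-space, but without boundary points the first coordinate is
    positive, so the image is open in the full Euclidean space and two-sided derivatives make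
    sense. *)
Lemma image_open phi U : atlas X phi -> open U -> open (coord phi @` (dom phi `&` U)).
Proof.
move=> aphi oU; rewrite openE => _ [x [dx Ux] <-].
have [r r0 hr] := half_space_near aphi dx.
have [s s0 hs] := pnt_near aphi dx oU Ux.
have c0 : 0 < coord phi x 0 ord0.
  rewrite lt_neqAle (coord_half aphi dx) andbT eq_sym; apply/eqP => e.
  have : boundary X x by exists phi.
  by rewrite noboundary.
apply/nbhs_boxP; exists (Num.min (coord phi x 0 ord0) (Num.min r s)).
  by rewrite !lt_min c0 r0.
move=> z bz.
have z0 : 0 <= z 0 ord0.
  have : `|z 0 ord0 - coord phi x 0 ord0| < coord phi x 0 ord0.
    by apply: lt_le_trans (bz ord0) _; rewrite ge_min lexx.
  by rewrite ltr_norml => /andP[h _]; lra.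
have iz : (coord phi @` dom phi) z.
  by apply: hr => //; apply: sub_box bz; rewrite !ge_min lexx !orbT.
have Uz : U (pnt phi z).
  by apply: hs => //; apply: sub_box bz; rewrite !ge_min lexx !orbT.
by case: iz Uz => w dw <-; rewrite (pnt_coord aphi dw) => Uw; exists w.
Qed.

(** Symmetry and invertibility are inherited, by congruence, from the diagonal matrix of signs in
    [has_signature]. *)
Lemma metric_chart (p : nat) (g : tensor2 R n M) W phi : metric X p W g -> open W ->
  atlas X phi ->
  [/\ mCinf (coord phi @` (dom phi `&` W)) (components g phi),
      forall y, (coord phi @` (dom phi `&` W)) y -> (components g phi y)^T = components g phi y &
      forall y, (coord phi @` (dom phi `&` W)) y -> components g phi y \in unitmx].
Proof.
move=> [_ sg sig] oW aphi.
have oV := image_open aphi oW.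
have sigE y : (coord phi @` (dom phi `&` W)) y -> has_signature p (components g phi y).
  by move=> [x [dx Wx] <-]; rewrite /components (pnt_coord aphi dx); exact: sig.
split.
- move=> i j; apply: smooth_on_Cinf; apply: smooth_in_open => //; exact: sg.
- move=> y /sigE [P uP eP].
  set A := components g phi y in eP *; set Dm := diag_mx _ in eP.
  have sD : Dm^T = Dm by exact: tr_diag_mx.
  have : P *m A^T *m P^T = P *m A *m P^T by rewrite eP -[in RHS]sD -eP !trmx_mul trmxK mulmxA.
  move/(congr1 (fun Z => invmx P *m Z *m invmx P^T)).
  have uPT : P^T \in unitmx by rewrite unitmx_tr.
  by rewrite !mulmxA mulVmx// !mul1mx -!mulmxA mulmxV// !mulmx1.
- move=> y /sigE [P uP eP].
  have : \det (P *m components g phi y *m P^T) != 0.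
    rewrite eP det_diag; apply/prodf_neq0 => i _; rewrite mxE.
    by case: ifP => _; rewrite ?oner_eq0// oppr_eq0 oner_eq0.
  rewrite !det_mulmx !mulf_eq0 !negb_or => /andP[/andP[_ h] _].
  by rewrite unitmxE unitfE.
Qed.

Lemma transition_Cinf phi psi U k : atlas X phi -> atlas X psi -> open U ->
  Cinf (coord phi @` (dom phi `&` (dom psi `&` U))) (fun z => transition phi psi z 0 k).
Proof.
move=> aphi apsi oU.
have oV := image_open aphi (open_dom apsi).
have [sm _] := atlas_compatible aphi apsi.
have C : Cinf (overlap phi psi) (fun z => transition phi psi z 0 k).
  by apply: smooth_on_Cinf; apply: smooth_in_open => //; exact: sm.
move=> j; apply: Ck_sub (C j) => z [x [dx [dx' _]] <-].
by exists x.
Qed.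

Lemma tensorial_chart (p : nat) (g : tensor2 R n M) W phi psi : metric X p W g -> open W ->
  atlas X phi -> atlas X psi ->
  forall y i j, (coord phi @` (dom phi `&` (dom psi `&` W))) y ->
  components g phi y i j = \sum_k \sum_l
    partial i (fun z => transition phi psi z 0 k) y *
    components g psi (transition phi psi y) k l *
    partial j (fun z => transition phi psi z 0 l) y.
Proof.
move=> [tg _ _] oW aphi apsi y i j Vy.
have oV := image_open aphi (open_dom apsi).
have [sm _] := atlas_compatible aphi apsi.
have sm' : smooth_map_on (overlap phi psi) (transition phi psi).
  by move=> k; apply: smooth_in_open => //; exact: sm.
have CF k : Cinf (overlap phi psi) (fun z => transition phi psi z 0 k).
  exact: smooth_on_Cinf.
case: Vy => x [dx [dx' Wx]] ey.
have oy : overlap phi psi (coord phi x) by exists x.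
have := tg phi psi x aphi apsi Wx dx dx' (overlap phi psi) (transition phi psi) oV oy sm'
  (fun _ _ _ => erefl).
rewrite ey in oy * => gE.
have e1 : components g phi y = g phi x by rewrite /components -ey (pnt_coord aphi dx).
have e2 : components g psi (transition phi psi y) = g psi x.
  by rewrite /components /transition -ey (pnt_coord aphi dx) (pnt_coord apsi dx').
rewrite e1 e2 gE -mulmxA mxE; apply: eq_bigr => k _.
rewrite (jacobianE _ _ oV CF oy) mxE mulr_sumr; apply: eq_bigr => l _.
by rewrite mxE (jacobianE _ _ oV CF oy) mulrA.
Qed.

(** The equation is known in the one chart [phi], and [geodesic_transfer] supplies it in every
    other. Time 0 is excluded because the curve will start outside [W]. *)
Lemma chart_geodesic (p : nat) (g : tensor2 R n M) W phi (d : R) (c : R -> E)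
    (v : R -> 'I_n.+1 -> R) :
  metric X p W g -> open W -> atlas X phi ->
  (forall t, 0 < t < d -> [/\ (coord phi @` (dom phi `&` W)) (c t),
     forall k, is_derive t (1 : R) (fun s => c s 0 k) (v t k) &
     forall k, is_derive t (1 : R) (fun s => v s k)
       (- \sum_i \sum_j christoffel (components g phi) k i j (c t) * v t i * v t j)]) ->
  geodesic X W g `]0, d[%classic (fun t => pnt phi (c t)).
Proof.
move=> mg oW aphi hc.
have inJ t : `]0, d[%classic t -> 0 < t < d by rewrite /= in_itv.
have cc t : 0 < t < d -> {for t, continuous c}.
  move=> td; have [_ h _] := hc t td.
  have : derivable c t 1 by apply/derivable_mxP => i j; rewrite ord1; have [] := h j.
  by move=> /derivable1_diffP; exact: differentiable_continuous.
have oD : open (coord phi @` (dom phi `&` [set: M])) := image_open aphi openT.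
have cpnt y : (coord phi @` dom phi) y -> {for y, continuous (pnt phi)}.
  move=> [x dx <-]; have [_ _ _ _ cp] := atlas_chart aphi.
  rewrite setIT in oD.
  move: cp; rewrite continuous_open_subspace// => /(_ (coord phi x)); apply.
  by rewrite inE; exists x.
have Wt t : 0 < t < d -> exists x, [/\ dom phi x, W x, coord phi x = c t & pnt phi (c t) = x].
  move=> /hc[[x [dx Wx] ex] _ _]; exists x; split=> //.
  by rewrite -ex (pnt_coord aphi dx).
split.
  move=> t /inJ td; have [x [dx Wx ex px]] := Wt t td; split; first by rewrite px.
  apply: (@continuous_comp _ _ _ c (pnt phi)); first exact: cc.
  by apply: cpnt; exists x.
move=> psi t apsi /inJ td dpsi k.
have [x [dx Wx ex px]] := Wt t td.
rewrite px in dpsi.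
set V := coord phi @` (dom phi `&` (dom psi `&` W)).
have oV : open V by apply: image_open => //; exact: (openI (open_dom apsi) oW).
have Vt : V (c t) by exists x.
have oW' : open (coord psi @` (dom psi `&` W)) by exact: image_open.
have [CG symG unitG] := metric_chart mg oW aphi.
have [CH symH unitH] := metric_chart mg oW apsi.
have VS : V `<=` coord phi @` (dom phi `&` W).
  by move=> _ [z [dz [_ Wz]] <-]; exists z.
have CGV : mCinf V (components g phi) by move=> i j m; exact: Ck_sub VS (CG i j m).
have FW y : V y -> (coord psi @` (dom psi `&` W)) (transition phi psi y).
  by move=> [z [dz [dz' Wz]] <-]; exists z => //; rewrite /transition (pnt_coord aphi dz).
have near_c : \forall s \near t, V (c s) /\
    forall i, is_derive s (1 : R) (fun u => c u 0 i) (v s i).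
  have h1 : \forall s \near t, V (c s) by apply: (cc t td); exact: open_nbhs_nbhs.
  have h2 : \forall s \near t, `]0, d[%classic s.
    by apply: open_nbhs_nbhs; split; [exact: interval_open|by rewrite /= in_itv].
  by apply: filterS2 h1 h2 => s Vs /inJ/hc[_ h _].
have [_ _ dv] := hc t td.
have [h1 h2] := geodesic_transfer oV oW' CGV (fun y Vy => symG y (VS y Vy))
  (fun y Vy => unitG y (VS y Vy)) CH symH unitH
  (fun k => transition_Cinf k aphi apsi oW) FW (tensorial_chart mg oW aphi apsi)
  Vt near_c dv.
pose w s k := \sum_i v s i * partial i (fun z => transition phi psi z 0 k) (c s).
have e1 : \forall s \near t, forall k, derive1 (curve_coord psi (fun t => pnt phi (c t)) k) s = w s k.
  apply: filterS h1 => s hs k'; rewrite derive1E.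
  by have [_] := hs k'.
have dw k' := h2 k'.
have e2 k' : \forall s \near t, w s k' = derive1 (curve_coord psi (fun t => pnt phi (c t)) k') s.
  by apply: filterS e1 => s /(_ k') ->.
have dd k' : is_derive t (1 : R) (derive1 (curve_coord psi (fun t => pnt phi (c t)) k'))
    (- \sum_i \sum_j christoffel (components g psi) k' i j (transition phi psi (c t)) *
      w t i * w t j).
  exact: near_eq_is_derive (e2 k') (dw k').
have e3 k' := nbhs_singleton e1 k'.
split.
- by have [] := nbhs_singleton h1 k.
- by have [] := dd k.
- rewrite derive1E; have [_ ->] := dd k.
  rewrite -[coord psi (pnt phi (c t))]/(transition phi psi (c t)).
  under [X in _ + X]eq_bigr do under eq_bigr do rewrite !e3.
  by rewrite addNr.
Qed.

End ClosedManifold.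

(** * The Einstein factor *)

Section EinsteinConstant.
Local Notation coord := Defs.coord.
Context {R : realType} {n : nat} {M : topologicalType}.
Local Notation E := 'rV[R]_n.+1.
Implicit Types (phi psi : chart R n M) (x : M) (y z : E) (U W : set M).
Variable X : manifold R n M.
Hypothesis noboundary : boundary X = set0.
Hypothesis dim2 : (2 < n.+1)%N.
Variables (p : nat) (W : set M) (gp : tensor2 R n M) (lam : M -> R).
Hypothesis oW : open W.
Hypothesis mgp : metric X p W gp.
Hypothesis einstein_gp : forall phi x, atlas X phi -> W x -> dom phi x ->
  ricci_tensor gp phi x = lam x *: gp phi x.

Lemma einstein_chart phi y : atlas X phi -> (coord phi @` (dom phi `&` W)) y ->
  ricci (components gp phi) y = lam (pnt phi y) *: components gp phi y.
Proof.
move=> aphi [x [dx Wx] <-].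
by rewrite /components (pnt_coord aphi dx); exact: einstein_gp.
Qed.

Lemma einstein_locally_constant x : W x -> \forall w \near x, lam w = lam x.
Proof.
move=> Wx; have [phi aphi dx] := atlas_cover X x.
have oV := image_open noboundary aphi oW.
have [CG symG unitG] := metric_chart noboundary mgp oW aphi.
have eG y := einstein_chart (y := y) aphi.
have Vx : (coord phi @` (dom phi `&` W)) (coord phi x) by exists x.
have [r r0 rV] := open_sub_box oV Vx.
have Cl := einstein_Cinf oV CG symG unitG eG.
have nb : nbhs (coord phi x) (box (coord phi x) r) by apply/nbhs_boxP; exists r.
apply: filterS (coord_near aphi dx nb) => z [dz bz].
have h := @box_increment R n (fun y => lam (pnt phi y)) (coord phi x) r (fun=> 0) 0.
have {h} : `|lam (pnt phi (coord phi z)) - lam (pnt phi (coord phi x)) -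
    \sum_i (coord phi z 0 i - coord phi x 0 i) * 0| <=
    0 * \sum_i `|coord phi z 0 i - coord phi x 0 i|.
  apply: h => // [i y /rV Vy|i y /rV Vy|]; last exact: box_center.
  - exact: (Cinf_derivable Cl Vy).
  - by rewrite (schur oV CG symG unitG eG i dim2 Vy) subrr normr0.
rewrite big1 ?mul0r => [|i _]; last by rewrite mulr0.
rewrite subr0 normr_le0 subr_eq0 => /eqP.
by rewrite (pnt_coord aphi dz) (pnt_coord aphi dx).
Qed.

Variable g : tensor2 R n M.
Hypothesis mg : metric X p setT g.
Hypothesis conf : conformal X W g gp.
Hypothesis complete : geodesically_complete X W gp.

Lemma gen_dense (x0 : E) (a b : 'I_n.+1) (r : R) y : 0 < r ->
  exists2 q, box y r q & gen x0 a b q.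
Proof.
move=> r0; exists (\row_k (if y 0 k == x0 0 k then y 0 k + r / 2 else y 0 k)).
  move=> k; rewrite mxE; case: ifP => _; last by rewrite subrr normr0.
  by rewrite addrC addKr gtr0_norm; lra.
suff h k : (\row_k (if y 0 k == x0 0 k then y 0 k + r / 2 else y 0 k)) 0 k != x0 0 k.
  by rewrite /gen !h.
rewrite mxE; case: ifP => [/eqP ->|/negbT//].
by rewrite -subr_eq0 addrC addKr; apply: lt0r_neq0; lra.
Qed.

(** Completeness excludes the second branch of [local_dichotomy] at a point outside [W]. The
    conclusion is restricted to [W] since [lam] carries no information elsewhere. *)
Lemma einstein_zero_at_infinity phi x (a b : 'I_n.+1) : atlas X phi -> dom phi x ->
  a != b -> ~ W x ->
  (forall w, dom phi w ->
    (coord phi w 0 a != coord phi x 0 a) || (coord phi w 0 b != coord phi x 0 b) -> W w) ->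
  \forall w \near x, W w -> lam w = 0.
Proof.
move=> aphi dx ab nWx offW.
have [f [sf f0 fE]] := conf.
set D := coord phi @` dom phi; set V := coord phi @` (dom phi `&` W).
set x0 := coord phi x.
have oV : open V := image_open noboundary aphi oW.
have oD : open D.
  by have := image_open noboundary aphi openT; rewrite setIT.
have VD : V `<=` D by move=> _ [z [dz _] <-]; exists z.
have Dx0 : D x0 by exists x.
have [CG symG unitG] := metric_chart noboundary mg openT aphi.
rewrite setIT -/D in CG symG unitG.
have [CGp symGp unitGp] := metric_chart noboundary mgp oW aphi.
pose omega y := f (pnt phi y).
have omega0 y : V y -> 0 < omega y.
  by move=> [z [dz Wz] <-]; rewrite /omega (pnt_coord aphi dz); exact: f0.
have Comega : Cinf V omega.
  by apply: smooth_on_Cinf; apply: smooth_in_open => //; exact: sf.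
(* [conf] gives [gp = omega^2 g]; the inverse factor is the one that may extend by 0. *)
pose sigma y := (omega y)^-1.
have Csigma : Cinf V sigma.
  by apply: CinfV => // y /omega0 /lt0r_neq0.
have sigma0 y : V y -> 0 < sigma y by move=> /omega0; rewrite invr_gt0.
have GpE y : V y -> components gp phi y = (sigma y)^-2 *: components g phi y.
  move=> [z [dz Wz] <-]; rewrite /sigma /omega /components (pnt_coord aphi dz).
  by rewrite exprVn invrK; exact: fE.
have [r1 r10 r1D] := open_sub_box oD Dx0.
have offV y : box x0 r1 y -> off x0 a b y -> V y.
  by move=> /r1D [z dz <-] oz; exists z => //; split=> //; exact: offW.
have [[r /andP[r0 _] hr]|] := local_dichotomy dim2 oD oV VD Dx0 CG symG unitG CGp
  Csigma sigma0 GpE (fun y => einstein_chart (y := y) aphi) ab r10 offV.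
  have nb : nbhs x0 (box x0 r) by apply/nbhs_boxP; exists r.
  apply: filterS (coord_near aphi dx nb) => z [dz bz] Wz.
  (* The dichotomy gives [lam = 0] on [gen] only. A point [z] of [W] on one of the hyperplanes is
     reached through a nearby generic point with the same value of [lam]. *)
  set U := [set z' | lam z' = lam z].
  have nU : nbhs z U := einstein_locally_constant Wz.
  have oO : open (coord phi @` (dom phi `&` U^°)).
    exact: (image_open noboundary aphi (@open_interior _ U)).
  have Oz : (coord phi @` (dom phi `&` U^°)) (coord phi z) by exists z.
  have [s s0 hs] := open_sub_box oO Oz.
  have [t t0 ht] := open_sub_box (open_box (x := x0) (r := r)) bz.
  have st0 : 0 < Num.min s t by rewrite lt_min s0.
  have [q bq gq] := gen_dense x0 a b (coord phi z) st0.
  have := hr q; rewrite -/x0 => /(_ _ gq) <-; last first.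
    by apply: ht; apply: sub_box bq; rewrite ge_min lexx orbT.
  have [z' [dz' /interior_subset Uz'] <-] : (coord phi @` (dom phi `&` U^°)) q.
    by apply: hs; apply: sub_box bq; rewrite ge_min lexx.
  by rewrite (pnt_coord aphi dz').
move=> [d [c [v [d0 c0 dc hc]]]]; exfalso; apply: nWx.
have td t : 0 < t < d -> `|t| < d by move=> /andP[t0 h]; rewrite gtr0_norm.
have geo : geodesic X W gp `]0, d[%classic (fun t => pnt phi (c t)).
  apply: (chart_geodesic noboundary mgp oW aphi) => t htd; have [Vc dv] := hc t htd.
  by split=> // k; apply: dc; exact: td.
have oJ : open (`]0, d[%classic : set R) by exact: interval_open.
have nJ : (`]0, d[%classic : set R) !=set0.
  by exists (d / 2); rewrite /= in_itv /=; lra.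
have [gamma' [gW _] ge] := complete oJ (@interval_is_interval _ _) nJ geo.
have [W0 cg] := gW 0 I.
suff <- : gamma' 0 = x by [].
have cc : {for 0, continuous c}.
  have : derivable c 0 1.
    by apply/derivable_mxP => i j; rewrite ord1; have [] := dc 0 j; rewrite ?normr0.
  by move=> /derivable1_diffP; exact: differentiable_continuous.
have cp : {for c 0, continuous (pnt phi)}.
  rewrite c0.
  have [_ _ _ _] := atlas_chart aphi.
  by rewrite continuous_open_subspace// => /(_ x0); apply; rewrite inE.
(* The complete geodesic and the chart curve agree for small positive times, so they have the same
   right limit at 0, by the Hausdorff property; the former lies in [W] there and the latter is
   [x]. *)
have l1 : (gamma' @ 0^'+) --> gamma' 0 by apply: cvg_at_right_filter.
have l2 : ((pnt phi \o c) @ 0^'+) --> x.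
  apply: cvg_at_right_filter; rewrite -[X in _ --> X](pnt_coord aphi dx) -/x0 -c0.
  exact: (continuous_comp cc cp).
apply: (cvg_unique (manifold_hausdorff X) l1).
apply: cvg_trans l2; apply: near_eq_cvg; near=> t.
by rewrite /= ge//= in_itv /=; apply/andP; split; near: t;
  [exact: nbhs_right_gt|exact: nbhs_right_lt].
Unshelve. all: by end_near. Qed.

End EinsteinConstant.

(** * Auxiliary facts and the global argument *)

Section ConformalClass.
Local Notation coord := Defs.coord.
Context {R : realType} {n : nat} {M : topologicalType}.
Local Notation E := 'rV[R]_n.+1.
Variable X : manifold R n M.

Lemma smooth_on_cst (V : set E) (r : R) : smooth_on V (fun=> r).
Proof.
move=> s y _; have [r' ->] : exists r' : R, iter_partial s (fun=> r) = fun=> r'.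
  elim: s => [|i s [r' IHs]]; first by exists r.
  exists 0; rewrite /= -/(iter_partial s _) IHs; apply/funext => z.
  exact: derive_cst.
by split; [exact: cst_continuous|move=> i; exact: derivable_cst].
Qed.

Lemma conformal_refl (W : set M) (g : tensor2 R n M) : conformal X W g g.
Proof.
exists (fun=> 1); split=> // [phi aphi y _|phi x *]; last by rewrite expr1n scale1r.
by exists setT, (fun=> 1); split=> //; [exact: openT|exact: smooth_on_cst].
Qed.

Lemma boundary_embedded : embedded_submanifold X 1 (boundary X).
Proof.
move=> x [phi [aphi dx bx]]; exists phi, [set ord0]%SET, 0; split=> //.
  by rewrite cards1.
move=> z dz; split.
  move=> [psi [apsi dz' bz]] i; rewrite inE => /eqP ->; rewrite mxE.
  exact: (boundary_coord apsi aphi dz' dz bz).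
move=> h; exists phi; split=> //; have := h ord0; rewrite mxE; apply.
by rewrite inE.
Qed.

End ConformalClass.

Lemma connected_near_dichotomy (T : topologicalType) (P : T -> Prop) :
  connected [set: T] ->
  (forall x : T, (\forall y \near x, P y) \/ (\forall y \near x, ~ P y)) ->
  (forall x, P x) \/ (forall x, ~ P x).
Proof.
move=> cT loc.
have oP : open [set x | P x].
  rewrite openE => x Px; case: (loc x) => // h; exfalso.
  exact: nbhs_singleton h Px.
have oN : open [set x | ~ P x].
  rewrite openE => x nPx; case: (loc x) => // h; exfalso.
  by apply: nPx; exact: nbhs_singleton h.
have [[x Px]|ne] := pselect (exists x, P x); last first.
  by right=> x Px; apply: ne; exists x.
left=> y; suff -> : P = setT by [].
apply: cT; first by exists x.
- by exists P => //; rewrite setTI.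
- by exists P; [rewrite -[P]setCK closedC|rewrite setTI].
Qed.

Theorem theorem6p9 (R : realType) (n p : nat) (hn : (3 <= n.+1)%N)
    (hp : (p <= n.+1)%N)
    (M : topologicalType) (X : manifold R n M)
    (hcompact : compact [set: M]) (hconnected : connected [set: M])
    (c : set (tensor2 R n M)) (hc : conformal_structure X p c)
    (Mplus : set M) (hopen : open Mplus) (hdense : dense Mplus)
    (hsetting :
      ~` Mplus = boundary X \/
      closed_manifold X [set: M] /\
      exists (k : nat) (S : set M),
        [/\ (2 <= k)%N, embedded_submanifold X k S & ~` Mplus `<=` S])
    (gplus : tensor2 R n M) (hmetric : metric X p Mplus gplus)
    (hcomplete : geodesically_complete X Mplus gplus)
    (heinstein : einstein X Mplus gplus)
    (hnotflat : ~ ricci_flat X Mplus gplus)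
    (hconformal : conformal_class X p Mplus gplus =
                  conformal_restriction X p c Mplus) :
  (closed_manifold X Mplus /\ Mplus = [set: M]) \/
  [/\ ~` Mplus = boundary X, boundary X !=set0 &
      embedded_submanifold X 1 (boundary X)].
Proof.
case: hsetting => [eb|[[_ bT] [k [S [k2 eS sub]]]]].
  (* An empty boundary makes setting (1) an instance of conclusion (a). *)
  have [e|/set0P ne] := eqVneq (boundary X) set0; last first.
    by right; split=> //; exact: boundary_embedded.
  have eM : Mplus = setT by rewrite -[LHS]setCK eb e setC0.
  by left; rewrite eM; split=> //; split=> //; rewrite e set0I.
have nb : boundary X = set0 by rewrite -[LHS]setIT.
suff eM : Mplus = setT by left; rewrite eM.
have [lam hlam] := heinstein.
have [g0 mg0 ec] := hc.
(* As a member of its own class, [gplus] belongs to the restriction of [c]; this produces a metric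
   [g] of [c] on all of [M] that is conformal to it on [Mplus]. *)
have : conformal_class X p Mplus gplus gplus by split=> //; exact: conformal_refl.
rewrite hconformal => -[g + [_ cg]]; rewrite ec => -[mg _].
(* A condition on germs guarded by [Mplus], so that it also makes sense at the points outside, where
   [lam] is arbitrary. *)
pose flat (x : M) := \forall y \near x, Mplus y -> lam y = 0.
have near_Mplus (U : set M) (x : M) : nbhs x U -> exists2 y, U y & Mplus y.
  move=> nU; have [y [Uy My]] : (U^° `&` Mplus) !=set0.
    by apply: hdense; [exists x; exact: nbhs_singleton (nbhs_interior nU)|exact: open_interior].
  by exists y => //; exact: interior_subset.
have dim2 : (2 < n.+1)%N by [].
have lc x : Mplus x -> \forall y \near x, lam y = lam x.
  exact: (einstein_locally_constant nb dim2 hopen hmetric hlam).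
have flat_out x : ~ Mplus x -> flat x.
  move=> nx; have [phi [I [e [aphi dx cI hS]]]] := eS x (sub x nx).
  (* Two of the fixed coordinates suffice: leaving their common level set leaves [S], hence lies in
     [Mplus]. *)
  have : (1 < #|I|)%N by rewrite cI.
  move=> /card_gt1P[a [b [aI bI ab]]].
  apply: (einstein_zero_at_infinity nb dim2 hopen hmetric hlam mg cg hcomplete aphi dx ab nx).
  move=> w dw ow; apply: contrapT => nw.
  have /(hS w dw) Sw := sub w nw; have /(hS x dx) Sx := sub x nx.
  by move: ow; rewrite !Sw// !Sx// !eqxx.
have near_flat x : flat x -> \forall y \near x, flat y.
  by move=> /nbhs_interior; apply.
have near_flat_or (x : M) : (\forall y \near x, flat y) \/ (\forall y \near x, ~ flat y).
  have [fx|nfx] := pselect (flat x); first by left; exact: near_flat.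
  right; have Mx : Mplus x by apply: contrapT => /flat_out.
  (* Then [lam] keeps this nonzero value near [x], and by density every neighbourhood of a nearby
     point meets [Mplus], so no such point is flat. *)
  have lx : lam x != 0.
    by apply/eqP => lx; apply: nfx; apply: filterS (lc x Mx) => y ->.
  have /nbhs_interior h := lc x Mx; apply: filterS h => y hy fy.
  have [z [lz fz] Mz] := near_Mplus _ _ (filterI hy fy).
  by move: lx; rewrite -lz fz// eqxx.
(* If all points are flat then [gplus] is Ricci flat; if none is, [flat_out] leaves no point outside
   [Mplus]. *)
have [allf|nof] := connected_near_dichotomy hconnected near_flat_or.
  exfalso; apply: hnotflat => phi x aphi Mx dx.
  by rewrite hlam// (nbhs_singleton (allf x))// scale0r.
apply/seteqP; split=> // x _; apply: contrapT => /flat_out; exact: nof.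
Qed.
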